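(* Fix $K\ge1$. Let $m:\mathbb{R}^c\to\mathbb{R}$ be Lipschitz continuous with respect to the supremum norm, i.e., there is $L>0$ with $|m(\mathbf{x})-m(\mathbf{y})|\le L\|\mathbf{x}-\mathbf{y}\|_\infty$ for all $\mathbf{x},\mathbf{y}\in\mathbb{R}^c$. Under the sequence of location-shift local alternatives described in the context and as $N\to\infty$, $$T_{N,c,K}^{\phi,m}\ \rightsquigarrow\ T_{\infty,c,K}^{\phi,m,\mathrm{loc}}:=m\bigg(\Big(\pi_\ell\sum_{k=1}^{K}\sum_{r=1}^{2}2^{-1}b_k(\phi)Z_{k,r,\ell}^2\Big)_{\ell=1}^{c}\bigg),$$ where $\{\mathbf{Z}_{k,r}=(Z_{k,r,1},\ldots,Z_{k,r,c})\sim\mathcal{N}_c(\boldsymbol\eta_{k,r},\mathbf{S}):1\le k\le K,\ r=1,2\}$ is a collection of mutually independent random vectors, with $\mathbf{S}:=\operatorname{diag}(1/\pi_1,\ldots,1/\pi_c)-\mathbf{1}_c\mathbf{1}_c^\top$ and $\boldsymbol\eta_{k,r}:=(\eta_{k,r,1},\ldots,\eta_{k,r,c})^\top$ given by $\eta_{k,r,\ell}:=\beta_{k,r}(\boldsymbol\pi-\mathbf{e}_\ell)^\top\boldsymbol\delta$, where $$\beta_{k,1}=-2\pi\sqrt2\,k\int_0^{2\pi}\sin(2\pi kF(\theta))f(\theta)^2\,\mathrm{d}\theta,\qquad \beta_{k,2}=2\pi\sqrt2\,k\int_0^{2\pi}\cos(2\pi kF(\theta))f(\theta)^2\,\mathr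m{d}\theta.$$
   Context: Local model. Fix $c\ge2$. Let $F$ be the cdf on $[0,2\pi)$ (started at $\theta=0$) of a circular distribution with density $f$ whose $2\pi$-periodic extension (also denoted $f$) belongs to $C^1(\mathbb{R})$. Fix $\boldsymbol\delta=(\delta_1,\ldots,\delta_c)^\top\in\mathbb{R}^c$ and set $\Delta_{\ell,N}:=N^{-1/2}\delta_\ell$. For each $N=\sum_{\ell=1}^c n_\ell$ with $\min_\ell n_\ell\ge2$ and each $\ell=1,\ldots,c$, $\Theta_{N,1}^{(\ell)},\ldots,\Theta_{N,n_\ell}^{(\ell)}$ are iid random variables on $[0,2\pi)$ with density $f_{\ell,N}(\theta)=f(\theta+\Delta_{\ell,N})$, and the $c$ samples are mutually independent. Uniform scores. $r_i^{(\ell)}\in\{1,\ldots,N\}$ is the rank of $\Theta_{N,i}^{(\ell)}$ in the pooled sample of size $N$ (ties have probability zero) and $c_i^{(\ell)}:=2\pi r_i^{(\ell)}/N$. Kernel. $\phi:[-1,1]\to\mathbb{R}$ is square integrable with respect to the weight $(1-t^2)^{-1/2}$, with Chebyshev coefficients $b_k(\phi)=\frac{2}{\pi(1+\delta_{k0})}\int_{-1}^1\phi(t)\cos(k\cos^{-1}t)(1-t^2)^{-1/2}\,\mathrm{d}t$ (here $\delta_{k0}$ is the Kronecker delta) satisfying $b_0(\phi)=0$ and $\sum_{k\ge1}|b_k(\phi)|<\infty$, and $\phi(\cos\theta)=\sum_{k\ge1}b_k(\phi)\cos(k\theta)$ for all $\theta$. Statistic. With $g_{k,1}(\theta):=\sqrt2\cos(k\theta)$,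 $g_{k,2}(\theta):=\sqrt2\sin(k\theta)$, and $G_{k,r,\ell,N}:=n_\ell^{-1}\sum_{i=1}^{n_\ell}g_{k,r}(c_i^{(\ell)})$, the truncated statistic is $$T_{N,c,K}^{\phi,m}:=m\bigg(\Big(\sum_{k=1}^{K}\sum_{r=1}^{2}2^{-1}b_k(\phi)\,n_\ell\,G_{k,r,\ell,N}^2\Big)_{\ell=1}^c\bigg).$$ Notation and regime. $N\to\infty$ with $c$ fixed and $\pi_{\ell,N}:=n_\ell/N\to\pi_\ell\in(0,1)$ for all $\ell$; $\boldsymbol\pi:=(\pi_1,\ldots,\pi_c)^\top$; $\mathbf{e}_\ell$ is the $\ell$th canonical vector of $\mathbb{R}^c$; $\mathbf{1}_c$ is the all-ones vector; $\rightsquigarrow$ denotes convergence in distribution. *)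

(* Defs.v *)
From HB Require Import structures.
From mathcomp Require Import all_boot all_order all_algebra.
From mathcomp Require Import all_classical all_reals all_analysis.

Set Implicit Arguments.
Unset Strict Implicit.
Unset Printing Implicit Defensive.

Import Order.TTheory GRing.Theory Num.Theory.
Import numFieldNormedType.Exports.

Local Open Scope classical_set_scope.
Local Open Scope ring_scope.

Section probability_notions.
Context {R : realType}.

(* Taking A i := setT for the indices outside a subfamily gives the product
   rule for that subfamily, so for a finite index type a single family of
   events is enough. *)
Definition mutually_independent d (T : measurableType d)
    (P : probability T R) (I : finType) d' (E : measurableType d')
    (X : I -> {RV P >-> E}) : Prop :=
  forall A : I -> set E, (forall i, measurable (A i)) ->
    P (\bigcap_i (X i @^-1` A i)) = (\prod_(i : I) P (X i @^-1` A i))%E.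

(* X takes its values in [0, 2 pi) and has density g there. *)
Definition has_circular_density d (T : measurableType d)
    (P : probability T R) (X : {RV P >-> R}) (g : R -> R) : Prop :=
  (forall w, X w \in `[0, 2 * pi[) /\
  forall A : set R, measurable A ->
    distribution P X A =
    (\int[lebesgue_measure]_(x in A `&` `[0%R, (2 * pi)%R[) (g x)%:E)%E.

(* The laws may live on different probability spaces.  Expectations of
   non-measurable maps are meaningless, hence the measurability clauses. *)
Definition cvg_in_distribution
    (d : nat -> measure_display) (T : forall v, measurableType (d v))
    (P : forall v, probability (T v) R) (X : forall v, T v -> R)
    d' (T' : measurableType d') (Q : probability T' R) (Y : T' -> R) : Prop :=
  [/\ forall v, measurable_fun [set: T v] (X v),
      measurable_fun [set: T'] Y &
      forall h : R -> R, continuous h ->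
        (exists M : R, forall x, `|h x| <= M) ->
        ('E_(P v)[h \o X v])%E @[v --> \oo] --> ('E_Q[h \o Y])%E].

(* One-dimensional normal law with mean a and variance v.  The degenerate case
   is a point mass, whereas the library's normal_prob a 0 is the uniform law on
   [0, 1]. *)
Definition gaussian_law (a v : R) : set R -> \bar R :=
  if 0 < v then normal_prob a (Num.sqrt v) else \d_a.

(* X ~ N_c(eta, S), with S possibly singular: every linear combination
   t^T X is normal with mean t^T eta and variance t^T S t. *)
Definition multinormal d (T : measurableType d) (P : probability T R)
    (c : nat) (X : {RV P >-> c.-tuple R}) (eta : 'cV[R]_c) (S : 'M[R]_c)
    : Prop :=
  forall t : 'cV[R]_c,
    0 <= (t^T *m S *m t) 0 0 /\
    forall A : set R, measurable A ->
      P [set w | A (\sum_(l < c) t l 0 * tnth (X w) l)] =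
      gaussian_law ((t^T *m eta) 0 0) ((t^T *m S *m t) 0 0) A.

End probability_notions.

Section uniform_scores.
Context {R : realType}.

(* f is the 2 pi-periodic extension, of class C^1 on the whole line, of a
   density on [0, 2 pi). *)
Definition C1_circular_density (f : R -> R) : Prop :=
  [/\ forall x, 0 <= f x,
      (\int[lebesgue_measure]_(x in `[0%R, (2 * pi)%R[) (f x)%:E = 1)%E,
      forall x, f (x + 2 * pi) = f x,
      forall x, derivable f x 1 &
      continuous (derive1 f)].

Definition circular_cdf (f : R -> R) (theta : R) : R :=
  \int[lebesgue_measure]_(x in `[0, theta]) f x.

(* The two values 0 and 1 of r : 'I_2 stand for r = 1 (cosine)
   and r = 2 (sine). *)
Definition trig_g (k : nat) (r : 'I_2) (theta : R) : R :=
  Num.sqrt 2 *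
  (if r == ord0 then cos (k%:R * theta) else sin (k%:R * theta)).

Definition beta_coef (f : R -> R) (k : nat) (r : 'I_2) : R :=
  let F := circular_cdf f in
  if r == ord0 then
    - 2 * pi * Num.sqrt 2 * k%:R *
      \int[lebesgue_measure]_(x in `[0, 2 * pi])
        (sin (2 * pi * k%:R * F x) * f x ^+ 2)
  else
    2 * pi * Num.sqrt 2 * k%:R *
      \int[lebesgue_measure]_(x in `[0, 2 * pi])
        (cos (2 * pi * k%:R * F x) * f x ^+ 2).

(* At t = -1 and t = 1 the weight is 0 here (0^-1 = 0), a null set. *)
Definition chebyshev_weight (t : R) : R := (Num.sqrt (1 - t ^+ 2))^-1.

Definition chebyshev_coef (phi : R -> R) (k : nat) : R :=
  2 / (pi * (1 + (k == 0%N)%:R)) *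
  \int[lebesgue_measure]_(t in `[-1, 1])
    (phi t * cos (k%:R * acos t) * chebyshev_weight t).

(* phi : [-1, 1] -> R is represented by a total function, of which only the
   values on [-1, 1] are used. *)
Definition chebyshev_kernel (phi : R -> R) : Prop :=
  [/\ measurable_fun (`[-1, 1] : set R) phi,
      lebesgue_measure.-integrable (`[-1, 1] : set R)
        (fun t => (phi t ^+ 2 * chebyshev_weight t)%:E),
      chebyshev_coef phi 0 = 0,
      cvgn (series (fun k => `|chebyshev_coef phi k.+1|)) &
      forall theta : R,
        series (fun k =>
          chebyshev_coef phi k.+1 * cos (k.+1%:R * theta)) @ \oo
        --> phi (cos theta)].

Section statistic.
Variables (c : nat) (n : 'I_c -> nat).

Definition pooled_size : nat := (\sum_(l < c) n l)%N.

Variable x : forall l : 'I_c, 'I_(n l) -> R.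

(* Number of pooled observations not exceeding x l i: the rank of x l i, in
   1, ..., N, when there are no ties. *)
Definition pooled_rank (l : 'I_c) (i : 'I_(n l)) : nat :=
  (\sum_(l' < c) \sum_(i' < n l') (x i' <= x i)%R)%N.

Definition uniform_score (l : 'I_c) (i : 'I_(n l)) : R :=
  2 * pi * (pooled_rank i)%:R / pooled_size%:R.

Definition score_mean (k : nat) (r : 'I_2) (l : 'I_c) : R :=
  (n l)%:R^-1 * \sum_(i < n l) trig_g k r (uniform_score i).

(* The frequency ranging over 1, ..., K is k.+1 with k < K. *)
Definition truncated_statistic (phi : R -> R) (m : 'rV[R]_c -> R) (K : nat)
    : R :=
  m (\row_l \sum_(k < K) \sum_(r < 2)
       2^-1 * chebyshev_coef phi k.+1 * (n l)%:R *
       score_mean k.+1 r l ^+ 2).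

End statistic.

Section limit.
Variables (c : nat) (p delta : 'cV[R]_c).

Definition limit_cov : 'M[R]_c :=
  diag_mx (\row_l (p l 0)^-1) - (const_mx 1 : 'cV[R]_c) *m (const_mx 1)^T.

Definition limit_mean (f : R -> R) (k : nat) (r : 'I_2) : 'cV[R]_c :=
  \col_l (beta_coef f k r * ((p - delta_mx l 0)^T *m delta) 0 0).

(* z k r is the value of the vector Z_{k+1, r+1}. *)
Definition limit_statistic (phi : R -> R) (m : 'rV[R]_c -> R) (K : nat)
    (z : 'I_K -> 'I_2 -> c.-tuple R) : R :=
  m (\row_l (p l 0 * \sum_(k < K) \sum_(r < 2)
       2^-1 * chebyshev_coef phi k.+1 * tnth (z k r) l ^+ 2)).

End limit.
End uniform_scores.

(* Main.v *)
Require Import Defs.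
From HB Require Import structures.
From mathcomp Require Import all_boot all_order all_algebra.
From mathcomp Require Import all_classical all_reals all_analysis.
From mathcomp Require Import measurable_realfun.
From mathcomp Require Import ring lra.

Set Implicit Arguments.
Unset Strict Implicit.
Unset Printing Implicit Defensive.

Import Order.TTheory GRing.Theory Num.Theory.
Import numFieldNormedType.Exports.

Local Open Scope classical_set_scope.
Local Open Scope ring_scope.

(** The truncated statistic is a fixed function of finitely many mean scores:
   with [tau l = sqrt (n l / N / p l)], which tends to one, it is a Lipschitz
   function of the squares of the variables
   [X (k, r, l) = tau l * sqrt N * score_mean k r l], and the limit is the same
   function of the coordinates of the Gaussian vectors [Z k r].  So everything
   reduces to the joint convergence in law of the [X (k, r, l)].

   Ranks make the terms of a mean score dependent.  [rank_linearization] replaces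
   the rank of an observation, divided by [N], by the value [F theta] of the
   distribution function, at a cost that vanishes in mean.  Because the scores
   of the whole pooled sample nearly sum to zero, the mean over one sample may
   first be replaced by a contrast [a] with zero sum, and it is the zero sum that
   makes the first-order effect of the fluctuations of the ranks negligible.
   What remains is [\sum_j a j * score (F (theta j))], a sum of independent
   variables of size [1 / sqrt N].

   Under [f] the variable [F theta] is uniform, so the scores have mean zero and
   are orthonormal ([integral_scoreM]).  A shift of [delta / sqrt N] does not
   change the limit of the second moments; it changes the mean score by
   [- beta * delta / sqrt N] up to smaller terms, by an integration by parts on
   the circle ([score_mean_shift]).  Summed with the weights of the contrasts
   these first-order effects give the means [eta], and the second moments give
   the covariance [diag (1 / p) - 1].

   Laws are handled through the integrals of [cos (b + \sum_i t i * X i)], for all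
   [b] and [t]: by varying the phase [b] one has the whole characteristic function
   without complex numbers.  For the sums above, [clt_cos] compares them with the
   normal values; for the Gaussian limit they are computed by Stein's identity
   ([normal_cos]).  Finally [weak_convergence] passes from these integrals to
   bounded functions uniformly continuous on bounded sets: such a function is
   approximated on a large cube by a polynomial in the sines of its variables,
   by means of Bernstein polynomials, and first moments bound the mass outside the
   cube. *)

(** * Bounded measurable functions *)

Section bounded_measurable.
Context d (T : measurableType d) (R : realType).
Implicit Types (D : set T) (X Y : T -> R).

(** Over a finite measure this one condition, stable under all the operations
   below, carries the integrability side conditions. *)
Definition bdd_meas D X :=
  measurable_fun D X /\ exists M : R, forall w, D w -> `|X w| <= M.

Lemma bdd_meas_cst D (r : R) : bdd_meas D (fun=> r).
Proof. by split; [exact: measurable_cst|exists `|r|]. Qed.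

Lemma bdd_measD D X Y : bdd_meas D X -> bdd_meas D Y ->
  bdd_meas D (fun w => X w + Y w).
Proof.
move=> [mX [A hA]] [mY [B hB]]; split; first exact: measurable_funD.
exists (A + B) => w Dw; apply: (le_trans (ler_normD _ _)).
by rewrite lerD ?hA ?hB.
Qed.

Lemma bdd_measM D X Y : bdd_meas D X -> bdd_meas D Y ->
  bdd_meas D (fun w => X w * Y w).
Proof.
move=> [mX [A hA]] [mY [B hB]]; split; first exact: measurable_funM.
by exists (A * B) => w Dw; rewrite normrM ler_pM ?hA ?hB.
Qed.

Lemma bdd_measZ D (r : R) X : bdd_meas D X -> bdd_meas D (fun w => r * X w).
Proof. exact/bdd_measM/bdd_meas_cst. Qed.

Lemma bdd_measN D X : bdd_meas D X -> bdd_meas D (fun w => - X w).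
Proof.
move=> bX; rewrite (_ : (fun w => _) = (fun w => -1 * X w)).
  exact: bdd_measZ.
by apply/funext => w; rewrite mulN1r.
Qed.

Lemma bdd_measB D X Y : bdd_meas D X -> bdd_meas D Y ->
  bdd_meas D (fun w => X w - Y w).
Proof. by move=> bX bY; apply: bdd_measD => //; exact: bdd_measN. Qed.

Lemma bdd_measX D X k : bdd_meas D X -> bdd_meas D (fun w => X w ^+ k).
Proof.
move=> bX; elim: k => [|k IH].
  by under eq_fun do rewrite expr0; exact: bdd_meas_cst.
by under eq_fun do rewrite exprS; exact: bdd_measM.
Qed.

Lemma bdd_meas_sum D (I : Type) (s : seq I) (Q : pred I) (X : I -> T -> R) :
  (forall i, bdd_meas D (X i)) ->
  bdd_meas D (fun w => \sum_(i <- s | Q i) X i w).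
Proof.
move=> bX; elim: s => [|i s IH].
  by under eq_fun do rewrite big_nil; exact: bdd_meas_cst.
under eq_fun do rewrite big_cons; case: (Q i) => //.
exact: bdd_measD.
Qed.

Lemma bdd_meas_prod D (I : Type) (s : seq I) (Q : pred I) (X : I -> T -> R) :
  (forall i, bdd_meas D (X i)) ->
  bdd_meas D (fun w => \prod_(i <- s | Q i) X i w).
Proof.
move=> bX; elim: s => [|i s IH].
  by under eq_fun do rewrite big_nil; exact: bdd_meas_cst.
under eq_fun do rewrite big_cons; case: (Q i) => //.
exact: bdd_measM.
Qed.

Lemma bdd_meas_norm D X : bdd_meas D X -> bdd_meas D (fun w => `|X w|).
Proof.
move=> [mX [A hA]]; split; first exact: measurableT_comp.
by exists A => w Dw; rewrite normr_id hA.
Qed.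

Lemma bdd_meas_indic D (A : set T) : measurable A -> bdd_meas D (\1_A : T -> R).
Proof.
move=> mA; split; first exact: measurable_indic.
by exists 1 => w _; rewrite indicE; case: (_ \in _); rewrite ?normr1 ?normr0.
Qed.

Lemma bdd_meas_cos D X : measurable_fun D X -> bdd_meas D (fun w => cos (X w)).
Proof.
move=> mX; split.
  by apply: (measurableT_comp (f := cos)) mX;
    apply: continuous_measurable_fun; exact: continuous_cos.
by exists 1 => w _; rewrite ler_norml cos_geN1 cos_le1.
Qed.

Lemma bdd_meas_sin D X : measurable_fun D X -> bdd_meas D (fun w => sin (X w)).
Proof.
move=> mX; split.
  by apply: (measurableT_comp (f := sin)) mX;
    apply: continuous_measurable_fun; exact: continuous_sin.
by exists 1 => w _; rewrite ler_norml sin_geN1 sin_le1.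
Qed.

End bounded_measurable.

Lemma bdd_meas_comp d d' (T : measurableType d) (E : measurableType d')
    (R : realType) (D : set T) (X : T -> E) (u : E -> R) :
  measurable_fun D X -> bdd_meas setT u -> bdd_meas D (u \o X).
Proof.
move=> mX [mu [M hM]]; split; first exact: measurableT_comp.
by exists M => w _ /=; exact: hM.
Qed.

Lemma bdd_meas_subset d (T : measurableType d) (R : realType) (D D' : set T)
    (X : T -> R) : measurable D' -> D `<=` D' -> bdd_meas D' X -> bdd_meas D X.
Proof.
move=> mD' DD' [mX [M hM]]; split; first exact: measurable_funS mX.
by exists M => w /DD'; exact: hM.
Qed.

Section bounded_integral.
Context d (T : measurableType d) (R : realType).
Variables (mu : {measure set T -> \bar R}) (D : set T).
Hypotheses (mD : measurable D) (fD : (mu D < +oo)%E).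
Implicit Types (X Y : T -> R).

Lemma bdd_meas_integrable X : bdd_meas D X -> mu.-integrable D (EFin \o X).
Proof.
move=> [mX [M hM]]; apply: measurable_bounded_integrable => //.
exists M; split; first exact: num_real.
by move=> B MB w /= Dw; rewrite (le_trans (hM w Dw)) ?ltW.
Qed.

Lemma bintD X Y : bdd_meas D X -> bdd_meas D Y ->
  \int[mu]_(w in D) (X w + Y w) = \int[mu]_(w in D) X w + \int[mu]_(w in D) Y w.
Proof. by move=> bX bY; rewrite RintegralD//; exact: bdd_meas_integrable. Qed.

Lemma bintB X Y : bdd_meas D X -> bdd_meas D Y ->
  \int[mu]_(w in D) (X w - Y w) = \int[mu]_(w in D) X w - \int[mu]_(w in D) Y w.
Proof. by move=> bX bY; rewrite RintegralB//; exact: bdd_meas_integrable. Qed.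

Lemma bintZ r X : bdd_meas D X ->
  \int[mu]_(w in D) (r * X w) = r * \int[mu]_(w in D) X w.
Proof. by move=> bX; rewrite RintegralZl//; exact: bdd_meas_integrable. Qed.

Lemma bint_sum (I : Type) (s : seq I) (Q : pred I) (X : I -> T -> R) :
  (forall i, bdd_meas D (X i)) ->
  \int[mu]_(w in D) (\sum_(i <- s | Q i) X i w) =
  \sum_(i <- s | Q i) \int[mu]_(w in D) X i w.
Proof.
move=> bX; elim: s => [|i s IH].
  rewrite big_nil; under eq_Rintegral do rewrite big_nil.
  by rewrite Rintegral_cst// mul0r.
rewrite big_cons; under eq_Rintegral do rewrite big_cons.
by case: (Q i) => //; rewrite bintD ?IH//; exact: bdd_meas_sum.
Qed.

Lemma le_bint X Y : bdd_meas D X -> bdd_meas D Y ->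
  (forall w, D w -> X w <= Y w) ->
  \int[mu]_(w in D) X w <= \int[mu]_(w in D) Y w.
Proof. by move=> bX bY; apply: le_Rintegral => //; exact: bdd_meas_integrable. Qed.

Lemma bint_norm X : bdd_meas D X ->
  `|\int[mu]_(w in D) X w| <= \int[mu]_(w in D) `|X w|.
Proof. by move=> bX; apply: le_normr_Rintegral => //; exact: bdd_meas_integrable. Qed.

Lemma bint_norm_le X M : bdd_meas D X -> (forall w, D w -> `|X w| <= M) ->
  `|\int[mu]_(w in D) X w| <= M * fine (mu D).
Proof.
move=> bX hM; apply: (le_trans (bint_norm bX)).
rewrite -Rintegral_cst//; apply: le_bint => //; first exact: bdd_meas_norm.
exact: bdd_meas_cst.
Qed.

(** Cauchy--Schwarz in its additive form: the weight [r] is chosen by the user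
   so as to balance the two sides. *)
Lemma bint_normM_le r X Y : 0 < r -> bdd_meas D X -> bdd_meas D Y ->
  \int[mu]_(w in D) `|X w * Y w| <=
  r * \int[mu]_(w in D) (X w ^+ 2) + r^-1 * \int[mu]_(w in D) (Y w ^+ 2).
Proof.
move=> r0 bX bY.
have bX2 := bdd_measX 2 bX; have bY2 := bdd_measX 2 bY.
rewrite -!bintZ// -bintD; [|exact: bdd_measZ..].
apply: le_bint; first exact/bdd_meas_norm/bdd_measM.
  by apply: bdd_measD; exact: bdd_measZ.
move=> w _; rewrite normrM -(real_normK (num_real (X w))).
rewrite -(real_normK (num_real (Y w))).
have := normr_ge0 (X w); have := normr_ge0 (Y w).
move: (`|X w|) (`|Y w|) => x y y0 x0.
have -> : x * y = r^-1 * (r * x * y).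
  by field; rewrite gt_eqF.
have -> : r * x ^+ 2 + r^-1 * y ^+ 2 = r^-1 * ((r * x) ^+ 2 + y ^+ 2).
  by field; rewrite gt_eqF.
apply: ler_wpM2l; first by rewrite invr_ge0 ltW.
have := sqr_ge0 (r * x - y); have : 0 <= r * x * y by rewrite !mulr_ge0// ltW.
by nra.
Qed.

Lemma bint_ge0 X : (forall w, D w -> 0 <= X w) -> 0 <= \int[mu]_(w in D) X w.
Proof. exact: Rintegral_ge0. Qed.

End bounded_integral.

Section bounded_expectation.
Context d (T : measurableType d) (R : realType) (P : probability T R).
Implicit Types (X Y : T -> R).

Lemma probability_finite : (P setT < +oo)%E.
Proof. by rewrite probability_setT ltry. Qed.

Lemma expectation_Rintegral X : bdd_meas setT X ->
  ('E_P[X] = (\int[P]_w X w)%:E)%E.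
Proof.
move=> bX; rewrite unlock /Rintegral fineK//.
apply: integrable_fin_num => //.
apply: bdd_meas_integrable => //; exact: probability_finite.
Qed.

Lemma Rintegral_prob_cst r : \int[P]_w r = r :> R.
Proof.
have P1 : P setT = 1%E := probability_setT P.
by rewrite Rintegral_cst// [X in fine X]P1 mulr1.
Qed.

Lemma Rintegral_indic (A : set T) : measurable A ->
  \int[P]_w (\1_A w) = fine (P A) :> R.
Proof. by move=> mA; rewrite /Rintegral integral_indic// setIT. Qed.

End bounded_expectation.

(** * Elementary estimates *)

Section elementary_estimates.
Variable R : realType.
Implicit Types x h a b : R.

Lemma mean_value_le (f df : R -> R) (B a b : R) :
  (forall x, is_derive x 1 f (df x)) ->
  (forall x, Num.min a b <= x <= Num.max a b -> `|df x| <= B) ->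
  `|f b - f a| <= B * `|b - a|.
Proof.
move=> fd dfB.
have cf : continuous f.
  by move=> x; apply/differentiable_continuous/derivable1_diffP.
wlog ab : a b dfB / a <= b.
  move=> H; case: (leP a b) => [ab|/ltW ba]; first exact: H.
  by rewrite distrC (distrC b); apply: H => // x; rewrite minC maxC; exact: dfB.
have [c + ->] := MVT_segment ab (fun x _ => fd x) (continuous_subspaceT cf).
rewrite in_itv /= => cab; rewrite normrM ler_wpM2r// dfB//.
by rewrite min_l// max_r.
Qed.

Lemma sin_norm_le h : `|sin h| <= `|h|.
Proof.
have /(_ 0 h) := @mean_value_le sin cos 1; rewrite sin0 !subr0 mul1r; apply.
by move=> x _; rewrite ler_norml cos_geN1 cos_le1.
Qed.

Lemma cosB1_norm_le h : `|cos h - 1| <= h ^+ 2 / 2.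
Proof.
have -> : cos h - 1 = - (2 * sin (h / 2) ^+ 2).
  rewrite {1}(_ : h = h / 2 + h / 2); last by field.
  rewrite cosD -!expr2; have := cos2Dsin2 (h / 2).
  by move: (cos _ ^+ 2) (sin _ ^+ 2) => c s e; lra.
rewrite normrN normrM ger0_norm// normrX.
have := sin_norm_le (h / 2).
rewrite -(ler_pXn2r (n := 2))// ?nnegrE// => /(ler_wpM2l (ler0n R 2)).
move/le_trans; apply; rewrite real_normK ?num_real//.
by rewrite expr_div_n; lra.
Qed.

Lemma sinBid_norm_le h : `|sin h - h| <= `|h| ^+ 3 / 2.
Proof.
have /(_ 0 h) := @mean_value_le (fun x => sin x - x) (fun x => cos x - 1)
  (h ^+ 2 / 2).
rewrite sin0 !subr0 => H; apply: (le_trans (H _ _)).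
- move=> x xh; apply: (le_trans (cosB1_norm_le x)).
  rewrite ler_pM2r// -(real_normK (num_real x)) -(real_normK (num_real h)).
  rewrite ler_pXn2r ?nnegrE// ler_norml.
  move: xh; case: (leP 0 h) => [h0|h0].
    by rewrite ger0_norm//; lra.
  by rewrite ltr0_norm//; lra.
- rewrite -(real_normK (num_real h)).
  by rewrite [leRHS](_ : _ = `|h| ^+ 2 / 2 * `|h|)//; ring.
Qed.

Lemma cosB1D_norm_le h : `|h| <= 1 -> `|cos h - 1 + h ^+ 2 / 2| <= `|h| ^+ 3.
Proof.
move=> h1.
have /(_ 0 h) := @mean_value_le (fun x => cos x + x ^+ 2 / 2)
  (fun x => - sin x + x) (`|h| ^+ 3 / 2).
rewrite cos0 expr0n mul0r !addr0 subr0 => H.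
rewrite addrAC; apply: (le_trans (H _ _)).
- move=> x; have d2 := is_deriveZ 2^-1 (is_deriveX 2 (is_derive_id x 1)).
  have -> : (fun x => cos x + x ^+ 2 / 2) = cos + (2^-1 \*: id ^+ 2).
    by apply/funext => y; rewrite mulrC.
  apply: (is_derive_eq (is_deriveD (is_derive_cos x) d2)).
  by rewrite /GRing.scale/= expr1 mulr1 mulrA mulVf// mul1r.
- move=> x xh; rewrite addrC -normrN opprB; apply: (le_trans (sinBid_norm_le x)).
  rewrite ler_pM2r// ler_pXn2r ?nnegrE// ler_norml.
  move: xh; case: (leP 0 h) => [h0|h0].
    by rewrite ger0_norm//; lra.
  by rewrite ltr0_norm//; lra.
- have : 0 <= `|h| ^+ 3 by rewrite exprn_ge0.
  by move: (_ ^+ 3) (normr_ge0 h) => t; nra.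
Qed.

Lemma cos_taylor2 a h : `|h| <= 1 ->
  `|cos (a + h) - (cos a - sin a * h - cos a * (h ^+ 2 / 2))|
  <= 2 * `|h| ^+ 3.
Proof.
move=> h1; rewrite cosD.
have -> : cos a * cos h - sin a * sin h -
    (cos a - sin a * h - cos a * (h ^+ 2 / 2)) =
  cos a * (cos h - 1 + h ^+ 2 / 2) - sin a * (sin h - h) by ring.
apply: (le_trans (ler_normB _ _)); rewrite !normrM.
have h30 : 0 <= `|h| ^+ 3 by rewrite exprn_ge0.
have c1 : `|cos a| <= 1 by rewrite ler_norml cos_geN1 cos_le1.
have s1 := sin_max a.
have H1 := ler_pM (normr_ge0 _) (normr_ge0 _) c1 (cosB1D_norm_le h1).
have H2 := ler_pM (normr_ge0 _) (normr_ge0 _) s1 (sinBid_norm_le h).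
by lra.
Qed.

Lemma cos_taylor1 a h : `|cos (a + h) - (cos a - sin a * h)| <= 2 * h ^+ 2.
Proof.
rewrite cosD.
have -> : cos a * cos h - sin a * sin h - (cos a - sin a * h) =
  cos a * (cos h - 1) - sin a * (sin h - h) by ring.
apply: (le_trans (ler_normB _ _)); rewrite !normrM.
have c1 : `|cos a| <= 1 by rewrite ler_norml cos_geN1 cos_le1.
have s1 := sin_max a.
have H1 := ler_pM (normr_ge0 _) (normr_ge0 _) c1 (cosB1_norm_le h).
have sh : `|sin h - h| <= h ^+ 2.
  rewrite -(real_normK (num_real h)).
  have [h2|h2] := leP `|h| 2.
    apply: (le_trans (sinBid_norm_le h)); rewrite exprS.
    by have := normr_ge0 h; have := sqr_ge0 `|h|; nra.
  apply: (le_trans (ler_normB _ _)).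
  by have := sin_norm_le h; have := normr_ge0 h; nra.
have H2 := ler_pM (normr_ge0 _) (normr_ge0 _) s1 sh.
by have := sqr_ge0 h; lra.
Qed.

Lemma expRN_taylor1 x : 0 <= x -> `|expR (- x) - (1 - x)| <= x ^+ 2.
Proof.
move=> x0; have e1 := expR_ge1Dx (- x).
rewrite ger0_norm ?subr_ge0// expRN.
suff : (expR x)^-1 <= 1 - x + x ^+ 2 by lra.
have e2 := expR_ge1Dx x.
have : (expR x)^-1 <= (1 + x)^-1.
  by rewrite lef_pV2 ?posrE ?expR_gt0//; lra.
move/le_trans; apply.
rewrite -[leLHS]mul1r ler_pdivrMr; last lra.
rewrite (_ : _ * _ = 1 + x ^+ 3); first by rewrite lerDl exprn_ge0.
by ring.
Qed.

(** For [y = n.+1%:R * u x] this says that [u] is within [1 / n.+1] of a multiple of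
   the sum of the indicators of its level sets. *)
Lemma floor_count (K : nat) (y : R) : 0 <= y < K.+1%:R ->
  y - 1 <= \sum_(k < K) (k.+1%:R <= y)%R%:R <= y.
Proof.
elim: K y => [|K IH] y /andP[y0 yK].
  by rewrite big_ord0 y0 andbT; rewrite subr_le0 ltW.
rewrite big_ord_recl /=; case: (leP 1 y) => y1.
  have /IH : 0 <= y - 1 < K.+1%:R.
    by rewrite subr_ge0 y1 ltrBlDr natr1.
  have -> : \sum_(i < K) ((bump 0 i).+1%:R <= y)%R%:R =
      \sum_(k < K) (k.+1%:R <= y - 1)%R%:R :> R.
    by apply: eq_bigr => k _; rewrite lerBrDr natr1.
  move: (\sum_(i < K) _) => s /andP[s1 s2].
  by rewrite -[true%:R]/(1 : R); apply/andP; split; lra.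
rewrite big1 ?addr0; first by rewrite y0 subr_le0 ltW.
move=> k _; by rewrite leNgt (lt_le_trans y1)// (ler_nat R 1).
Qed.

End elementary_estimates.

(** * The product rule for independent variables *)

(** A bounded linear functional on bounded measurable functions is determined
   by indicators: after a shift making it nonnegative, [u] is within
   [1 / n.+1] of [n.+1%:R^-1] times the sum of the indicators of its level sets
   [k.+1%:R / n.+1%:R <= u]. *)
Lemma bdd_meas_functional0 d (E : measurableType d) (R : realType)
    (L : (E -> R) -> R) (C : R) :
  (forall u v, bdd_meas setT u -> bdd_meas setT v ->
     L (fun x => u x + v x) = L u + L v) ->
  (forall r u, bdd_meas setT u -> L (fun x => r * u x) = r * L u) ->
  (forall u (B : R), bdd_meas setT u -> (forall x, `|u x| <= B) -> `|L u| <= C * B) ->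
  (forall A, measurable A -> L \1_A = 0) ->
  forall u, bdd_meas setT u -> L u = 0.
Proof.
move=> LD LZ LB LI u bu; have [mu [M hM]] := bu.
pose v x := u x + M.
have bM : bdd_meas [set: E] (fun=> M : R) by exact: bdd_meas_cst.
have bv : bdd_meas setT v by exact: bdd_measD.
have v_ge0 x : 0 <= v x by have := hM x I; rewrite ler_norml /v; lra.
have v_le x : v x <= 2 * M by have := hM x I; rewrite ler_norml /v; lra.
have LM : L (fun=> M) = 0.
  rewrite (_ : (fun=> M) = (fun x : E => M * \1_setT x)).
    by rewrite LZ ?LI ?mulr0//; exact: bdd_meas_indic.
  by apply/funext => x; rewrite indicE in_setT mulr1.
have -> : L u = L v by rewrite LD// LM addr0.
have Lsum (K : nat) (f : nat -> E -> R) : (forall k, bdd_meas setT (f k)) ->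
    (forall k, L (f k) = 0) -> L (fun x => \sum_(k < K) f k x) = 0.
  move=> bf Lf; elim: K => [|K IH].
    under eq_fun do rewrite big_ord0.
    have := @LZ 0 (fun=> M) bM; by rewrite !mul0r.
  under eq_fun do rewrite big_ord_recr/=.
  by rewrite LD ?IH ?Lf ?addr0//; exact: bdd_meas_sum.
have C0 : 0 <= C.
  have b0 : bdd_meas [set: E] (fun=> 0 : R) by exact: bdd_meas_cst.
  have /(_ _)/(le_trans _) := @LB _ 1 b0; rewrite mulr1; apply => // x.
  by rewrite normr0.
have key (n : nat) : `|L v| <= C / n.+1%:R.
  pose K := Num.truncn (n.+1%:R * (2 * M)).
  pose f (k : nat) : E -> R := \1_[set x | k.+1%:R <= n.+1%:R * v x].
  have mlev k : measurable [set x | k.+1%:R <= n.+1%:R * v x].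
    have mnv : measurable_fun setT (fun x => n.+1%:R * v x).
      by case: (bdd_measZ n.+1%:R bv).
    have := mnv measurableT _ (measurable_itv `[k.+1%:R, +oo[).
    rewrite setTI; congr measurable; apply/seteqP; split => x /=;
      by rewrite in_itv/= andbT.
  have bf k : bdd_meas setT (f k) by apply: bdd_meas_indic; exact: mlev.
  pose s x := \sum_(k < K) f k x.
  have bs : bdd_meas setT s by exact: bdd_meas_sum.
  have Ls : L s = 0 by apply: Lsum => // k; exact: LI.
  pose r x := v x + (- n.+1%:R^-1) * s x.
  have bns := bdd_measZ (- n.+1%:R^-1) bs.
  have br : bdd_meas setT r by exact: bdd_measD.
  have -> : L v = L r by rewrite /r (LD _ _ bv bns) (LZ _ _ bs) Ls mulr0 addr0.
  apply: LB => // x.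
  have n0 : (0 : R) < n.+1%:R by [].
  have : n.+1%:R * v x - 1 <= s x <= n.+1%:R * v x.
    rewrite /s (eq_bigr (fun k : 'I_K => (k.+1%:R <= n.+1%:R * v x)%R%:R)).
      apply: floor_count; rewrite mulr_ge0//=.
      apply: le_lt_trans (truncnS_gt _); by rewrite ler_pM2l.
    move=> k _; rewrite /f indicE; congr (nat_of_bool _)%:R.
    by apply/idP/idP => [/set_mem//|H]; exact/mem_set.
  rewrite /r mulNr => /andP[s1 s2].
  rewrite -(ler_pM2l n0) mulfV ?gt_eqF// -[X in X * _](gtr0_norm n0) -normrM.
  rewrite mulrBr mulrA mulfV ?gt_eqF// mul1r ler_norml; lra.
apply/eqP; rewrite -normr_eq0 eq_le normr_ge0 andbT; apply/ler_addgt0Pl => e e0.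
rewrite addr0; pose n := Num.truncn (C / e).
apply: (le_trans (key n)); rewrite ler_pdivrMr// -ler_pdivrMl// mulrC.
exact/ltW/truncnS_gt.
Qed.

Section independence.
Context d (T : measurableType d) (R : realType) (P : probability T R).
Context (I : finType) d' (E : measurableType d') (X : I -> {RV P >-> E}).
Hypothesis indX : mutually_independent X.

Local Notation Ex := (Rintegral P setT).

Let pf := probability_finite P.

Lemma bdd_meas_RV (u : E -> R) i :
  bdd_meas setT u -> bdd_meas setT (fun w => u (X i w)).
Proof. by move=> bu; apply: (bdd_meas_comp (X := X i)). Qed.
Hint Resolve bdd_meas_RV : core.

(** The product rule passes from events to bounded functions one factor at a
   time: with the other factors frozen, both sides are bounded linear
   functionals of the remaining one. *)
Lemma independent_prod (u : I -> E -> R) : (forall i, bdd_meas setT (u i)) ->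
  Ex (fun w => \prod_i u i (X i w)) = \prod_i Ex (fun w => u i (X i w)).
Proof.
suff H (s : seq I) : forall u : I -> E -> R, (forall i, bdd_meas setT (u i)) ->
    (forall i, i \notin s -> exists2 A, measurable A & u i = \1_A) ->
    Ex (fun w => \prod_i u i (X i w)) = \prod_i Ex (fun w => u i (X i w)).
  by move=> bu; apply: (H (enum I)) => // i; rewrite mem_enum.
elim: s => [|i s IH] {}u bu hu.
  have /choice[A hA] : forall i, exists A, measurable A /\ u i = \1_A.
    by move=> i; have [//|A ? ?] := hu i; exists A.
  have mXA i : measurable (X i @^-1` A i).
    by rewrite -[X in measurable X]setTI; apply: measurable_funPT => //;
      exact: (hA i).1.
  have prodE w : \prod_i u i (X i w) = \1_(\bigcap_i (X i @^-1` A i)) w.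
    rewrite indicE; under eq_bigr do rewrite (hA _).2 indicE.
    have [/set_mem H|/negP H] := boolP (w \in _).
      by rewrite big1// => i _; rewrite mem_set//; exact: H.
    have [i Hi] : exists i, X i w \notin A i.
      apply/not_existsP => H'; apply: H; apply/mem_set => i _ /=.
      by apply/set_mem/negPn/negP; exact: H'.
    by rewrite (bigD1 i)//= (negbTE Hi) mul0r.
  under eq_Rintegral do rewrite prodE.
  have mcap : measurable (\bigcap_i (X i @^-1` A i)).
    by apply: fin_bigcap_measurable => //; exact: finite_finset.
  rewrite Rintegral_indic// (indX (fun i => (hA i).1)).
  have -> : (\prod_i P (X i @^-1` A i) =
             (\prod_i fine (P (X i @^-1` A i)))%:E)%E.
    elim/big_ind2: _ => [//|x1 x2 y1 y2 -> ->//|i _].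
    by rewrite fineK// fin_num_measure.
  rewrite /=; apply: eq_bigr => i _.
  under [RHS]eq_Rintegral do rewrite (hA _).2.
  rewrite -Rintegral_indic//; apply: eq_Rintegral => w _; rewrite !indicE.
pose rep v := fun j => if j == i then v else u j : E -> R.
have brep v : bdd_meas setT v -> forall j, bdd_meas setT (rep v j).
  by move=> bv j; rewrite /rep; case: ifP.
pose V w := \prod_(j | j != i) u j (X j w).
have bV : bdd_meas setT V.
  apply: (@bdd_meas_prod _ _ _ _ _ _ _ (fun j w => u j (X j w))) => j.
  exact: bdd_meas_RV.
pose k := \prod_(j | j != i) Ex (fun w => u j (X j w)).
have [bV1 [M hM]] := bV.
have prod_rep v w : \prod_j rep v j (X j w) = v (X i w) * V w.
  rewrite (bigD1 i)//= {1}/rep eqxx; congr (_ * _).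
  by apply: eq_bigr => j ji; rewrite /rep (negbTE ji).
have Eprod_rep v : \prod_j Ex (fun w => rep v j (X j w)) = Ex (fun w => v (X i w)) * k.
  rewrite (bigD1 i)//= {1}/rep eqxx; congr (_ * _).
  by apply: eq_bigr => j ji; rewrite /rep (negbTE ji).
have -> : u = rep (u i).
  by apply/funext => j; rewrite /rep; case: eqP => [->|].
rewrite Eprod_rep; under eq_Rintegral do rewrite prod_rep.
have bE v : bdd_meas setT v -> bdd_meas setT (fun w => v (X i w) * V w).
  by move=> bv; apply: bdd_measM => //; exact: bdd_meas_RV.
apply/eqP; rewrite -subr_eq0; apply/eqP.
pose L v := Ex (fun w => v (X i w) * V w) - Ex (fun w => v (X i w)) * k.
apply: (@bdd_meas_functional0 _ _ _ L (M + `|k|)); rewrite /L //.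
- move=> v1 v2 b1 b2.
  under eq_Rintegral do rewrite mulrDl.
  rewrite (bintD measurableT pf (bE _ b1) (bE _ b2)).
  rewrite (bintD measurableT pf (bdd_meas_RV _ b1) (bdd_meas_RV _ b2)).
  by ring.
- move=> r v bv.
  under eq_Rintegral do rewrite -mulrA.
  rewrite (bintZ measurableT pf _ (bE _ bv)).
  rewrite (bintZ measurableT pf _ (bdd_meas_RV _ bv)).
  by ring.
- move=> v B bv hB; apply: (le_trans (ler_normB _ _)).
  rewrite mulrDl lerD//.
    rewrite -[leRHS]mulr1 -[X in _ * X](_ : fine (P setT) = 1); last first.
      by have -> : P setT = 1%E := probability_setT P.
    apply: bint_norm_le => //; first exact: bE.
    by move=> w _; rewrite normrM mulrC ler_pM// hM.
  rewrite normrM mulrC ler_wpM2l//.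
  rewrite -[leRHS]mulr1 -[X in _ * X](_ : fine (P setT) = 1); last first.
    by have -> : P setT = 1%E := probability_setT P.
  by apply: bint_norm_le => //; exact: bdd_meas_RV.
- move=> A mA; have bA : bdd_meas setT (\1_A : E -> R) by exact: bdd_meas_indic.
  have := IH _ (brep _ bA); rewrite Eprod_rep.
  under eq_Rintegral do rewrite prod_rep.
  move=> ->; first by rewrite subrr.
  move=> j js; rewrite /rep; case: eqP => [_|/eqP ji]; first by exists A.
  by apply: hu; rewrite inE negb_or ji.
Qed.

End independence.

(** * Cosines of sums of independent variables *)

Section sums_of_independent_variables.
Context d (T : measurableType d) (R : realType) (P : probability T R).
Context (I : finType) d' (E : measurableType d') (X : I -> {RV P >-> E}).
Hypothesis indX : mutually_independent X.
Variable y : I -> E -> R.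
Hypothesis my : forall i, measurable_fun setT (y i).

Local Notation Ex := (Rintegral P setT).

Let pf := probability_finite P.

Lemma measurable_fun_RV i : measurable_fun setT (fun w => y i (X i w)).
Proof. exact: measurableT_comp. Qed.

Lemma measurable_phase (s : seq I) (b : R) :
  measurable_fun setT (fun w => b + \sum_(j <- s) y j (X j w)).
Proof.
apply: measurable_funD; first exact: measurable_cst.
apply: (@measurable_sum _ _ _ _ _ _ (fun j w => y j (X j w))) => j.
exact: measurable_fun_RV.
Qed.

(** The addition formulas reduce the cosine of a partial sum to products of
   functions of the single variables, so the product rule shows that such a
   cosine is uncorrelated with functions of the remaining variables. *)
Lemma independent_cos_sum (s : seq I) (b : R) (u : I -> E -> R) :
  uniq s -> (forall i, bdd_meas setT (u i)) ->
  Ex (fun w => cos (b + \sum_(j <- s) y j (X j w)) *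
               \prod_(j | j \notin s) u j (X j w)) =
  Ex (fun w => cos (b + \sum_(j <- s) y j (X j w))) *
  \prod_(j | j \notin s) Ex (fun w => u j (X j w)).
Proof.
have bu_prod (u' : I -> E -> R) (Q : pred I) : (forall i, bdd_meas setT (u' i)) ->
    bdd_meas setT (fun w => \prod_(j | Q j) u' j (X j w)).
  move=> bu'; apply: (@bdd_meas_prod _ _ _ _ _ _ _ (fun j w => u' j (X j w))) => j.
  exact: (bdd_meas_RV X j (bu' j)).
elim: s b u => [|i s IH] b u.
  move=> _ bu; under eq_Rintegral do rewrite big_nil addr0.
  rewrite (bintZ measurableT pf); last exact: bu_prod.
  rewrite (independent_prod indX)//; congr (_ * _).
  by under eq_Rintegral do rewrite big_nil addr0; rewrite Rintegral_prob_cst.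
rewrite cons_uniq => /andP[is_ us].
(* the general case follows from the instance u = 1 *)
suff H (v : I -> E -> R) : (forall i, bdd_meas setT (v i)) ->
    Ex (fun w => cos (b + \sum_(j <- i :: s) y j (X j w)) *
                 \prod_(j | j \notin i :: s) v j (X j w)) =
    (Ex (fun w => cos (b + \sum_(j <- s) y j (X j w))) *
       Ex (fun w => cos (y i (X i w))) +
     Ex (fun w => cos (b + pi / 2 + \sum_(j <- s) y j (X j w))) *
       Ex (fun w => sin (y i (X i w)))) *
    \prod_(j | j \notin i :: s) Ex (fun w => v j (X j w)).
  move=> bu; rewrite H//; congr (_ * _).
  have b1 : forall i : I, bdd_meas [set: E] (fun=> 1 : R).
    by move=> _; exact: bdd_meas_cst.
  have := H _ b1; under eq_Rintegral do rewrite big1_eq mulr1.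
  move=> ->; rewrite big1 ?mulr1// => j _.
  by rewrite Rintegral_prob_cst.
move=> bv.
pose rep c := fun j => if j == i then c else v j : E -> R.
have brep c : bdd_meas setT c -> forall j, bdd_meas setT (rep c j).
  by move=> bc j; rewrite /rep; case: ifP.
have split_notin (F : I -> R) : \prod_(j | j \notin s) F j =
    F i * \prod_(j | j \notin i :: s) F j.
  rewrite (bigD1 i)//=; congr (_ * _); apply: eq_bigl => j.
  by rewrite inE negb_or andbC.
have prod_rep c w : \prod_(j | j \notin s) rep c j (X j w) =
    c (X i w) * \prod_(j | j \notin i :: s) v j (X j w).
  rewrite split_notin {1}/rep eqxx; congr (_ * _).
  apply: eq_bigr => j; rewrite inE negb_or => /andP[ji _].
  by rewrite /rep (negbTE ji).
have Eprod_rep c : \prod_(j | j \notin s) Ex (fun w => rep c j (X j w)) =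
    Ex (fun w => c (X i w)) * \prod_(j | j \notin i :: s) Ex (fun w => v j (X j w)).
  rewrite split_notin {1}/rep eqxx; congr (_ * _).
  apply: eq_bigr => j; rewrite inE negb_or => /andP[ji _].
  by rewrite /rep (negbTE ji).
have bc := bdd_meas_cos (my i); have bs := bdd_meas_sin (my i).
have IHc := IH b _ us (brep _ bc).
have IHs := IH (b + pi / 2) _ us (brep _ bs).
rewrite Eprod_rep mulrA in IHc; rewrite Eprod_rep mulrA in IHs.
rewrite mulrDl -IHc -IHs -(bintD measurableT pf); last 2 first.
- apply: bdd_measM; first exact/bdd_meas_cos/measurable_phase.
  by apply: bu_prod; exact: brep.
- apply: bdd_measM; first exact/bdd_meas_cos/measurable_phase.
  by apply: bu_prod; exact: brep.
apply: eq_Rintegral => w _; rewrite !prod_rep big_cons.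
rewrite (addrAC b) cosDpihalf.
by rewrite (addrCA b) (addrC (y i _)) (cosD (b + _)); ring.
Qed.

(** Since [b] is arbitrary, the cosine is the only test function needed: the
   hypothesis says that [y i (X i)] has characteristic function close to
   [r i * expi (t i)] at frequency one, and the errors add up because
   [0 <= r i <= 1]. *)
Lemma cos_sum_close (s : seq I) (r t eps : I -> R) : uniq s ->
  (forall i, 0 <= r i <= 1) ->
  (forall i b, `|Ex (fun w => cos (b + y i (X i w))) - r i * cos (b + t i)|
               <= eps i) ->
  forall b, `|Ex (fun w => cos (b + \sum_(j <- s) y j (X j w))) -
     \prod_(j <- s) r j * cos (b + \sum_(j <- s) t j)| <=
    2 * \sum_(j <- s) eps j.
Proof.
move=> + hr heps; elim: s => [|i s IH].
  move=> _ b; under eq_Rintegral do rewrite big_nil.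
  by rewrite !big_nil Rintegral_prob_cst mul1r subrr normr0 mulr0.
rewrite cons_uniq => /andP[is_ us] b.
pose C a := Ex (fun w => cos (a + \sum_(j <- s) y j (X j w))).
have bC a : bdd_meas setT (fun w => cos (a + \sum_(j <- s) y j (X j w))).
  exact/bdd_meas_cos/measurable_phase.
have C1 a : `|C a| <= 1.
  rewrite -[leRHS](Rintegral_prob_cst P).
  apply: (le_trans (bint_norm measurableT pf (bC a))).
  apply: le_bint => //; first exact: bdd_meas_norm.
    exact: bdd_meas_cst.
  by move=> w _; rewrite ler_norml cos_geN1 cos_le1.
(* All the factors but the one of [i] are trivial. *)
pose ui (c : E -> R) j := if j == i then c else (fun=> 1).
have Cui a c : bdd_meas setT c ->
    Ex (fun w => cos (a + \sum_(j <- s) y j (X j w)) * c (X i w)) =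
    C a * Ex (fun w => c (X i w)).
  move=> bc; have bui j : bdd_meas setT (ui c j).
    by rewrite /ui; case: ifP => // _; exact: bdd_meas_cst.
  have := independent_cos_sum a us bui.
  rewrite (bigD1 i)//= {2}/ui eqxx [X in _ * (_ * X)]big1 ?mulr1 => [<-|j /andP[_ ji]].
    apply: eq_Rintegral => w _; rewrite [X in _ = _ * X](bigD1 i)//= {1}/ui eqxx [X in _ = _ * (_ * X)]big1 ?mulr1//.
    by move=> j /andP[_ ji]; rewrite /ui (negbTE ji).
  by rewrite /ui (negbTE ji) Rintegral_prob_cst.
have splitE : Ex (fun w => cos (b + \sum_(j <- i :: s) y j (X j w))) =
    C b * Ex (fun w => cos (0 + y i (X i w))) -
    C (b + pi / 2) * Ex (fun w => cos (pi / 2 + y i (X i w))).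
  have bc0 : bdd_meas setT (fun x => cos (0 + y i x)).
    by apply: bdd_meas_cos; apply: measurable_funD => //; exact: measurable_cst.
  have bc1 : bdd_meas setT (fun x => cos (pi / 2 + y i x)).
    by apply: bdd_meas_cos; apply: measurable_funD => //; exact: measurable_cst.
  rewrite -(Cui b _ bc0) -(Cui (b + pi / 2) _ bc1) -(bintB measurableT pf); last 2 first.
  - by apply: bdd_measM => //; exact: (bdd_meas_RV X i bc0).
  - by apply: bdd_measM => //; exact: (bdd_meas_RV X i bc1).
  apply: eq_Rintegral => w _; rewrite big_cons add0r (addrC (pi / 2)).
  rewrite (addrAC b) !cosDpihalf (addrCA b) (addrC (y i _)) (cosD (b + _)); ring.
have Cshift : C (b + t i) = C b * cos (t i) - C (b + pi / 2) * cos (t i + pi / 2).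
  rewrite mulrC (mulrC (C (b + _))) -!(bintZ measurableT pf)// -(bintB measurableT pf);
    [|exact: bdd_measZ..].
  apply: eq_Rintegral => w _.
  rewrite (addrAC b (pi / 2)) !cosDpihalf (addrAC b) (cosD (b + _)); ring.
rewrite splitE !big_cons.
set c0 := Ex (fun w => cos (0 + _)); set c1 := Ex (fun w => cos (pi / 2 + _)).
have h0 := heps i 0; have h1 := heps i (pi / 2).
rewrite -/c0 add0r in h0; rewrite -/c1 (addrC (pi / 2)) in h1.
have hI := IH us (b + t i); rewrite -/(C _) in hI.
have /andP[r0 r1] := hr i.
set S := \sum_(j <- s) eps j in hI *.
set e0 := c0 - _ in h0; set e1 := c1 - _ in h1; set e2 := C (b + t i) - _ in hI.
rewrite [X in `|X|](_ : _ = C b * e0 - C (b + pi / 2) * e1 + r i * e2); last first.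
  rewrite /e0 /e1 /e2 !mulrBr !addrA -!mulrA.
  by rewrite {1}Cshift; ring.
apply: (le_trans (ler_normD _ _)).
have H0 : `|C b * e0| <= eps i.
  by rewrite normrM -[leRHS]mul1r ler_pM.
have H1 : `|C (b + pi / 2) * e1| <= eps i.
  by rewrite normrM -[leRHS]mul1r ler_pM.
have H2 : `|r i * e2| <= 2 * S.
  by rewrite normrM -[leRHS]mul1r ler_pM// ger0_norm.
have := ler_normB (C b * e0) (C (b + pi / 2) * e1); lra.
Qed.

End sums_of_independent_variables.

(** * A central limit theorem with an error bound *)

Section independent_moments.
Context d (T : measurableType d) (R : realType) (P : probability T R).

Local Notation Ex := (Rintegral P setT).

Let pf := probability_finite P.

Lemma Rintegral_prob_le (Y : T -> R) M : bdd_meas setT Y ->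
  (forall w, Y w <= M) -> Ex Y <= M.
Proof.
move=> bY hM; rewrite -[leRHS](Rintegral_prob_cst P).
by apply: le_bint => //; exact: bdd_meas_cst.
Qed.

Lemma Rintegral_prob_norm_le (Y : T -> R) M : bdd_meas setT Y ->
  (forall w, `|Y w| <= M) -> `|Ex Y| <= M.
Proof.
move=> bY hM; apply: (le_trans (bint_norm measurableT pf bY)).
by apply: Rintegral_prob_le => //; exact: bdd_meas_norm.
Qed.

(** The second-order Taylor expansion of the cosine at [b + Ex Y], integrated,
   gives [(1 - v / 2) * cos (b + Ex Y)] for the variance [v]; replacing
   [1 - v / 2] by the exponential costs [v ^+ 2 <= B ^+ 4]. *)
Lemma cos_normal_close (Y : T -> R) (B b : R) : bdd_meas setT Y -> B <= 1 ->
  (forall w, `|Y w - Ex Y| <= B) ->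
  `|Ex (fun w => cos (b + Y w)) -
    expR (- (Ex (fun w => (Y w - Ex Y) ^+ 2) / 2)) * cos (b + Ex Y)|
  <= 3 * B ^+ 3.
Proof.
move=> bY B1 hB; set mu := Ex Y; set s := Ex (fun w => (Y w - mu) ^+ 2).
have bY0 : bdd_meas setT (fun w => Y w - mu).
  by apply: bdd_measB => //; exact: bdd_meas_cst.
have bY2 := bdd_measX 2 bY0.
have B0 : 0 <= B by apply: (le_trans (normr_ge0 _) (hB point)).
have s0 : 0 <= s by apply: bint_ge0 => w _; exact: sqr_ge0.
have sB : s <= B ^+ 2.
  apply: Rintegral_prob_le => // w; rewrite -(real_normK (num_real _)).
  by rewrite ler_pXn2r ?nnegrE.
have mu0 : Ex (fun w => Y w - mu) = 0.
  rewrite (bintB measurableT pf)//; last exact: bdd_meas_cst.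
  by rewrite Rintegral_prob_cst subrr.
pose a := b + mu.
have bc : bdd_meas setT (fun w => cos (b + Y w)).
  by apply: bdd_meas_cos; apply: measurable_funD; [exact: measurable_cst|case: bY].
pose q w := cos a - sin a * (Y w - mu) - cos a * ((Y w - mu) ^+ 2 / 2).
have b1 : bdd_meas setT (fun w => sin a * (Y w - mu)) by exact: bdd_measZ.
have b2 : bdd_meas setT (fun w => cos a * ((Y w - mu) ^+ 2 / 2)).
  apply: bdd_measZ; under eq_fun do rewrite mulrC; exact: bdd_measZ.
have bca : bdd_meas [set: T] (fun=> cos a) by exact: bdd_meas_cst.
have bq0 : bdd_meas setT (fun w => cos a - sin a * (Y w - mu)) by exact: bdd_measB.
have bq : bdd_meas setT q by exact: bdd_measB.
have Eq : Ex q = (1 - s / 2) * cos a.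
  rewrite (bintB measurableT pf bq0 b2) (bintB measurableT pf bca b1).
  rewrite Rintegral_prob_cst (bintZ measurableT pf)// mu0 mulr0 subr0.
  rewrite (bintZ measurableT pf); last first.
    by under eq_fun do rewrite mulrC; exact: bdd_measZ.
  under eq_Rintegral do rewrite mulrC.
  by rewrite (bintZ measurableT pf)// -/s; ring.
have H1 : `|Ex (fun w => cos (b + Y w)) - Ex q| <= 2 * B ^+ 3.
  rewrite -(bintB measurableT pf)//.
  apply: Rintegral_prob_norm_le; first exact: bdd_measB.
  move=> w; rewrite (_ : b + Y w = a + (Y w - mu)); last by rewrite /a; ring.
  apply: le_trans (cos_taylor2 a _) _; first exact: le_trans (hB w) B1.
  by rewrite ler_pM2l// ler_pXn2r ?nnegrE.
have H2 : `|Ex q - expR (- (s / 2)) * cos a| <= B ^+ 3.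
  rewrite Eq -mulrBl normrM distrC -[leRHS]mulr1 ler_pM//; last first.
    by rewrite ler_norml cos_geN1 cos_le1.
  apply: (le_trans (expRN_taylor1 _)); first by rewrite divr_ge0.
  apply: (@le_trans _ _ ((B ^+ 2) ^+ 2)).
    by rewrite ler_pXn2r ?nnegrE ?divr_ge0 ?exprn_ge0//; lra.
  by rewrite -exprM (exprS _ 3) -[leRHS]mul1r ler_wpM2r ?exprn_ge0.
rewrite -/a; move: H1 H2; move: (Ex q) (Ex _) (expR _ * _) => u v t H1 H2.
rewrite (_ : v - t = (v - u) + (u - t)); last by ring.
by apply: (le_trans (ler_normD _ _)); lra.
Qed.

Context (I : finType) d' (E : measurableType d') (X : I -> {RV P >-> E}).
Hypothesis indX : mutually_independent X.

(** Each summand costs [3 * B ^+ 3]; for [B] of order [#|I| ^ (- 1 / 2)], the case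
   of a triangular array, the total vanishes. *)
Lemma clt_cos (y : I -> E -> R) (B b : R) :
  (forall i, bdd_meas setT (y i)) -> 0 <= B <= 1 ->
  let mu i := Ex (fun w => y i (X i w)) in
  (forall i x, `|y i x - mu i| <= B) ->
  `|Ex (fun w => cos (b + \sum_i y i (X i w))) -
    expR (- ((\sum_i Ex (fun w => (y i (X i w) - mu i) ^+ 2)) / 2)) *
    cos (b + \sum_i mu i)| <= 6 * B ^+ 3 * #|I|%:R.
Proof.
move=> by_ /andP[B0 B1] mu hB.
pose r i := expR (- (Ex (fun w => (y i (X i w) - mu i) ^+ 2) / 2)).
have r01 i : 0 <= r i <= 1.
  rewrite expR_ge0/= -expR0 ler_expR oppr_le0 divr_ge0//.
  by apply: bint_ge0 => w _; exact: sqr_ge0.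
have hclose i b' :
    `|Ex (fun w => cos (b' + y i (X i w))) - r i * cos (b' + mu i)| <= 3 * B ^+ 3.
  by apply: cos_normal_close => //; exact: (bdd_meas_RV X i (by_ i)).
have my i : measurable_fun setT (y i) by case: (by_ i).
have := cos_sum_close indX my (enum_uniq I) r01 hclose b.
rewrite !big_enum/= sumr_const -[X in 2 * X]mulr_natr.
under eq_Rintegral do rewrite big_enum/=.
have -> : \prod_i r i =
    expR (- ((\sum_i Ex (fun w => (y i (X i w) - mu i) ^+ 2)) / 2)).
  by rewrite mulr_suml -sumrN expR_sum.
by move/le_trans; apply; rewrite !mulrA (_ : 2 * 3 = 6)// -natrM.
Qed.

Lemma independent_pair (u v : E -> R) (i j : I) : i != j ->
  bdd_meas setT u -> bdd_meas setT v ->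
  Ex (fun w => u (X i w) * v (X j w)) =
  Ex (fun w => u (X i w)) * Ex (fun w => v (X j w)).
Proof.
move=> ij bu bv.
pose f k := if k == i then u else if k == j then v else (fun=> 1).
have bf k : bdd_meas setT (f k).
  by rewrite /f; do 2 (case: ifP => // _); exact: bdd_meas_cst.
have ji : (j == i) = false by rewrite eq_sym (negbTE ij).
have := independent_prod indX bf.
have fold_prod (F : I -> R) : (forall k, k != i -> k != j -> F k = 1) ->
    \prod_k F k = F i * F j.
  move=> F1; rewrite (bigD1 i)//= (bigD1 j)/= ?ji// big1 ?mulr1//.
  by move=> k /andP[]; exact: F1.
rewrite fold_prod; last first.
  move=> k ki kj; rewrite /f (negbTE ki) (negbTE kj).
  exact: Rintegral_prob_cst.
rewrite /f eqxx ji eqxx => <-; apply: eq_Rintegral => w _.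
rewrite fold_prod ?eqxx ?ji//.
by move=> k ki kj; rewrite /f (negbTE ki) (negbTE kj).
Qed.

(** Centred independent variables are orthogonal, so second moments add, and
   centring decreases a second moment. *)
Lemma centered_sum_sq_le (v : I -> E -> R) : (forall i, bdd_meas setT (v i)) ->
  Ex (fun w => (\sum_i (v i (X i w) - Ex (fun w => v i (X i w)))) ^+ 2) <=
  \sum_i Ex (fun w => v i (X i w) ^+ 2).
Proof.
move=> bv; set m := fun i => Ex (fun w => v i (X i w)).
pose u i x := v i x - m i.
have bm i : bdd_meas [set: E] (fun=> m i) by exact: bdd_meas_cst.
have bu i : bdd_meas setT (u i) by exact: bdd_measB.
have buX i := bdd_meas_RV X i (bu i).
have bvX i := bdd_meas_RV X i (bv i).
have Eu i : Ex (fun w => u i (X i w)) = 0.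
  rewrite (bintB measurableT pf)//; last exact: (bdd_meas_RV X i (bm i)).
  by rewrite Rintegral_prob_cst subrr.
under eq_Rintegral do rewrite expr2 mulr_suml; rewrite /=.
under eq_Rintegral do under eq_bigr do rewrite mulr_sumr.
have buu i j : bdd_meas setT (fun w => u i (X i w) * u j (X j w)).
  exact: bdd_measM.
rewrite (@bint_sum _ _ _ _ _ measurableT pf _ _ _
  (fun i w => \sum_j u i (X i w) * u j (X j w))); last first.
  move=> i; exact: (@bdd_meas_sum _ _ _ _ _ _ _ (fun j w => u i (X i w) * u j (X j w))).
apply: ler_sum => i _.
rewrite (@bint_sum _ _ _ _ _ measurableT pf _ _ _
  (fun j w => u i (X i w) * u j (X j w)))//.
rewrite (bigD1 i)//= big1 ?addr0; last first.
  move=> j ji; rewrite (independent_pair _ (bu i) (bu j)) ?Eu ?mul0r//.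
  by rewrite eq_sym.
have b2 : bdd_meas setT (fun w => v i (X i w) ^+ 2) by exact: bdd_measX.
have b3 : bdd_meas setT (fun w => (- 2 * m i) * v i (X i w)) by exact: bdd_measZ.
have b4 : bdd_meas setT (fun w => v i (X i w) ^+ 2 + (- 2 * m i) * v i (X i w)).
  exact: bdd_measD.
have b5 : bdd_meas [set: T] (fun=> m i ^+ 2) by exact: bdd_meas_cst.
rewrite [leLHS](_ : _ =
  Ex (fun w => v i (X i w) ^+ 2 + (- 2 * m i) * v i (X i w) + m i ^+ 2)); last first.
  by apply: eq_Rintegral => w _; rewrite /u; ring.
rewrite (bintD measurableT pf b4 b5) (bintD measurableT pf b2 b3).
rewrite (bintZ measurableT pf)// Rintegral_prob_cst -/(m i).
by have := sqr_ge0 (m i); lra.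
Qed.

End independent_moments.

(** * Linearization of rank statistics *)

(** Let [N] independent observations [theta j] have distribution functions close
   to [F], with contrasts [a j] of zero sum and of size [A / sqrt N].  The rank
   statistic with scores [g] is compared to the sum of independent variables
   obtained by replacing the rank of [theta j], divided by [N], by
   [F (theta j)].

   The interval is cut into [M] cells at the points [x_ m].  Within a cell the
   normalized ranks differ from the empirical distribution function [xi m] at
   its left end by at most [cnt m / N], so the statistic is, up to
   [\sum_m cnt m ^+ 2], a sum over the cells of [al m * g (xi m)], where [al m] is
   the total contrast in the cell.  Expanding [g] at [F (x_ m)], the first-order
   term is the sum of [al m * dg (F (x_ m)) * V m] with
   [V m = xi m - F (x_ m)]: since the contrasts sum to zero the mean of [al m]
   is of order [1 / M], its deviation is of order [1 / sqrt M], and [V m] is of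
   order [1 / sqrt N].  So the [M] cells contribute [sqrt M / sqrt N], while the
   discretization costs [sqrt N / M]; both vanish for [M] strictly between
   [sqrt N] and [N].  Independence enters through second moments only, and ties
   need no separate treatment.

   The weights in the statistic are [a j + 1 / sqrt N] because the mean score of
   one sample is not a contrast; the difference, the normalized sum of the
   scores of the whole sample, is a Riemann sum of a function of period one and
   mean zero.  This is where the antiderivative [ig] of [g] is used. *)
Section rank_linearization.
Context d (T : measurableType d) (R : realType) (P : probability T R).
Context (J : finType) (theta : J -> {RV P >-> R}).
Hypothesis indtheta : mutually_independent theta.
Variables (M : nat) (x_ : nat -> R) (F : R -> R) (c A G : R) (a : J -> R).
Variables (g dg ig : R -> R).

Local Notation Ex := (Rintegral P setT).
Local Notation N := (#|J|%:R : R).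
Local Notation s := (Num.sqrt N).

Hypothesis (J0 : (0 < #|J|)%N) (M0 : (0 < M)%N).
Hypothesis x_mono : {homo x_ : m k / (m <= k)%N >-> m <= k}.
Hypothesis theta_range : forall j w, x_ 0 <= theta j w < x_ M.
Hypotheses (mF : measurable_fun setT F) (bg : bdd_meas setT g).
Hypothesis F01 : forall m, (m < M)%N -> 0 <= F (x_ m) <= 1.

Let cell m : R -> R := \1_`[x_ m, x_ m.+1[.
Let below m : R -> R := \1_`]-oo, x_ m[.

Hypothesis cell_le : forall j m, (m < M)%N ->
  Ex (fun w => cell m (theta j w)) <= c / M%:R.
Hypothesis cell_close : forall j m, (m < M)%N ->
  `|Ex (fun w => cell m (theta j w)) - (F (x_ m.+1) - F (x_ m))| <=
  c / (s * M%:R).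
Hypothesis below_close : forall j m, (m < M)%N ->
  `|Ex (fun w => below m (theta j w)) - F (x_ m)| <= c / s.
Hypothesis F_cell : forall m x, (m < M)%N -> x_ m <= x < x_ m.+1 ->
  `|F x - F (x_ m)| <= c / M%:R.
Hypothesis a_sum0 : \sum_j a j = 0.
Hypothesis a_le : forall j, `|a j| <= A / s.
Hypothesis g_lip : forall u v, `|g u - g v| <= G * `|u - v|.
Hypothesis g_taylor : forall u v, `|g u - g v - dg v * (u - v)| <= G * (u - v) ^+ 2.
Hypothesis dg_le : forall u, `|dg u| <= G.
Hypothesis ig_taylor : forall u v, `|ig u - ig v - g v * (u - v)| <= G * (u - v) ^+ 2.
Hypothesis ig_loop : ig 1 = ig 0.

Let pf := probability_finite P.
Let N0 : 0 < N. Proof. by rewrite ltr0n. Qed.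
Let s0 : 0 < s. Proof. by rewrite sqrtr_gt0. Qed.
Let ss : s * s = N. Proof. by rewrite -expr2 sqr_sqrtr// ltW. Qed.
Let invs : s^-1 = s / N.
Proof. by rewrite -[X in _ / X]ss invfM mulrA divff ?mul1r// gt_eqF. Qed.
Let M0R : (0 : R) < M%:R. Proof. by rewrite ltr0n. Qed.

Let e j m w := cell m (theta j w).
Let b j m w := below m (theta j w).
Let xi m w := N^-1 * \sum_j b j m w.
Let cnt m w := \sum_j e j m w.
Let al m w := \sum_j a j * e j m w.
Let rho j w := (\sum_j' (theta j' w <= theta j w)%R)%:R / N.
Let V m w := xi m w - F (x_ m).

Let bcell m : bdd_meas setT (cell m).
Proof. by apply: bdd_meas_indic; exact: measurable_itv. Qed.
Let bbelow m : bdd_meas setT (below m).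
Proof. by apply: bdd_meas_indic; exact: measurable_itv. Qed.
Let be j m : bdd_meas setT (e j m).
Proof. exact: (bdd_meas_RV theta j (bcell m)). Qed.
Let bb j m : bdd_meas setT (b j m).
Proof. exact: (bdd_meas_RV theta j (bbelow m)). Qed.
Let bxi m : bdd_meas setT (xi m).
Proof. by apply: bdd_measZ; apply: (@bdd_meas_sum _ _ _ _ _ _ _ (fun j => b j m)). Qed.
Let bcnt m : bdd_meas setT (cnt m).
Proof. exact: (@bdd_meas_sum _ _ _ _ _ _ _ (fun j => e j m)). Qed.
Let bal m : bdd_meas setT (al m).
Proof.
apply: (@bdd_meas_sum _ _ _ _ _ _ _ (fun j w => a j * e j m w)) => j.
exact: bdd_measZ.
Qed.
Let bV m : bdd_meas setT (V m).
Proof. by apply: bdd_measB => //; exact: bdd_meas_cst. Qed.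

Let eE j m w : e j m w = ((x_ m <= theta j w) && (theta j w < x_ m.+1))%:R.
Proof.
rewrite /e /cell indicE; congr (nat_of_bool _)%:R.
by apply/idP/idP => [/set_mem/=|H]; [|apply/mem_set => /=]; rewrite in_itv.
Qed.

Let bE j m w : b j m w = (theta j w < x_ m)%R%:R.
Proof.
rewrite /b /below indicE; congr (nat_of_bool _)%:R.
by apply/idP/idP => [/set_mem/=|H]; [|apply/mem_set => /=]; rewrite in_itv.
Qed.

Let e_ge0 j m w : 0 <= e j m w. Proof. by rewrite eE. Qed.
Let cnt_ge0 m w : 0 <= cnt m w. Proof. by apply: sumr_ge0. Qed.

Let b_step j m w : b j m.+1 w = b j m w + e j m w.
Proof.
rewrite !bE eE; have := x_mono (leqnSn m).
case: (ltP (theta j w) (x_ m)) => /= h1 h2; last by rewrite add0r.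
by rewrite (lt_le_trans h1 h2) addr0.
Qed.

Let xi_step m w : xi m.+1 w - xi m w = cnt m w / N.
Proof.
rewrite /xi /cnt -mulrBr mulrC -sumrB; congr (_ * _).
by apply: eq_bigr => j _; rewrite b_step addrAC subrr add0r.
Qed.

Let xi0 w : xi 0 w = 0.
Proof.
rewrite /xi big1 ?mulr0// => j _; rewrite bE.
by have /andP[/le_gtF ->] := theta_range j w.
Qed.

Let xiM w : xi M w = 1.
Proof.
rewrite /xi (eq_bigr (fun=> 1)); last first.
  by move=> j _; rewrite bE; have /andP[_ ->] := theta_range j w.
by rewrite sumr_const mulVf// gt_eqF.
Qed.

Let e_sum j w : \sum_(m < M) e j m w = 1.
Proof.
have -> : \sum_(m < M) e j m w = b j M w - b j 0 w.
  elim: M => [|k IH]; first by rewrite big_ord0 subrr.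
  by rewrite big_ord_recr/= IH b_step; ring.
by rewrite !bE; have /andP[/le_gtF -> ->] := theta_range j w; rewrite subr0.
Qed.

Let split_cells (u : J -> R) w : \sum_j u j = \sum_(m < M) \sum_j e j m w * u j.
Proof.
rewrite exchange_big/=; apply: eq_bigr => j _.
by rewrite -mulr_suml e_sum mul1r.
Qed.

Let xi01 m w : 0 <= xi m w <= 1.
Proof.
rewrite /xi mulr_ge0 ?invr_ge0 ?(ltW N0)//=; last first.
  by apply: sumr_ge0 => j _; rewrite bE.
rewrite mulrC ler_pdivrMr// mul1r -sumr_const.
by apply: ler_sum => j _; rewrite bE; case: (_ < _).
Qed.

Let V_le1 m w : (m < M)%N -> `|V m w| <= 1.
Proof.
by move=> mM; have := xi01 m w; have := F01 mM; rewrite /V ler_norml; lra.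
Qed.

(* The rank of an observation of a cell lies between the counts at its ends. *)
Let rho_cell j m w : e j m w != 0 -> `|rho j w - xi m w| <= cnt m w / N.
Proof.
rewrite eE; case: (boolP (_ && _)) => [/andP[h1 h2] _|_]; last by rewrite eqxx.
suff : xi m w <= rho j w <= xi m.+1 w.
  by rewrite -xi_step ler_norml; lra.
rewrite /xi /rho natr_sum !(mulrC _ N^-1) !ler_pM2l ?invr_gt0//.
apply/andP; split; apply: ler_sum => j' _; rewrite bE ler_nat.
  by case: (ltP (theta j' w)) => // h3; rewrite (ltW (lt_le_trans h3 h1)).
by case: (leP (theta j' w)) => // h3; rewrite (le_lt_trans h3 h2).
Qed.

Let al_le m w : `|al m w| <= A / s * cnt m w.
Proof.
rewrite /al mulr_sumr; apply: (le_trans (ler_norm_sum _ _ _)).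
by apply: ler_sum => j _; rewrite normrM (ger0_norm (e_ge0 _ _ _)) ler_wpM2r.
Qed.

Let W w := \sum_j (a j + s^-1) * g (rho j w).
Let L w := \sum_j a j * g (F (theta j w)).
Let Eal m := Ex (al m).

Let G0 : 0 <= G. Proof. exact: (le_trans _ (dg_le 0)). Qed.
Let A0 : 0 <= A.
Proof.
have /card_gt0P[j _] := J0.
have := le_trans (normr_ge0 _) (a_le j).
by rewrite pmulr_lge0 ?invr_gt0.
Qed.

Let err_rank w :
  `|W w - \sum_(m < M) (al m w + s * (xi m.+1 w - xi m w)) * g (xi m w)| <=
  (A + 1) * G / (s * N) * \sum_(m < M) cnt m w ^+ 2.
Proof.
have -> : W w - \sum_(m < M) (al m w + s * (xi m.+1 w - xi m w)) * g (xi m w) =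
    \sum_(m < M) \sum_j e j m w * ((a j + s^-1) * (g (rho j w) - g (xi m w))).
  rewrite /W (split_cells _ w) -sumrB; apply: eq_bigr => m _.
  under [RHS]eq_bigr do rewrite mulrBr mulrBr.
  rewrite sumrB; congr (_ - _).
  under [RHS]eq_bigr do rewrite mulrA.
  rewrite -mulr_suml; congr (_ * _).
  under [RHS]eq_bigr do rewrite mulrDr.
  rewrite big_split/= /al; congr (_ + _).
    by apply: eq_bigr => j _; rewrite mulrC.
  rewrite xi_step -mulr_suml -/(cnt m w) invs; ring.
apply: (le_trans (ler_norm_sum _ _ _)); rewrite mulr_sumr.
apply: ler_sum => m _; apply: (le_trans (ler_norm_sum _ _ _)).
have -> : (A + 1) * G / (s * N) * cnt m w ^+ 2 =
    \sum_j e j m w * ((A + 1) / s * (G * (cnt m w / N))).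
  rewrite -mulr_suml -/(cnt m w); field.
  by rewrite !gt_eqF.
apply: ler_sum => j _; rewrite normrM (ger0_norm (e_ge0 _ _ _)).
have [->|ne] := eqVneq (e j m w) 0; first by rewrite !mul0r.
apply: ler_wpM2l => //; rewrite normrM; apply: ler_pM => //.
  apply: (le_trans (ler_normD _ _)); rewrite mulrDl lerD// mul1r.
  by rewrite ger0_norm// invr_ge0 ltW.
by apply: (le_trans (g_lip _ _)); rewrite ler_wpM2l// rho_cell.
Qed.

(* The sum of [ig (xi m.+1) - ig (xi m)] telescopes to [ig 1 - ig 0 = 0], and each
   term is the corresponding term of the Riemann sum up to a square. *)
Let err_riemann w :
  `|\sum_(m < M) (s * (xi m.+1 w - xi m w)) * g (xi m w)| <=
  G / (s * N) * \sum_(m < M) cnt m w ^+ 2.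
Proof.
have tel : \sum_(m < M) (ig (xi m.+1 w) - ig (xi m w)) = 0.
  rewrite -(big_mkord xpredT (fun m => ig (xi m.+1 w) - ig (xi m w))).
  by rewrite telescope_sumr// xiM xi0 ig_loop subrr.
have -> : \sum_(m < M) (s * (xi m.+1 w - xi m w)) * g (xi m w) =
    - (s * \sum_(m < M) (ig (xi m.+1 w) - ig (xi m w) -
      g (xi m w) * (xi m.+1 w - xi m w))).
  rewrite sumrB tel sub0r mulrN opprK mulr_sumr.
  by apply: eq_bigr => m _; ring.
rewrite normrN normrM (ger0_norm (ltW s0)).
rewrite [leRHS](_ : _ = s * \sum_(m < M) (G * (cnt m w / N) ^+ 2)); last first.
  rewrite !mulr_sumr; apply: eq_bigr => m _; rewrite invfM invs; field.
  by rewrite gt_eqF.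
rewrite ler_wpM2l ?(ltW s0)//; apply: (le_trans (ler_norm_sum _ _ _)).
by apply: ler_sum => m _; rewrite -xi_step.
Qed.

Let err_taylor w :
  `|\sum_(m < M) al m w * g (xi m w) - \sum_(m < M) al m w * g (F (x_ m))| <=
  A * G / s * \sum_(m < M) cnt m w * V m w ^+ 2 +
  G * \sum_(m < M) (`|(al m w - Eal m) * V m w| + `|Eal m| * `|V m w|).
Proof.
rewrite -sumrB; apply: (le_trans (ler_norm_sum _ _ _)).
rewrite !mulr_sumr -big_split/=; apply: ler_sum => m _.
rewrite -mulrBr.
have -> : al m w * (g (xi m w) - g (F (x_ m))) =
    al m w * (g (xi m w) - g (F (x_ m)) - dg (F (x_ m)) * V m w) +
    dg (F (x_ m)) * ((al m w - Eal m) * V m w + Eal m * V m w).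
  by ring.
apply: (le_trans (ler_normD _ _)); apply: lerD; rewrite normrM.
  rewrite [leRHS](_ : _ = (A / s * cnt m w) * (G * V m w ^+ 2)); last by ring.
  by apply: ler_pM => //; exact: g_taylor.
apply: ler_pM => //; apply: (le_trans (ler_normD _ _)).
by rewrite (normrM (Eal m)).
Qed.

Let err_cells w :
  `|\sum_(m < M) al m w * g (F (x_ m)) - L w| <= A * G * c * (s / M%:R).
Proof.
have -> : \sum_(m < M) al m w * g (F (x_ m)) - L w =
    \sum_(m < M) \sum_j e j m w * (a j * (g (F (x_ m)) - g (F (theta j w)))).
  rewrite /L (split_cells _ w) -sumrB; apply: eq_bigr => m _.
  rewrite /al mulr_suml -sumrB; apply: eq_bigr => j _; ring.
apply: (le_trans (ler_norm_sum _ _ _)).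
have -> : A * G * c * (s / M%:R) =
    \sum_(m < M) \sum_j e j m w * (A / s * (G * (c / M%:R))).
  rewrite -(split_cells (fun=> _)) sumr_const -[RHS]mulr_natr invs.
  by field; rewrite !gt_eqF.
apply: ler_sum => m _; apply: (le_trans (ler_norm_sum _ _ _)).
apply: ler_sum => j _; rewrite normrM (ger0_norm (e_ge0 _ _ _)).
have [->|ne] := eqVneq (e j m w) 0; first by rewrite !mul0r.
apply: ler_wpM2l => //; rewrite normrM; apply: ler_pM => //.
apply: (le_trans (g_lip _ _)); rewrite ler_wpM2l// distrC F_cell//.
by move: ne; rewrite eE; case: (_ && _); rewrite ?eqxx.
Qed.

Let Ecnt m : (m < M)%N -> Ex (cnt m) <= N * (c / M%:R).
Proof.
move=> mM; rewrite (@bint_sum _ _ _ _ _ measurableT pf _ _ _ (fun j => e j m))//.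
rewrite mulr_natl -sumr_const; apply: ler_sum => j _; exact: cell_le.
Qed.

Let E_cell2 j m : (m < M)%N -> Ex (fun w => e j m w ^+ 2) <= c / M%:R.
Proof.
move=> mM; rewrite (_ : (fun w => _) = e j m); first exact: cell_le.
by apply/funext => w; rewrite eE; case: (_ && _); rewrite ?expr1n ?expr0n.
Qed.

Let Evar_cnt m : (m < M)%N ->
  Ex (fun w => (cnt m w - Ex (cnt m)) ^+ 2) <= N * (c / M%:R).
Proof.
move=> mM; have := centered_sum_sq_le indtheta (fun=> bcell m).
under eq_Rintegral do rewrite sumrB.
rewrite -(@bint_sum _ _ _ _ _ measurableT pf _ _ _ (fun j => e j m))//.
move/le_trans; apply; rewrite mulr_natl -sumr_const.
by apply: ler_sum => j _; exact: E_cell2.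
Qed.

Let Evar_al m : (m < M)%N ->
  Ex (fun w => (al m w - Eal m) ^+ 2) <= A ^+ 2 * (c / M%:R).
Proof.
move=> mM; have ba (j : J) := bdd_measZ (a j) (bcell m).
have := centered_sum_sq_le indtheta ba.
under eq_Rintegral do rewrite sumrB.
rewrite -(@bint_sum _ _ _ _ _ measurableT pf _ _ _ (fun j w => a j * e j m w)); last first.
  by move=> j; exact: bdd_measZ.
move/le_trans; apply.
rewrite [leRHS](_ : _ = \sum_(j : J) (A / s) ^+ 2 * (c / M%:R)); last first.
  rewrite sumr_const -[RHS]mulr_natr expr_div_n (expr2 s) ss.
  by field; rewrite !gt_eqF.
apply: ler_sum => j _; under eq_Rintegral do rewrite exprMn.
rewrite (bintZ measurableT pf); last exact: (bdd_measX 2 (be j m)).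
apply: ler_pM => //; first exact: sqr_ge0.
- by apply: bint_ge0 => w _; exact: sqr_ge0.
- by rewrite -(real_normK (num_real (a j))) ler_pXn2r ?nnegrE// divr_ge0// ltW.
- exact: E_cell2.
Qed.

Let EV2 m : (m < M)%N -> Ex (fun w => V m w ^+ 2) <= (2 + 2 * c ^+ 2) / N.
Proof.
move=> mM.
have bv (j : J) := bdd_measZ N^-1 (bbelow m).
have := centered_sum_sq_le indtheta bv.
under eq_Rintegral do rewrite sumrB -mulr_sumr -/(xi m _).
pose q := \sum_j Ex (fun w => N^-1 * b j m w); rewrite -/q => Hv.
have qF : `|q - F (x_ m)| <= c / s.
  rewrite /q (eq_bigr (fun j => N^-1 * Ex (b j m))); last first.
    by move=> j _; rewrite (bintZ measurableT pf N^-1 (bb j m)).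
  rewrite -mulr_sumr (_ : F (x_ m) = N^-1 * \sum_(j : J) F (x_ m)); last first.
    by rewrite sumr_const -[X in _ * X]mulr_natl mulKf// gt_eqF.
  rewrite -mulrBr -sumrB normrM gtr0_norm ?invr_gt0//.
  rewrite mulrC ler_pdivrMr// mulr_natr -sumr_const.
  apply: (le_trans (ler_norm_sum _ _ _)); apply: ler_sum => j _.
  exact: below_close.
have q2 : (q - F (x_ m)) ^+ 2 <= c ^+ 2 / N.
  rewrite -(real_normK (num_real _)) -ss -expr2 -expr_div_n.
  by rewrite ler_pXn2r ?nnegrE// (le_trans (normr_ge0 _) qF).
have Hv' : Ex (fun w => (xi m w - q) ^+ 2) <= N^-1.
  apply: (le_trans Hv).
  rewrite [leRHS](_ : _ = \sum_(j : J) N^-2); last first.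
    by rewrite sumr_const -[RHS]mulr_natr; field; rewrite gt_eqF.
  apply: ler_sum => j _; under eq_Rintegral do rewrite exprMn.
  have b2 := bdd_measX 2 (bb j m).
  rewrite (bintZ measurableT pf)// exprVn ler_piMr ?invr_ge0 ?exprn_ge0 ?(ltW N0)//.
  apply: Rintegral_prob_le => // w; rewrite -/(b j m w) bE.
  by case: (_ < _); rewrite ?expr1n ?expr0n.
have bq : bdd_meas [set: T] (fun=> q) by exact: bdd_meas_cst.
have b1 : bdd_meas setT (fun w => 2 * (xi m w - q) ^+ 2).
  by apply/bdd_measZ/bdd_measX/bdd_measB.
have b2 : bdd_meas [set: T] (fun=> 2 * (q - F (x_ m)) ^+ 2) by exact: bdd_meas_cst.
apply: (@le_trans _ _ (Ex (fun w => 2 * (xi m w - q) ^+ 2 + 2 * (q - F (x_ m)) ^+ 2))).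
  apply: le_bint => //; [exact: bdd_measX|exact: bdd_measD|].
  move=> w _; rewrite /V; have := sqr_ge0 ((xi m w - q) - (q - F (x_ m))).
  by nra.
rewrite (bintD measurableT pf b1 b2) Rintegral_prob_cst (bintZ measurableT pf).
  by rewrite mulrDl; lra.
exact/bdd_measX/bdd_measB.
Qed.

(* As the contrasts sum to zero, the common part [F (x_ m.+1) - F (x_ m)] of the
   probabilities of the cell cancels. *)
Let Eal_le m : (m < M)%N -> `|Eal m| <= A * c / M%:R.
Proof.
move=> mM; rewrite /Eal (@bint_sum _ _ _ _ _ measurableT pf _ _ _
  (fun j w => a j * e j m w)); last by move=> j; exact: bdd_measZ.
under eq_bigr do rewrite (bintZ measurableT pf)//.
rewrite (_ : \sum_j _ = \sum_j a j * (Ex (e j m) - (F (x_ m.+1) - F (x_ m)))); last first.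
  under [RHS]eq_bigr do rewrite mulrBr.
  by rewrite sumrB -mulr_suml a_sum0 mul0r subr0.
apply: (le_trans (ler_norm_sum _ _ _)).
rewrite [leRHS](_ : _ = \sum_(j : J) A / s * (c / (s * M%:R))); last first.
  rewrite sumr_const -[RHS]mulr_natr (_ : _ * N = A * c / M%:R * (N / (s * s))).
    by rewrite ss divff ?mulr1// gt_eqF.
  by field; rewrite !gt_eqF.
apply: ler_sum => j _; rewrite normrM; apply: ler_pM => //.
exact: cell_close.
Qed.

Local Notation K := (2 + 2 * c ^+ 2).
Local Notation u := (Num.sqrt (M%:R : R)).

Let u0 : 0 < u. Proof. by rewrite sqrtr_gt0. Qed.
Let uu : u * u = M%:R. Proof. by rewrite -expr2 sqr_sqrtr// ltW. Qed.

Let bN m : bdd_meas setT (fun w => cnt m w - Ex (cnt m)).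
Proof. by apply: bdd_measB => //; exact: bdd_meas_cst. Qed.
Let bal0 m : bdd_meas setT (fun w => al m w - Eal m).
Proof. by apply: bdd_measB => //; exact: bdd_meas_cst. Qed.

Let Ecnt_ge0 m : 0 <= Ex (cnt m).
Proof. by apply: bint_ge0 => w _; exact: cnt_ge0. Qed.

Let Ecnt2 m : (m < M)%N ->
  Ex (fun w => cnt m w ^+ 2) <= 2 * N * (c / M%:R) + 2 * (N * (c / M%:R)) ^+ 2.
Proof.
move=> mM; have b1 := bdd_measZ 2 (bdd_measX 2 (bN m)).
have b2 : bdd_meas [set: T] (fun=> 2 * Ex (cnt m) ^+ 2) by exact: bdd_meas_cst.
apply: (@le_trans _ _
    (Ex (fun w => 2 * (cnt m w - Ex (cnt m)) ^+ 2 + 2 * Ex (cnt m) ^+ 2))).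
  apply: le_bint => //; [exact: bdd_measX|exact: bdd_measD|].
  move=> w _; have := sqr_ge0 (cnt m w - 2 * Ex (cnt m)); by nra.
rewrite (bintD measurableT pf b1 b2) Rintegral_prob_cst (bintZ measurableT pf).
  apply: lerD; first by rewrite -mulrA ler_pM2l// Evar_cnt.
  rewrite ler_pM2l// ler_pXn2r ?nnegrE// ?(le_trans (Ecnt_ge0 m))//; exact: Ecnt.
exact: bdd_measX.
Qed.

(* The weight in the additive Cauchy--Schwarz inequality balances the variance
   [N / M] of the count against the second moment [1 / N] of [V m]; the same
   balancing is used in the next two estimates. *)
Let EcntV2 m : (m < M)%N ->
  Ex (fun w => cnt m w * V m w ^+ 2) <= (c + K) / u + c * K / M%:R.
Proof.
move=> mM; have bV2 := bdd_measX 2 (bV m).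
have b1 : bdd_meas setT (fun w => `|(cnt m w - Ex (cnt m)) * V m w|).
  exact/bdd_meas_norm/bdd_measM.
have b2 := bdd_measZ (Ex (cnt m)) bV2.
apply: (@le_trans _ _ (Ex (fun w => `|(cnt m w - Ex (cnt m)) * V m w| +
    Ex (cnt m) * V m w ^+ 2))).
  apply: le_bint => //; [exact: bdd_measM|exact: bdd_measD|].
  move=> w _; rewrite -lerBlDr -mulrBl (le_trans (ler_norm _))// !normrM.
  by rewrite ler_wpM2l// ler_piMr// V_le1.
rewrite (bintD measurableT pf b1 b2) (bintZ measurableT pf)//.
have r0 : 0 < u / N by rewrite divr_gt0.
apply: lerD.
  apply: (le_trans (bint_normM_le measurableT pf r0 (bN m) (bV m))).
  rewrite mulrDl; apply: lerD.
    rewrite [leRHS](_ : _ = u / N * (N * (c / (u * u)))); last first.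
      by field; rewrite !gt_eqF.
    by rewrite uu ler_pM2l// Evar_cnt.
  rewrite [leRHS](_ : _ = (u / N)^-1 * (K / N)); last first.
    by field; rewrite !gt_eqF.
  by rewrite ler_pM2l ?invr_gt0// EV2.
rewrite [leRHS](_ : _ = N * (c / M%:R) * (K / N)); last first.
  by field; rewrite !gt_eqF.
by apply: ler_pM => //; [exact: bint_ge0 (fun w _ => sqr_ge0 _)|exact: Ecnt|exact: EV2].
Qed.

Let EalV m : (m < M)%N ->
  Ex (fun w => `|(al m w - Eal m) * V m w|) <= (A ^+ 2 * c + K) / (u * s).
Proof.
move=> mM; have r0 : 0 < u / s by rewrite divr_gt0.
apply: (le_trans (bint_normM_le measurableT pf r0 (bal0 m) (bV m))).
rewrite mulrDl; apply: lerD.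
  rewrite [leRHS](_ : _ = u / s * (A ^+ 2 * (c / (u * u)))); last first.
    by field; rewrite !gt_eqF.
  by rewrite uu ler_pM2l// Evar_al.
rewrite [leRHS](_ : _ = (u / s)^-1 * (K / (s * s))); last first.
  by field; rewrite !gt_eqF.
by rewrite ss ler_pM2l ?invr_gt0// EV2.
Qed.

Let EnormV m : (m < M)%N -> Ex (fun w => `|V m w|) <= (K + 1) / s.
Proof.
move=> mM; have b1 : bdd_meas [set: T] (fun=> 1 : R) by exact: bdd_meas_cst.
have := bint_normM_le measurableT pf s0 (bV m) b1.
under eq_Rintegral do rewrite mulr1.
move/le_trans; apply; under [X in _ + _ * X]eq_Rintegral do rewrite expr1n.
rewrite Rintegral_prob_cst mulr1 mulrDl mul1r lerD2r.
rewrite [leRHS](_ : _ = s * (K / (s * s))); last by field; rewrite gt_eqF.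
by rewrite ss ler_pM2l// EV2.
Qed.

Lemma rank_linearization :
  Ex (fun w => `|\sum_j (a j + s^-1) *
      g ((\sum_j' (theta j' w <= theta j w)%R)%:R / N) -
    \sum_j a j * g (F (theta j w))|) <=
  (2 * (A + 2) * G * c ^+ 2 + A * G * c) * (s / M%:R) +
  (2 * (A + 2) * G * c + A * G * c * K + G * A * c * (K + 1)) / s +
  (A * G * (c + K) + G * (A ^+ 2 * c + K)) * (u / s).
Proof.
pose k1 := (A + 2) * G / (s * N); pose k2 := A * G / s.
pose q m w := k1 * cnt m w ^+ 2 + k2 * (cnt m w * V m w ^+ 2) +
  (G * `|(al m w - Eal m) * V m w| + G * `|Eal m| * `|V m w|).
have k1_ge0 : 0 <= k1.
  by rewrite /k1 divr_ge0 ?mulr_ge0 ?addr_ge0 ?(ltW s0) ?(ltW N0).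
have k2_ge0 : 0 <= k2 by rewrite /k2 divr_ge0 ?mulr_ge0 ?(ltW s0).
have bq1 m : bdd_meas setT (fun w => k1 * cnt m w ^+ 2) by exact/bdd_measZ/bdd_measX.
have bq2 m : bdd_meas setT (fun w => k2 * (cnt m w * V m w ^+ 2)).
  exact/bdd_measZ/bdd_measM/bdd_measX.
have bq3 m : bdd_meas setT (fun w => G * `|(al m w - Eal m) * V m w|).
  exact/bdd_measZ/bdd_meas_norm/bdd_measM.
have bq4 m : bdd_meas setT (fun w => G * `|Eal m| * `|V m w|).
  exact/bdd_measZ/bdd_meas_norm.
have bq12 m := bdd_measD (bq1 m) (bq2 m).
have bq34 m := bdd_measD (bq3 m) (bq4 m).
have bq m : bdd_meas setT (q m) by exact: bdd_measD (bq12 m) (bq34 m).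
have bqs : bdd_meas setT (fun w => \sum_(m < M) q m w).
  exact: (@bdd_meas_sum _ _ _ _ _ _ _ (fun (m : 'I_M) w => q m w)).
have bW : bdd_meas setT W.
  apply: (@bdd_meas_sum _ _ _ _ _ _ _ (fun j w => (a j + s^-1) * g (rho j w))) => j.
  apply/bdd_measZ/(bdd_meas_comp (X := rho j)) => //.
  rewrite /rho; under eq_fun do rewrite natr_sum.
  apply: measurable_funM; last exact: measurable_cst.
  apply: (@measurable_sum _ _ _ _ _ _ (fun j' w => (theta j' w <= theta j w)%R%:R)) => j'.
  apply: (measurableT_comp (f := fun t : bool => t%:R : R)) => //.
  exact: measurable_fun_ler.
have bL : bdd_meas setT L.
  apply: (@bdd_meas_sum _ _ _ _ _ _ _ (fun j w => a j * g (F (theta j w)))) => j.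
  apply/bdd_measZ/(bdd_meas_comp (X := fun w => F (theta j w))) => //.
  exact: measurableT_comp.
have bcst : bdd_meas [set: T] (fun=> A * G * c * (s / M%:R)) by exact: bdd_meas_cst.
have pw w : `|W w - L w| <= \sum_(m < M) q m w + A * G * c * (s / M%:R).
  have -> : W w - L w =
      (W w - \sum_(m < M) (al m w + s * (xi m.+1 w - xi m w)) * g (xi m w)) +
      \sum_(m < M) (s * (xi m.+1 w - xi m w)) * g (xi m w) +
      (\sum_(m < M) al m w * g (xi m w) - \sum_(m < M) al m w * g (F (x_ m))) +
      (\sum_(m < M) al m w * g (F (x_ m)) - L w).
    rewrite (_ : \sum_(m < M) (_ + _) * _ = \sum_(m < M) al m w * g (xi m w) +
        \sum_(m < M) (s * (xi m.+1 w - xi m w)) * g (xi m w)); first by ring.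
    by rewrite -big_split/=; apply: eq_bigr => m _; rewrite mulrDl.
  apply: (le_trans (ler_normD _ _)); apply: lerD; last exact: err_cells.
  apply: (le_trans (ler_normD _ _)).
  rewrite !big_split/= -addrA -!mulr_sumr addrA.
  rewrite [leRHS](_ : _ = k1 * \sum_(m < M) cnt m w ^+ 2 +
    (k2 * \sum_(m < M) cnt m w * V m w ^+ 2 +
     G * \sum_(m < M) (`|(al m w - Eal m) * V m w| + `|Eal m| * `|V m w|))); last first.
    rewrite big_split/= mulrDr !addrA; congr (_ + _).
    by rewrite !mulr_sumr; apply: eq_bigr => m _; rewrite mulrA.
  apply: lerD; last exact: err_taylor.
  apply: (le_trans (ler_normD _ _)).
  rewrite [leRHS](_ : _ = (A + 1) * G / (s * N) * \sum_(m < M) cnt m w ^+ 2 +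
     G / (s * N) * \sum_(m < M) cnt m w ^+ 2); last by rewrite /k1; ring.
  by apply: lerD; [exact: err_rank|exact: err_riemann].
rewrite -[leLHS]/(Ex (fun w => `|W w - L w|)).
apply: (@le_trans _ _ (Ex (fun w => \sum_(m < M) q m w + A * G * c * (s / M%:R)))).
  apply: le_bint => //; first exact/bdd_meas_norm/bdd_measB.
  exact: bdd_measD.
rewrite (bintD measurableT pf bqs bcst) Rintegral_prob_cst.
rewrite (@bint_sum _ _ _ _ _ measurableT pf _ _ _ (fun (m : 'I_M) w => q m w))//.
pose B := k1 * (2 * N * (c / M%:R) + 2 * (N * (c / M%:R)) ^+ 2) +
  k2 * ((c + K) / u + c * K / M%:R) +
  (G * ((A ^+ 2 * c + K) / (u * s)) + G * (A * c / M%:R) * ((K + 1) / s)).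
have qB (m : 'I_M) : Ex (q m) <= B.
  rewrite (bintD measurableT pf (bq12 m) (bq34 m)).
  rewrite (bintD measurableT pf (bq1 m) (bq2 m)) (bintD measurableT pf (bq3 m) (bq4 m)).
  rewrite !(bintZ measurableT pf); last 4 first.
  - exact: bdd_meas_norm.
  - exact/bdd_meas_norm/bdd_measM.
  - exact/bdd_measM/bdd_measX.
  - exact: bdd_measX.
  rewrite /B; apply: lerD; apply: lerD.
  - by rewrite ler_wpM2l// Ecnt2.
  - by rewrite ler_wpM2l// EcntV2.
  - by rewrite ler_wpM2l// EalV.
  - apply: ler_pM; rewrite ?mulr_ge0//.
    + by apply: bint_ge0 => w _.
    + by rewrite ler_wpM2l// Eal_le.
    + exact: EnormV.
have sumB : \sum_(m < M) Ex (q m) <= M%:R * B.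
  by rewrite mulr_natl -[X in B *+ X](card_ord M) -sumr_const; exact: ler_sum.
apply: (le_trans (lerD sumB (lexx _))).
rewrite le_eqVlt; apply/orP; left; apply/eqP; rewrite /B /k1 /k2.
move: ss uu s0 u0; move: (s) (u) => t v <- <- t0 v0.
by field; rewrite !gt_eqF.
Qed.

End rank_linearization.

(** * Circular densities and their distribution functions *)

Section circular_density.
Variables (R : realType) (f : R -> R).
Hypothesis hf : C1_circular_density f.

Local Notation mu := (@lebesgue_measure R).
Local Notation D0 := `[(0 : R), 2 * pi[%classic.
Local Notation F := (circular_cdf f).
Local Notation df := (derive1 f).

Lemma pi2_gt0 : 0 < 2 * pi :> R. Proof. by rewrite mulr_gt0 ?pi_gt0. Qed.
Hint Resolve pi2_gt0 : core.

Lemma measurable_circle : measurable D0. Proof. exact: measurable_itv. Qed.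

Lemma circle_measure : mu D0 = (2 * pi)%:E.
Proof. by rewrite lebesgue_measure_itv/= lte_fin pi2_gt0 -EFinB subr0. Qed.

Lemma circle_finite : (mu D0 < +oo)%E.
Proof. by rewrite circle_measure ltry. Qed.

Let mD := measurable_circle.
Let fD := circle_finite.

Lemma density_is_derive (x : R) : is_derive x 1 f (df x).
Proof. by case: hf => _ _ _ dfx _; rewrite derive1E; apply: derivableP. Qed.

Lemma density_continuous : continuous f.
Proof.
move=> x; apply/differentiable_continuous/derivable1_diffP.
by have [] := density_is_derive x.
Qed.

Lemma density_ge0 x : 0 <= f x. Proof. by case: hf. Qed.

Lemma within_density_continuous (A : set R) : {within A, continuous f}.
Proof. exact: continuous_subspaceT density_continuous. Qed.

Lemma continuous_itv_bdd (g : R -> R) (a b : R) :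
  {within `[a, b], continuous g} -> exists B : R, forall x, a <= x <= b -> `|g x| <= B.
Proof.
move=> cg; have [M [_ hM]] := compact_bounded (continuous_compact cg (@segment_compact _ a b)).
exists (M + 1) => x xab; apply: hM; first by rewrite ltrDl.
by exists x => //=; rewrite in_itv.
Qed.

(** The shifts are bounded, so the densities of all the samples and their
   derivatives are bounded by one constant. *)
Lemma density_window (H : R) : 0 <= H -> exists2 B : R, 0 <= B &
  forall x, - H <= x <= 2 * pi + H -> `|f x| <= B /\ `|df x| <= B.
Proof.
move=> H0; have [B1 h1] := continuous_itv_bdd (@within_density_continuous `[- H, 2 * pi + H]).
have cdf : {within `[- H, 2 * pi + H], continuous df}.
  by apply: continuous_subspaceT; case: hf.
have [B2 h2] := continuous_itv_bdd cdf.
exists (Num.max (Num.max B1 B2) 0); first by rewrite le_max lexx orbT.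
by move=> x xH; rewrite !le_max h1// h2// !orbT.
Qed.

Lemma density_integrable (A : set R) (a b : R) : A `<=` `[a, b] -> measurable A ->
  mu.-integrable A (EFin \o f).
Proof.
move=> Aab mA; apply: (@integrableS _ _ _ mu `[a, b]) => //.
apply: continuous_compact_integrable; first exact: segment_compact.
exact: within_density_continuous.
Qed.

Lemma cdfB a b : 0 <= a -> a <= b -> F b - F a = \int[mu]_(x in `]a, b]) f x.
Proof.
move=> a0 ab; rewrite /circular_cdf.
rewrite -(@Rintegral_itvB _ f (BLeft 0) (BRight b) a) ?bnd_simp//.
exact: (@density_integrable _ 0 b).
Qed.

Lemma cdf_mono a b : a <= b -> F a <= F b.
Proof.
move=> ab; have [a0|a0] := leP 0 a.
  by rewrite -subr_ge0 cdfB//; apply: Rintegral_ge0 => x _; exact: density_ge0.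
rewrite {1}/circular_cdf set_itv_ge ?bnd_simp -?ltNge// Rintegral_set0.
by apply: Rintegral_ge0 => x _; exact: density_ge0.
Qed.

Lemma measurable_cdf : measurable_fun setT F.
Proof.
apply: nondecreasing_measurable => // a b ab.
by apply: cdf_mono.
Qed.

Lemma cdf0 : F 0 = 0.
Proof. by rewrite /circular_cdf set_itv1 Rintegral_set1. Qed.

Lemma cdf_2pi : F (2 * pi) = 1.
Proof.
rewrite /circular_cdf -Rintegral_itv_bndo_bndc; last first.
  by apply: (@density_integrable _ 0 (2 * pi)) => //; exact: subset_itv_co_cc.
by rewrite /Rintegral; case: hf => _ -> .
Qed.

Lemma cdf01 x : 0 <= x <= 2 * pi -> 0 <= F x <= 1.
Proof. by move=> /andP[x0 x1]; rewrite -cdf0 -cdf_2pi !cdf_mono. Qed.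

Lemma Rintegral_indicM (g : R -> R) (A : set R) :
  \int[mu]_(x in D0) (\1_A x * g x) = \int[mu]_(x in D0 `&` A) g x.
Proof.
rewrite Rintegral_mkcondr; apply: eq_Rintegral => x _.
rewrite indicE patchE; case: (x \in A); first by rewrite mul1r.
by rewrite mul0r.
Qed.

Lemma circle_cell a b : 0 <= a -> b <= 2 * pi -> D0 `&` `[a, b[ = `[a, b[%classic.
Proof.
move=> a0 b2; apply/setIidPr => x /=; rewrite !in_itv/= => /andP[h1 h2].
by rewrite (le_trans a0 h1) (lt_le_trans h2 b2).
Qed.

Lemma cdf_cell a b : 0 <= a -> a <= b -> b <= 2 * pi ->
  \int[mu]_(x in D0) (\1_`[a, b[ x * f x) = F b - F a.
Proof.
move=> a0 ab b2; rewrite cdfB// Rintegral_indicM circle_cell//.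
rewrite Rintegral_itv_bndo_bndc; last first.
  by apply: (@density_integrable _ a b) => //; exact: subset_itv_co_cc.
rewrite -Rintegral_itv_obnd_cbnd//.
by apply: (@density_integrable _ a b) => //; exact: subset_itv_oc_cc.
Qed.

Lemma circle_cell_length a b : 0 <= a -> a <= b -> b <= 2 * pi ->
  \int[mu]_(x in D0) (\1_`[a, b[ x) = b - a.
Proof.
move=> a0 ab b2; under eq_Rintegral do rewrite -[\1__ _]mulr1.
rewrite Rintegral_indicM circle_cell// Rintegral_cst// mul1r.
have muab : mu `[a, b[%classic = (b - a)%:E.
  rewrite lebesgue_measure_itv/= lte_fin; case: ltP => [_//|ba].
  by rewrite (le_anti (introT andP (conj ab ba))) subrr.
by rewrite [X in fine X]muab.
Qed.

Lemma cdf_within_continuous : {within `[0, 2 * pi], continuous F}.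
Proof.
apply: parameterized_integral_continuous; first exact: ltW.
exact: (@density_integrable _ 0 (2 * pi)).
Qed.

Lemma cdf_is_derive (x : R) : x \in `]0, 2 * pi[ -> is_derive x 1 F (f x).
Proof.
rewrite in_itv/= => /andP[x0 x1].
have [||||dF <-] := @continuous_FTC1_closed R f 0 x (2 * pi).
- by [].
- exact: (@density_integrable _ 0 (2 * pi)).
- by [].
- exact: density_continuous.
by rewrite derive1E; exact: derivableP.
Qed.

End circular_density.

(** * Shifted densities *)

(** Only one of the two points is confined to the segment: the other one may be
   a shifted argument leaving the circle. *)
Lemma heine_cantor (R : realType) (g : R -> R) (a b e : R) : continuous g -> 0 < e ->
  exists2 eta : R, 0 < eta & forall x y, a <= x <= b -> `|x - y| <= eta ->
    `|g x - g y| <= e.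
Proof.
move=> cg e0; have /compact_near_coveringP cab := @segment_compact _ a b.
have : \forall eta \near 0^'+, `[a, b] `<=` (fun x => forall y, `|x - y| <= eta -> `|g x - g y| <= e).
  apply: cab => x _.
  have e20 : 0 < e / 2 by rewrite divr_gt0.
  have /cvgrPdist_lt /(_ _ e20) := cg x.
  rewrite nearE => -[r/= r0 hr].
  exists (ball x (r / 2), [set eta | eta < r / 2]) => /=.
    split; first by apply: nbhsx_ballx; rewrite divr_gt0.
    by apply: nbhs_right_lt; rewrite divr_gt0.
  move=> [x' eta]/= [xx' etar] y xy.
  rewrite /ball/= in xx'.
  have h1 : `|g x - g x'| < e / 2 by apply: hr; rewrite /ball/=; lra.
  have h2 : `|g x - g y| < e / 2.
    apply: hr; rewrite /ball/= (_ : x - y = (x - x') + (x' - y)); last by ring.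
    by apply: (le_lt_trans (ler_normD _ _)); lra.
  rewrite (_ : g x' - g y = (g x - g y) - (g x - g x')); last by ring.
  by apply: (le_trans (ler_normB _ _)); lra.
rewrite nearE => -[r/= r0 hr]; exists (r / 2); first by rewrite divr_gt0.
move=> x y xab xy; apply: (hr (r / 2)) => //=.
- by rewrite sub0r normrN gtr0_norm ?divr_gt0//; lra.
- by rewrite divr_gt0.
Qed.

Section shifted_density.
Variables (R : realType) (f : R -> R).
Hypothesis hf : C1_circular_density f.

Local Notation mu := (@lebesgue_measure R).
Local Notation D0 := `[(0 : R), 2 * pi[%classic.
Local Notation F := (circular_cdf f).
Local Notation df := (derive1 f).

Let mD : measurable D0 := @measurable_circle R.
Let fD := circle_finite R.
Let circleD := @bintD _ _ R mu D0 mD fD.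
Let circleB := @bintB _ _ R mu D0 mD fD.
Let circleZ := @bintZ _ _ R mu D0 mD fD.
Let circle_norm := @bint_norm _ _ R mu D0 mD fD.
Let circle_norm_le := @bint_norm_le _ _ R mu D0 mD fD.
Let le_circle := @le_bint _ _ R mu D0 mD fD.
Let pi2 := pi2_gt0 R.

Variables (H B : R).
Hypothesis H0 : 0 <= H.
Hypothesis hB : forall x, - H <= x <= 2 * pi + H -> `|f x| <= B /\ `|df x| <= B.

Lemma in_circle (x : R) : D0 x -> 0 <= x < 2 * pi.
Proof. by rewrite /= in_itv. Qed.

Lemma shift_close (h x : R) : `|h| <= H -> 0 <= x <= 2 * pi ->
  `|f (x + h) - f x| <= B * `|h|.
Proof.
rewrite ler_norml => /andP[h1 h2] x2.
rewrite [X in B * `|X|](_ : h = x + h - x); last by ring.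
apply: (mean_value_le (df := df)) => [y|y]; first exact: density_is_derive.
rewrite minElt maxElt; case: ifP => _ hy; apply: (hB _).2; lra.
Qed.

Lemma bdd_meas_shift (h : R) : `|h| <= H -> bdd_meas D0 (fun x => f (x + h)).
Proof.
rewrite ler_norml => /andP[h1 h2]; split; last first.
  by exists B => x /in_circle xD; apply: (hB _).1; lra.
apply: (@measurable_funS _ _ _ _ setT) => //.
apply: continuous_measurable_fun => x.
apply: (@continuous_comp _ _ _ (fun x : R => x + h) f); last exact: density_continuous.
by apply: cvgD; [exact: cvg_id|exact: cvg_cst].
Qed.

Lemma bdd_meas_density : bdd_meas D0 f.
Proof.
have := @bdd_meas_shift 0; rewrite normr0 => /(_ H0).
rewrite (_ : (fun x => f (x + 0)) = f)//.
by apply/funext => x; rewrite addr0.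
Qed.

Lemma bdd_meas_circle (u : R -> R) : bdd_meas setT u -> bdd_meas D0 u.
Proof. exact: bdd_meas_subset. Qed.

Lemma shift_integral_close (h : R) (u : R -> R) : `|h| <= H -> bdd_meas D0 u ->
  `|\int[mu]_(x in D0) (u x * f (x + h)) - \int[mu]_(x in D0) (u x * f x)| <=
  B * `|h| * \int[mu]_(x in D0) `|u x|.
Proof.
move=> hh bu.
have b1 := bdd_measM bu (bdd_meas_shift hh); have b2 := bdd_measM bu bdd_meas_density.
rewrite -(circleB b1 b2); have b3 := bdd_measB b1 b2.
apply: (le_trans (circle_norm b3)).
rewrite -circleZ; last exact: bdd_meas_norm.
apply: le_circle; first exact: bdd_meas_norm.
  exact/bdd_measZ/bdd_meas_norm.
move=> x /in_circle xD; rewrite -mulrBr normrM mulrC ler_wpM2r//.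
by apply: shift_close => //; lra.
Qed.

Section law.
Context d (T : measurableType d) (P : probability T R) (X : {RV P >-> R}) (h : R).
Hypothesis hh : `|h| <= H.
Hypothesis hX : has_circular_density X (fun x => f (x + h)).

Local Notation Ex := (Rintegral P setT).
Let pf := probability_finite P.
Let bs := bdd_meas_shift hh.

(** Both sides are bounded linear functionals of [u], and the definition of a
   density says that they agree on indicators. *)
Lemma law_expectation (u : R -> R) : bdd_meas setT u ->
  Ex (fun w => u (X w)) = \int[mu]_(x in D0) (u x * f (x + h)).
Proof.
move=> bu.
have bX (v : R -> R) : bdd_meas setT v -> bdd_meas setT (fun w => v (X w)).
  by move=> bv; apply: (bdd_meas_comp (X := X)).
have bM (v : R -> R) : bdd_meas setT v -> bdd_meas D0 (fun x => v x * f (x + h)).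
  by move=> bv; apply: bdd_measM => //; exact: bdd_meas_circle.
apply/eqP; rewrite -subr_eq0; apply/eqP.
pose L v := Ex (fun w => v (X w)) - \int[mu]_(x in D0) (v x * f (x + h)).
apply: (@bdd_meas_functional0 _ _ _ L (1 + B * fine (mu D0))); rewrite /L //.
- move=> u1 u2 b1 b2.
  under [X in _ - X]eq_Rintegral do rewrite mulrDl.
  rewrite (bintD measurableT pf (bX _ b1) (bX _ b2)).
  by rewrite (circleD (bM _ b1) (bM _ b2)); ring.
- move=> r v bv; under [X in _ - X]eq_Rintegral do rewrite -mulrA.
  rewrite (bintZ measurableT pf _ (bX _ bv)) (circleZ _ (bM _ bv)).
  by ring.
- move=> v C bv hC; apply: (le_trans (ler_normB _ _)); rewrite [leRHS]mulrDl mul1r.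
  apply: lerD; first by apply: Rintegral_prob_norm_le => //; exact: bX.
  rewrite mulrAC [B * C]mulrC; apply: circle_norm_le; first exact: bM.
  move=> x /in_circle xD; rewrite normrM; apply: ler_pM => //.
  by apply: (hB _).1; move: hh; rewrite ler_norml; lra.
- move=> A mA; rewrite Rintegral_indicM setIC.
  have mXA : measurable (X @^-1` A).
    by rewrite -[Y in measurable Y]setTI; apply: measurable_funPT.
  have -> : Ex (fun w => \1_A (X w)) = fine (distribution P X A).
    by rewrite -(Rintegral_indic P mXA).
  by rewrite hX.2// /Rintegral subrr.
Qed.

Lemma law_close (u : R -> R) : bdd_meas setT u ->
  `|Ex (fun w => u (X w)) - \int[mu]_(x in D0) (u x * f x)| <=
  B * `|h| * \int[mu]_(x in D0) `|u x|.
Proof.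
move=> bu; rewrite law_expectation//.
exact: (shift_integral_close hh (bdd_meas_circle bu)).
Qed.

Lemma law_le (u : R -> R) : bdd_meas setT u -> (forall x, 0 <= u x) ->
  Ex (fun w => u (X w)) <= B * \int[mu]_(x in D0) u x.
Proof.
move=> bu u0; have bu0 := bdd_meas_circle bu.
rewrite law_expectation// -circleZ//.
apply: le_circle; [exact: bdd_measM|exact: bdd_measZ|].
move=> x /in_circle xD; rewrite mulrC ler_wpM2r//.
apply: (le_trans (ler_norm _)); apply: (hB _).1.
by move: hh; rewrite ler_norml; lra.
Qed.

Lemma law_range w : 0 <= X w < 2 * pi.
Proof. by have := hX.1 w; rewrite in_itv. Qed.

End law.
End shifted_density.

(** * Integration against a distribution function *)

Section cdf_calculus.
Variables (R : realType) (f : R -> R).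
Hypothesis hf : C1_circular_density f.

Local Notation mu := (@lebesgue_measure R).
Local Notation D0 := `[(0 : R), 2 * pi[%classic.
Local Notation F := (circular_cdf f).
Local Notation df := (derive1 f).

Let pi2 := pi2_gt0 R.

Lemma is_derive_continuous (g dg : R -> R) :
  (forall x : R, is_derive x 1 g (dg x)) -> continuous g.
Proof.
move=> gd x; apply/differentiable_continuous/derivable1_diffP.
by have [] := gd x.
Qed.

Lemma within_comp_cdf (g : R -> R) : continuous g ->
  {within `[0, 2 * pi], continuous (fun x => g (F x))}.
Proof.
move=> cg x; apply: continuous_comp; last exact: cg.
exact: (cdf_within_continuous hf).
Qed.

Lemma comp_cdf_is_derive (g dg : R -> R) (x : R) :
  (forall x : R, is_derive x 1 g (dg x)) -> x \in `]0, 2 * pi[ ->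
  is_derive x 1 (fun x => g (F x)) (dg (F x) * f x).
Proof. by move=> gd xD; apply: is_derive1_comp; exact: (cdf_is_derive hf). Qed.

Lemma comp_cdf_LRcontinuous (g dg : R -> R) :
  (forall x : R, is_derive x 1 g (dg x)) ->
  derivable_oo_LRcontinuous (fun x => g (F x)) 0 (2 * pi).
Proof.
move=> gd; have cg := is_derive_continuous gd.
have /(continuous_within_itvP _ pi2)[_ h0 h1] := within_comp_cdf cg.
split => // x xD; by have [] := comp_cdf_is_derive gd xD.
Qed.

Lemma within_density (A : set R) : {within A, continuous f}.
Proof. exact: (within_density_continuous hf). Qed.

Lemma within_dg_f (dg : R -> R) : continuous dg ->
  {within `[0, 2 * pi], continuous (fun x => dg (F x) * f x)}.
Proof.
move=> cdg x; apply: continuousM; last exact: within_density.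
exact: within_comp_cdf.
Qed.

Lemma within_dg_f2 (dg : R -> R) : continuous dg ->
  {within `[0, 2 * pi], continuous (fun x => dg (F x) * f x * f x)}.
Proof.
move=> cdg.
have -> : (fun x => dg (F x) * f x * f x) = (fun x => dg (F x) * f x) * f by [].
by move=> x; apply: continuousM; [exact: within_dg_f|exact: within_density].
Qed.

Lemma integral_circle_itv (u : R -> R) : {within `[0, 2 * pi], continuous u} ->
  \int[mu]_(x in D0) u x = \int[mu]_(x in `[0, 2 * pi]) u x.
Proof.
move=> cu; apply: Rintegral_itv_bndo_bndc.
apply: (@integrableS _ _ _ mu `[0, 2 * pi]) => //; first exact: subset_itv_co_cc.
apply: continuous_compact_integrable => //; exact: segment_compact.
Qed.

(** The change of variable [u = F x]: under [f] the variable [F x] is uniform on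
   the unit interval. *)
Lemma integral_comp_cdf (g dg : R -> R) :
  (forall x : R, is_derive x 1 g (dg x)) -> continuous dg ->
  \int[mu]_(x in D0) (dg (F x) * f x) = g 1 - g 0.
Proof.
move=> gd cdg; have cw := within_dg_f cdg.
rewrite integral_circle_itv// /Rintegral.
rewrite (continuous_FTC2 pi2 cw (comp_cdf_LRcontinuous gd)).
  by rewrite -EFinB /= (cdf_2pi hf) cdf0.
move=> x xD; rewrite derive1E; have := comp_cdf_is_derive gd xD.
by move=> h; rewrite derive_val.
Qed.

(** There is no boundary term because [f] and [g \o F] agree at both ends of
   the circle. *)
Lemma comp_cdf_by_parts (g dg : R -> R) :
  (forall x : R, is_derive x 1 g (dg x)) -> continuous dg -> g 1 = g 0 ->
  \int[mu]_(x in D0) (g (F x) * df x) =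
  - \int[mu]_(x in `[0, 2 * pi]) (dg (F x) * f x ^+ 2).
Proof.
move=> gd cdg g10; have cg := is_derive_continuous gd.
have cdf : continuous df by case: hf.
have cw : {within `[0, 2 * pi], continuous (fun x => g (F x) * df x)}.
  move=> x; apply: continuousM; first exact: within_comp_cdf.
  exact: (continuous_subspaceT cdf).
rewrite integral_circle_itv//.
have fLR : derivable_oo_LRcontinuous f 0 (2 * pi).
  have /(continuous_within_itvP _ pi2)[_ h0 h1] := @within_density `[0, 2 * pi].
  by split => // x _; have [] := density_is_derive hf x.
rewrite (Rintegration_by_parts pi2 (within_dg_f cdg)
  (comp_cdf_LRcontinuous gd) _ (continuous_subspaceT cdf) fLR)//; last first.
  move=> x xD; rewrite derive1E; have := comp_cdf_is_derive gd xD.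
  by move=> h; rewrite derive_val.
have f2pi : f (2 * pi) = f 0.
  by have [_ _ per _ _] := hf; rewrite -[in RHS](per 0) add0r.
rewrite (cdf_2pi hf) cdf0 g10 f2pi subrr sub0r; congr (- _).
by apply: eq_Rintegral => x _; rewrite -mulrA -expr2.
Qed.

End cdf_calculus.

(** * Scores *)
Section scores.
Variable R : realType.

Lemma cos_2pin n : cos (2 * pi * n%:R) = 1 :> R.
Proof.
have := periodicn (@cosD2pi R) n 0; rewrite add0r cos0 => h; rewrite -[RHS]h.
by congr cos; rewrite -[pi *+ 2]mulr_natr -[RHS]mulr_natr; ring.
Qed.

Lemma sin_2pin n : sin (2 * pi * n%:R) = 0 :> R.
Proof.
have := periodicn (@sinD2pi R) n 0; rewrite add0r sin0 => h; rewrite -[RHS]h.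
by congr sin; rewrite -[pi *+ 2]mulr_natr -[RHS]mulr_natr; ring.
Qed.

(** Scores are indexed by the frequency [k] and by the phase [r]; as functions
   of [u = F x] they have period one.  Writing both as cosines lets one
   treatment serve for the two phases. *)
Definition phase (r : 'I_2) : R := if r == ord0 then 0 else - (pi / 2).

Definition score (k : nat) (r : 'I_2) (u : R) : R := trig_g k r (2 * pi * u).

Definition dscore (k : nat) (r : 'I_2) (u : R) : R :=
  - (Num.sqrt 2 * (2 * pi * k%:R)) * sin (2 * pi * k%:R * u + phase r).

Lemma scoreE k r u :
  score k r u = Num.sqrt 2 * cos (2 * pi * k%:R * u + phase r).
Proof.
rewrite /score /trig_g /phase (_ : k%:R * _ = 2 * pi * k%:R * u); last by ring.
by case: (r == ord0); rewrite ?addr0// cosBpihalf.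
Qed.

Lemma linear_is_derive (a b x : R) : is_derive x 1 (fun x => a * x + b) a.
Proof.
rewrite (_ : (fun x : R => a * x + b) = (a \*: (id : R -> R)) + cst b)//.
apply: (is_derive_eq (is_deriveD (is_deriveZ a (is_derive_id x 1)) (is_derive_cst b x 1))).
by rewrite addr0 /GRing.scale/= mulr1.
Qed.

Lemma cos_linear_is_derive (a b c x : R) :
  is_derive x 1 (fun x => c * cos (a * x + b)) (- (c * a) * sin (a * x + b)).
Proof.
have h := @is_derive1_comp _ cos (fun x => a * x + b) x _ _
  (is_derive_cos _) (linear_is_derive a b x).
rewrite (_ : (fun x => _) = c \*: (cos \o (fun x => a * x + b)))//.
apply: (is_derive_eq (is_deriveZ c h)).
by rewrite /GRing.scale/=; ring.
Qed.

Lemma score_is_derive k r (x : R) : is_derive x 1 (score k r) (dscore k r x).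
Proof.
rewrite (_ : score k r = fun x => Num.sqrt 2 * cos (2 * pi * k%:R * x + phase r)).
  exact: cos_linear_is_derive.
by apply/funext => u; rewrite scoreE.
Qed.

Lemma sin_linear_continuous (a b c : R) : continuous (fun x => c * sin (a * x + b)).
Proof.
move=> x; apply: cvgM; first exact: cvg_cst.
apply: (@continuous_comp _ _ _ (fun x => a * x + b) sin); last exact: continuous_sin.
by apply: (is_derive_continuous (dg := fun=> a)) => y; exact: linear_is_derive.
Qed.

Lemma dscore_continuous k r : continuous (dscore k r).
Proof. exact: sin_linear_continuous. Qed.

Lemma score_continuous k r : continuous (score k r).
Proof. exact: (is_derive_continuous (score_is_derive k r)). Qed.

Lemma score_bdd_meas k r : bdd_meas setT (score k r).
Proof.
split; first by apply: continuous_measurable_fun; exact: score_continuous.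
exists (Num.sqrt 2) => u _; rewrite scoreE normrM ger0_norm ?sqrtr_ge0//.
by rewrite ler_piMr ?sqrtr_ge0// ler_norml cos_geN1 cos_le1.
Qed.

Lemma score_loop k r : score k r 1 = score k r 0.
Proof.
rewrite !scoreE mulr1 mulr0; congr (_ * _).
by rewrite !cosD cos_2pin sin_2pin cos0 sin0.
Qed.

End scores.

(** * Smoothness of the scores *)

Section score_smoothness.
Variables (R : realType) (k : nat) (r : 'I_2).
Hypothesis k0 : (0 < k)%N.

Let om : R := 2 * pi * k%:R.

Lemma frequency_ge1 : 1 <= om.
Proof.
have p1 : 1 <= pi :> R by have := @pi_ge2 R; lra.
have k1 : 1 <= k%:R :> R by rewrite (ler_nat _ 1).
by rewrite /om; nra.
Qed.

Let om1 := frequency_ge1.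
Let om_ge0 : 0 <= om := le_trans ler01 om1.
Let s2 : 0 <= Num.sqrt 2 :> R := sqrtr_ge0 2.

Definition score_lip : R := 2 * Num.sqrt 2 * om ^+ 2.

Definition score_primitive (u : R) : R :=
  Num.sqrt 2 / om * sin (om * u + phase R r).

Let lip_ge : Num.sqrt 2 * om <= score_lip.
Proof.
rewrite /score_lip (_ : 2 * _ * _ = Num.sqrt 2 * (2 * om ^+ 2)); last by ring.
by rewrite ler_wpM2l//; move: om (om1) => o o1; nra.
Qed.

Lemma score_lipschitz (u v : R) : `|score k r u - score k r v| <= score_lip * `|u - v|.
Proof.
apply: (mean_value_le (df := dscore k r)) => [x|x _]; first exact: score_is_derive.
rewrite /dscore -/om mulNr normrN normrM -[leRHS]mulr1.
apply: ler_pM => //; last exact: sin_max.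
by rewrite ger0_norm ?lip_ge// mulr_ge0.
Qed.

Lemma dscore_le (u : R) : `|dscore k r u| <= score_lip.
Proof.
rewrite /dscore -/om mulNr normrN normrM -[leRHS]mulr1.
apply: ler_pM => //; last exact: sin_max.
by rewrite ger0_norm ?lip_ge// mulr_ge0.
Qed.

Lemma score_taylor (u v : R) :
  `|score k r u - score k r v - dscore k r v * (u - v)| <= score_lip * (u - v) ^+ 2.
Proof.
rewrite !scoreE /dscore -/om.
set a := om * v + phase R r.
rewrite (_ : om * u + _ = a + om * (u - v)); last by rewrite /a; ring.
rewrite [X in `|X|](_ : _ = Num.sqrt 2 * (cos (a + om * (u - v)) -
  (cos a - sin a * (om * (u - v))))); last by ring.
rewrite normrM (ger0_norm s2) /score_lip.
rewrite [leRHS](_ : _ = Num.sqrt 2 * (2 * (om * (u - v)) ^+ 2)); last by ring.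
by rewrite ler_wpM2l// cos_taylor1.
Qed.

Lemma score_primitive_taylor (u v : R) :
  `|score_primitive u - score_primitive v - score k r v * (u - v)| <=
  score_lip * (u - v) ^+ 2.
Proof.
have omn0 : om != 0 by rewrite gt_eqF// (lt_le_trans ltr01).
rewrite !scoreE /score_primitive -/om.
set a := om * v + phase R r.
rewrite (_ : om * u + _ = a + om * (u - v)); last by rewrite /a; ring.
rewrite [X in `|X|](_ : _ = Num.sqrt 2 / om * (cos (a - pi / 2 + om * (u - v)) -
  (cos (a - pi / 2) - sin (a - pi / 2) * (om * (u - v))))); last first.
  by rewrite (addrAC a) !cosBpihalf sinBpihalf; field.
rewrite normrM ger0_norm; last by rewrite divr_ge0.
apply: (le_trans (ler_wpM2l _ (cos_taylor1 _ _))); first by rewrite divr_ge0.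
rewrite [leLHS](_ : _ = 2 * Num.sqrt 2 * om * (u - v) ^+ 2); last by field.
rewrite /score_lip ler_wpM2r ?sqr_ge0// ler_wpM2l ?mulr_ge0//.
by rewrite expr2 ler_peMl.
Qed.

(** The scores have mean zero over a period. *)
Lemma score_primitive_loop : score_primitive 1 = score_primitive 0.
Proof.
rewrite /score_primitive mulr1 mulr0; congr (_ * _).
by rewrite !sinD /om cos_2pin sin_2pin cos0 sin0.
Qed.

End score_smoothness.

(** * Integrals of the scores *)
Section score_integrals.
Variables (R : realType) (f : R -> R).
Hypothesis hf : C1_circular_density f.

Local Notation mu := (@lebesgue_measure R).
Local Notation D0 := `[(0 : R), 2 * pi[%classic.
Local Notation F := (circular_cdf f).
Local Notation df := (derive1 f).

Let mD : measurable D0 := @measurable_circle R.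
Let fD := circle_finite R.
Let circleD := @bintD _ _ R mu D0 mD fD.
Let circleB := @bintB _ _ R mu D0 mD fD.
Let circleZ := @bintZ _ _ R mu D0 mD fD.
Let circle_norm_le := @bint_norm_le _ _ R mu D0 mD fD.
Let pi2 := pi2_gt0 R.

Lemma integral_density : \int[mu]_(x in D0) f x = 1.
Proof. by rewrite /Rintegral; case: hf => _ ->. Qed.

Lemma cos_cdf_integral (j : nat) (b : R) :
  \int[mu]_(x in D0) (cos (2 * pi * j%:R * F x + b) * f x) =
  (j == 0)%N%:R * cos b.
Proof.
have [j0|j0] := posnP j.
  rewrite j0 mul1r.
  under eq_Rintegral do rewrite mulr0 mul0r add0r.
  rewrite RintegralZl ?integral_density ?mulr1//.
  by apply: (density_integrable hf (a := 0) (b := 2 * pi)) => //; exact: subset_itv_co_cc.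
pose om : R := 2 * pi * j%:R.
have om0 : om != 0 by rewrite !mulf_neq0 ?gt_eqF ?pi_gt0 ?ltr0n.
rewrite mul0r.
pose g (u : R) := om^-1 * cos (om * u + (b - pi / 2)).
have gd (u : R) : is_derive u 1 g (1 * cos (om * u + b)).
  apply: (is_derive_eq (cos_linear_is_derive om (b - pi / 2) om^-1 u)).
  by rewrite addrA sinBpihalf mulVf// mulrN mulNr opprK.
have cg : continuous (fun u : R => 1 * cos (om * u + b)).
  rewrite (_ : (fun u => _) = fun u => 1 * sin (om * u + (b + pi / 2))).
    exact: sin_linear_continuous.
  by apply/funext => u; rewrite addrA sinDpihalf.
have := integral_comp_cdf hf gd cg.
under eq_Rintegral do rewrite mul1r.
rewrite -/om => ->; rewrite /g mulr1 mulr0 -mulrBr !cosD /om cos_2pin sin_2pin.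
by rewrite cos0 sin0 subrr mulr0.
Qed.

Lemma bdd_meas_score_cdf k r : bdd_meas setT (fun x => score k r (F x)).
Proof. exact: (bdd_meas_comp (measurable_cdf hf) (score_bdd_meas R k r)). Qed.

Lemma bdd_meas_density_circle : bdd_meas D0 f.
Proof.
have [B B0 hB] := density_window hf (lexx 0).
exact: (bdd_meas_density hf (lexx 0) hB).
Qed.

Lemma integral_score k r : (0 < k)%N ->
  \int[mu]_(x in D0) (score k r (F x) * f x) = 0.
Proof.
move=> k0; under eq_Rintegral do rewrite scoreE -(mulrA (Num.sqrt 2)).
rewrite circleZ.
  by rewrite cos_cdf_integral (negbTE (lt0n_neq0 k0)) mul0r mulr0.
apply: bdd_measM; last exact: bdd_meas_density_circle.
apply: bdd_meas_circle; apply: bdd_meas_cos; apply: measurable_funD => //.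
by apply: measurable_funM => //; exact: measurable_cdf.
Qed.

Lemma cosM_sum (A B : R) : Num.sqrt 2 * cos A * (Num.sqrt 2 * cos B) =
  cos (A + B) + cos (A - B).
Proof.
rewrite mulrACA -expr2 sqr_sqrtr// !cosD cosN sinN; ring.
Qed.

(** A product of two scores is a sum of cosines of frequencies [k + k'] and
   [k - k'] in the uniform variable [F x], and a cosine integrates to zero unless
   its frequency vanishes. *)
Lemma integral_scoreM k r k' r' : (0 < k)%N -> (0 < k')%N ->
  \int[mu]_(x in D0) (score k r (F x) * score k' r' (F x) * f x) =
  ((k == k') && (r == r'))%:R.
Proof.
wlog kk' : k r k' r' / (k' <= k)%N.
  move=> wl k0 k'0; have [kk'|/ltnW kk'] := leqP k' k; first exact: wl.
  under eq_Rintegral do rewrite (mulrC (score k r _)).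
  by rewrite wl// (eq_sym k) (eq_sym r).
move=> k0 k'0; pose p := phase R r; pose p' := phase R r'.
have mF := measurable_cdf hf.
have bc j b : bdd_meas D0 (fun x => cos (2 * pi * j%:R * F x + b) * f x).
  apply: bdd_measM; last exact: bdd_meas_density_circle.
  apply: bdd_meas_circle; apply: bdd_meas_cos; apply: measurable_funD => //.
  exact: measurable_funM.
rewrite (_ : Rintegral _ _ _ = \int[mu]_(x in D0)
  (cos (2 * pi * (k + k')%:R * F x + (p + p')) * f x +
   cos (2 * pi * (k - k')%:R * F x + (p - p')) * f x)); last first.
  apply: eq_Rintegral => x _; rewrite !scoreE cosM_sum -mulrDl -/p -/p'.
  rewrite natrD natrB//; congr ((cos _ + cos _) * _); ring.
rewrite (circleD (bc _ _) (bc _ _)) !cos_cdf_integral addn_eq0 subn_eq0.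
rewrite (negbTE (lt0n_neq0 k0)) mul0r add0r eqn_leq kk' andbT.
case: (k <= k')%N; rewrite ?mul0r// mul1r /p /p' /phase.
case: (eqVneq r r') => [->|]; first by rewrite subrr cos0.
case: r r' {p p'} => [[|[|//]] i0] [[|[|//]] i1]; rewrite -!val_eqE//= => _.
  by rewrite sub0r opprK cos_pihalf.
by rewrite subr0 cosN cos_pihalf.
Qed.

Lemma integral_score_deriv k r :
  \int[mu]_(x in D0) (score k r (F x) * df x) = - beta_coef f k r.
Proof.
rewrite (comp_cdf_by_parts hf (score_is_derive k r) (@dscore_continuous _ k r))
  ?score_loop// /beta_coef.
pose c : R := Num.sqrt 2 * (2 * pi * k%:R).
have cw (h : R -> R) : continuous h ->
    mu.-integrable `[0, 2 * pi] (EFin \o (fun x => h (F x) * f x ^+ 2)).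
  move=> ch; rewrite (_ : (fun x => _) = fun x => h (F x) * f x * f x); last first.
    by apply/funext => x; rewrite expr2 mulrA.
  apply: continuous_compact_integrable; first exact: segment_compact.
  exact: (within_dg_f2 hf ch).
have cs b : continuous (fun u : R => 1 * sin (2 * pi * k%:R * u + b)).
  exact: sin_linear_continuous.
have intE : \int[mu]_(x in `[0, 2 * pi]) (dscore k r (F x) * f x ^+ 2) =
    - c * \int[mu]_(x in `[0, 2 * pi])
      (1 * sin (2 * pi * k%:R * F x + phase R r) * f x ^+ 2).
  rewrite -RintegralZl//; last exact: (cw _ (cs (phase R r))).
  by apply: eq_Rintegral => x _; rewrite /dscore -/c mul1r mulrA.
rewrite intE /phase; case: (r == ord0).
  under eq_Rintegral do rewrite addr0 mul1r.
  by rewrite /c; ring.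
rewrite (_ : Rintegral _ _ _ = - 1 * \int[mu]_(x in `[0, 2 * pi])
      (cos (2 * pi * k%:R * F x) * f x ^+ 2)); first by rewrite /c; ring.
rewrite -RintegralZl//.
  by apply: eq_Rintegral => x _; rewrite sinBpihalf mul1r mulN1r mulNr.
have := cw _ (cs (pi / 2)); congr (_.-integrable _ _).
by apply/funext => x /=; rewrite sinDpihalf mul1r.
Qed.

(** The mean score vanishes without shift, and its derivative with respect to
   the shift is the integral of the score against [derive1 f], which integration
   by parts identifies with [- beta_coef].  The uniform continuity of
   [derive1 f] controls the remainder. *)
Lemma score_mean_shift k r (e : R) : (0 < k)%N -> 0 < e ->
  exists2 eta : R, 0 < eta & forall h : R, `|h| <= eta ->
  `|\int[mu]_(x in D0) (score k r (F x) * f (x + h)) + beta_coef f k r * h| <=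
  e * `|h|.
Proof.
move=> k0 e0.
have s2 : 0 < Num.sqrt 2 :> R by rewrite sqrtr_gt0.
pose e1 := e / (Num.sqrt 2 * (2 * pi)).
have e10 : 0 < e1 by rewrite divr_gt0// mulr_gt0.
have cdf : continuous df by case: hf.
have [B B0 hB] := density_window hf ler01.
have [eta eta0 heta] := heine_cantor (0 : R) (2 * pi) cdf e10.
exists (Num.min eta 1); first by rewrite lt_min eta0/=.
move=> h; rewrite le_min => /andP[h_eta h1].
have bsc := bdd_meas_circle (bdd_meas_score_cdf k r).
have bsh := bdd_meas_shift hf hB h1.
have bf := bdd_meas_density_circle.
have bdf : bdd_meas D0 df.
  split; first by apply: (@measurable_funS _ _ _ _ setT) => //; exact: continuous_measurable_fun.
  by exists B => x /in_circle xD; apply: (hB _ _).2; lra.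
rewrite (_ : _ + _ = \int[mu]_(x in D0)
    (score k r (F x) * (f (x + h) - f x - h * df x))); last first.
  have b1 := bdd_measM bsc bsh; have b2 := bdd_measM bsc bf.
  have b3 := bdd_measZ h (bdd_measM bsc bdf).
  rewrite (_ : (fun x : R => _ * (_ - _ - _)) = fun x => score k r (F x) * f (x + h) -
    score k r (F x) * f x - h * (score k r (F x) * df x)); last first.
    by apply/funext => x; ring.
  rewrite (circleB (bdd_measB b1 b2) b3) (circleB b1 b2).
  rewrite circleZ ?integral_score_deriv ?integral_score//; last exact: bdd_measM.
  by ring.
rewrite [leRHS](_ : _ = Num.sqrt 2 * (e1 * `|h|) * fine (mu D0)); last first.
  have -> : fine (mu D0) = 2 * pi by rewrite circle_measure.
  rewrite /e1; move: (2 * pi : R) pi2 => q q0.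
  by field; rewrite !gt_eqF.
apply: circle_norm_le.
  exact: (bdd_measM bsc (bdd_measB (bdd_measB bsh bf) (bdd_measZ h bdf))).
move=> x /in_circle xD; rewrite normrM; apply: ler_pM => //.
  rewrite scoreE normrM ger0_norm ?(ltW s2)//.
  by rewrite ler_piMr ?(ltW s2)// ler_norml cos_geN1 cos_le1.
pose u (y : R) := f y - y * df x.
have ud (y : R) : is_derive y 1 u (df y - df x).
  rewrite /u (_ : (fun y => _) = f - (df x \*: (id : R -> R))); last first.
    by apply/funext => z /=; rewrite mulrC.
  apply: (is_derive_eq (is_deriveB (density_is_derive hf y)
    (is_deriveZ (df x) (is_derive_id y 1)))).
  by rewrite /GRing.scale/= mulr1.
have := @mean_value_le _ u _ e1 x (x + h) ud.
rewrite (_ : u (x + h) - u x = f (x + h) - f x - h * df x); last by rewrite /u; ring.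
rewrite (_ : x + h - x = h); last by ring.
apply=> y hy; rewrite distrC; apply: heta; first lra.
have := ler_norm h; have := ler_norm (- h); rewrite normrN => n1 n2.
move: hy; rewrite minElt maxElt ler_norml; case: ltP => _ hy; lra.
Qed.

End score_integrals.

(** * The characteristic function of a normal law *)

(** This form of differentiability passes through an integral: it suffices to
   integrate the remainder bound. *)
Lemma quadratic_is_derive (R : realType) (g : R -> R) (x d C : R) :
  (forall h, `|g (x + h) - g x - h * d| <= C * h ^+ 2) -> is_derive x 1 g d.
Proof.
move=> hC.
have key : h^-1 *: ((g \o shift x) (h *: (1 : R)) - g x) @[h --> 0^'] --> d.
  apply/cvgrPdist_le => e e0; near=> h.
  have h0 : h != 0 by near: h; exact: nbhs_dnbhs_neq.
  rewrite /GRing.scale/= mulr1 (addrC h).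
  rewrite [X in `|X|](_ : _ = - (h^-1 * (g (x + h) - g x - h * d))); last by field.
  rewrite normrN normrM; apply: (le_trans (ler_wpM2l (normr_ge0 _) (hC h))).
  rewrite (_ : `|h^-1| * _ = C * `|h|); last first.
    by rewrite -(real_normK (num_real h)) normfV; field; rewrite normr_eq0.
  have C1 : C <= `|C| + 1 by rewrite (le_trans (ler_norm C))// lerDl.
  have hh : `|h| <= e / (`|C| + 1).
    by near: h; apply: dnbhs0_le; rewrite divr_gt0// ltr_wpDl.
  apply: (le_trans (ler_wpM2r (normr_ge0 h) C1)).
  by rewrite -ler_pdivlMl ?ltr_wpDl// mulrC.
apply: DeriveDef; first by apply/cvg_ex; exists d.
exact: cvg_lim.
Unshelve. all: by end_near. Qed.

Section normal_characteristic.
Variables (R : realType) (m sigma : R).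
Hypothesis sigma0 : 0 < sigma.

Local Notation mu := (@lebesgue_measure R).
Local Notation p := (normal_pdf m sigma).

Let sn0 : sigma != 0. Proof. by rewrite gt_eqF. Qed.
Let s2n0 : 2 * sigma != 0. Proof. by rewrite mulf_neq0. Qed.

Let pE x : p x = normal_peak sigma * expR (- ((x - m) ^+ 2 / (2 * sigma ^+ 2))).
Proof. by rewrite normal_pdfE// /normal_fun mulNr mulr_natl. Qed.

(** The growth allowed to integrands, so that the derivative and the remainder
   of [cos (b + s * (x - m))] in the variable [s] are covered. *)
Definition quad_bounded (u : R -> R) :=
  measurable_fun setT u /\ exists C : R, forall x, `|u x| <= C * (1 + (x - m) ^+ 2).

(** A wider normal density dominates the second moment. *)
Let second_moment_le x : (1 + (x - m) ^+ 2) * p x <=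
  normal_peak sigma * (1 + 3 * sigma ^+ 2) / normal_peak (2 * sigma) *
  normal_pdf m (2 * sigma) x.
Proof.
have pk : 0 < normal_peak sigma by exact: normal_peak_gt0.
have pk2 : 0 < normal_peak (2 * sigma) by exact: normal_peak_gt0.
rewrite pE normal_pdfE// /normal_fun.
set t := (x - m) ^+ 2 / (2 * sigma ^+ 2).
have s20 : 0 < 2 * sigma ^+ 2 by rewrite mulr_gt0 ?exprn_gt0.
have t0 : 0 <= t by rewrite divr_ge0 ?sqr_ge0// ltW.
have -> : (x - m) ^+ 2 = 2 * sigma ^+ 2 * t.
  by rewrite /t; field.
have -> : - (2 * sigma ^+ 2 * t) / ((2 * sigma) ^+ 2 *+ 2) = - (t / 4).
  by rewrite -[_ *+ 2]mulr_natr; field.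
rewrite [leRHS](_ : _ = normal_peak sigma *
  ((1 + 3 * sigma ^+ 2) * expR (- (t / 4)))); last by field; rewrite gt_eqF.
rewrite mulrCA ler_wpM2l//; first exact: ltW.
rewrite [in leLHS](_ : - t = - (3 * t / 4) + - (t / 4)); last by field.
rewrite expRD mulrA ler_wpM2r ?expR_ge0// expRN.
have e1 := expR_ge1Dx (3 * t / 4).
have e0 := expR_gt0 (3 * t / 4).
rewrite ler_pdivrMr//; set E := expR _ in e1 e0 *.
have : 0 <= sigma ^+ 2 by exact: sqr_ge0.
move: (sigma ^+ 2) => v v0; nra.
Qed.

Lemma quad_bounded_integrable u : quad_bounded u ->
  mu.-integrable setT (EFin \o (fun x => u x * p x)).
Proof.
move=> [mu_ [C hC]].
pose K := normal_peak sigma * (1 + 3 * sigma ^+ 2) / normal_peak (2 * sigma).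
apply: (@le_integrable _ _ _ mu setT measurableT _
  (fun x => (`|C| * K * normal_pdf m (2 * sigma) x)%:E)).
- apply/measurable_EFinP; apply: measurable_funM => //; exact: measurable_normal_pdf.
- move=> x _; rewrite !abse_EFin lee_fin normrM (ger0_norm (normal_pdf_ge0 _ _ _)).
  rewrite [leRHS]ger0_norm; last first.
    rewrite !mulr_ge0 ?invr_ge0 ?normal_peak_ge0 ?normal_pdf_ge0//.
    by rewrite addr_ge0// mulr_ge0// sqr_ge0.
  have x2 : 0 <= 1 + (x - m) ^+ 2 by rewrite addr_ge0// sqr_ge0.
  apply: (@le_trans _ _ (`|C| * ((1 + (x - m) ^+ 2) * p x))).
    rewrite mulrA ler_wpM2r ?normal_pdf_ge0//.
    by apply: (le_trans (hC x)); rewrite ler_wpM2r// ler_norm.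
  by rewrite -mulrA ler_wpM2l// second_moment_le.
- rewrite (_ : (fun x => _) = (fun x => (`|C| * K)%:E * (normal_pdf m (2 * sigma) x)%:E)%E).
    by apply: integrableZl => //; exact: integrable_normal_pdf.
  by apply/funext => x; rewrite EFinM.
Qed.

Local Notation In u := (\int[mu]_x (u x * p x)).

Lemma quad_boundedD u v : quad_bounded u -> quad_bounded v ->
  quad_bounded (fun x => u x + v x).
Proof.
move=> [mu_ [C hC]] [mv [D hD]]; split; first exact: measurable_funD.
exists (C + D) => x; apply: (le_trans (ler_normD _ _)).
by rewrite mulrDl lerD.
Qed.

Lemma quad_boundedZ r u : quad_bounded u -> quad_bounded (fun x => r * u x).
Proof.
move=> [mu_ [C hC]]; split; first exact: measurable_funM.
by exists (`|r| * C) => x; rewrite normrM -mulrA ler_wpM2l.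
Qed.

Lemma quad_bounded_bdd u : bdd_meas setT u -> quad_bounded u.
Proof.
move=> [mu_ [C hC]]; split => //; exists C => x.
have C0 : 0 <= C by exact: le_trans (hC x I).
by apply: (le_trans (hC x I)); rewrite ler_peMr// lerDl sqr_ge0.
Qed.

Let mcenter : measurable_fun setT (fun x : R => x - m).
Proof. by apply: measurable_funB. Qed.

Lemma quad_bounded_centerM u : bdd_meas setT u -> quad_bounded (fun x => (x - m) * u x).
Proof.
move=> [mu_ [C hC]]; split; first exact: measurable_funM.
exists C => x; have C0 : 0 <= C by exact: le_trans (hC x I).
rewrite normrM mulrC; apply: ler_pM => //; first exact: hC.
rewrite -(real_normK (num_real (x - m))).
by have := sqr_ge0 (`|x - m| - 1); have := sqr_ge0 `|x - m|; nra.
Qed.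

Lemma quad_bounded_center2 : quad_bounded (fun x => (x - m) ^+ 2).
Proof.
split; first exact: measurable_funX.
by exists 1 => x; rewrite ger0_norm ?sqr_ge0// mul1r lerDr.
Qed.

Lemma normal_intD u v : quad_bounded u -> quad_bounded v ->
  In (fun x => u x + v x) = In u + In v.
Proof.
move=> qu qv; rewrite -RintegralD//; try exact: quad_bounded_integrable.
by apply: eq_Rintegral => x _; rewrite mulrDl.
Qed.

Lemma normal_intZ r u : quad_bounded u -> In (fun x => r * u x) = r * In u.
Proof.
move=> qu; rewrite -RintegralZl//; last exact: quad_bounded_integrable.
by apply: eq_Rintegral => x _; rewrite mulrA.
Qed.

Lemma normal_int_le u v : quad_bounded u -> quad_bounded v ->
  (forall x, u x <= v x) -> In u <= In v.
Proof.
move=> qu qv uv; apply: le_Rintegral => //; try exact: quad_bounded_integrable.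
by move=> x _; rewrite ler_wpM2r ?normal_pdf_ge0.
Qed.

Lemma normal_int_norm_le u v : quad_bounded u -> quad_bounded v ->
  (forall x, `|u x| <= v x) -> `|In u| <= In v.
Proof.
move=> qu qv uv; rewrite ler_norml; apply/andP; split; last first.
  by apply: normal_int_le => // x; exact: le_trans (ler_norm _) (uv x).
rewrite -mulN1r -normal_intZ//; apply: normal_int_le => //.
  exact: quad_boundedZ.
by move=> x; rewrite mulN1r; have := uv x; rewrite ler_norml => /andP[].
Qed.

Lemma normal_int_cst r : In (fun=> r) = r.
Proof.
rewrite RintegralZl//; last exact: integrable_normal_pdf.
by rewrite /Rintegral integral_normal_pdf mulr1.
Qed.

Lemma normal_pdf_is_derive (x : R) :
  is_derive x 1 p (- ((x - m) / sigma ^+ 2) * p x).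
Proof.
pose q (y : R) := - ((y - m) ^+ 2 / (2 * sigma ^+ 2)).
have qd : is_derive x 1 q (- ((x - m) / sigma ^+ 2)).
  apply: (@quadratic_is_derive _ _ _ _ (2 * sigma ^+ 2)^-1) => h.
  rewrite [X in `|X|](_ : _ = - ((2 * sigma ^+ 2)^-1 * h ^+ 2)).
    rewrite normrN ger0_norm//; apply: mulr_ge0; last exact: sqr_ge0.
    by rewrite invr_ge0 mulr_ge0// sqr_ge0.
  by rewrite /q; field.
have hp : p = normal_peak sigma \*: (expR \o q).
  by apply/funext => y; rewrite pE.
have h := @is_derive1_comp _ expR q x _ _ (is_derive_expR _) qd.
rewrite {1}hp; apply: (is_derive_eq (is_deriveZ (normal_peak sigma) h)).
by rewrite pE /GRing.scale/= /q; ring.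
Qed.

Lemma normal_pdf_tail (n : nat) (x : R) : (0 < n)%N -> `|x - m| = n%:R ->
  p x <= normal_peak sigma * (2 * sigma ^+ 2) / n%:R.
Proof.
move=> n0 xn; have n0R : 0 < n%:R :> R by rewrite ltr0n.
have s20 : 0 < 2 * sigma ^+ 2 by rewrite mulr_gt0 ?exprn_gt0.
rewrite pE -mulrA ler_wpM2l ?normal_peak_ge0// expRN.
rewrite -(real_normK (num_real (x - m))) xn.
set t := n%:R ^+ 2 / _; have e1 := expR_ge1Dx t.
have t0 : 0 < t by rewrite divr_gt0 ?exprn_gt0.
apply: (@le_trans _ _ t^-1); first by rewrite lef_pV2 ?posrE ?expR_gt0//; lra.
rewrite /t invf_div ler_pM2l// lef_pV2 ?posrE ?exprn_gt0//.
by rewrite expr2 ler_peMl ?(ltW n0R)// (ler_nat _ 1).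
Qed.

Let wave_bdd (g : R -> R) (s b : R) : continuous g -> (forall x, `|g x| <= 1) ->
  bdd_meas setT (fun x : R => g (b + s * (x - m))).
Proof.
move=> cg g1; split; last by exists 1.
apply: (measurableT_comp (f := g)); first exact: continuous_measurable_fun.
by apply: measurable_funD => //; apply: measurable_funM.
Qed.

Let cos_bdd s b : bdd_meas setT (fun x : R => cos (b + s * (x - m))).
Proof.
apply: wave_bdd; first exact: continuous_cos.
by move=> x; rewrite ler_norml cos_geN1 cos_le1.
Qed.

Let sin_bdd s b : bdd_meas setT (fun x : R => sin (b + s * (x - m))).
Proof. by apply: wave_bdd; [exact: continuous_sin|exact: sin_max]. Qed.

(** Stein's identity: [u * p] vanishes at infinity, so its derivative has
   integral zero. *)
Lemma normal_stein (s b : R) :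
  In (fun x => (x - m) * sin (b + s * (x - m))) =
  sigma ^+ 2 * s * In (fun x => cos (b + s * (x - m))).
Proof.
pose u x := sin (b + s * (x - m)); pose U x := cos (b + s * (x - m)).
pose w x := s * U x + (- (sigma ^+ 2)^-1) * ((x - m) * u x).
pose W x := u x * p x.
have q1 : quad_bounded (fun x => s * U x) by exact/quad_boundedZ/quad_bounded_bdd/cos_bdd.
have q2 : quad_bounded (fun x => (x - m) * u x) by exact/quad_bounded_centerM/sin_bdd.
have qw : quad_bounded w by apply: quad_boundedD => //; exact: quad_boundedZ.
have iw := quad_bounded_integrable qw.
have Wd (x : R) : is_derive x 1 W (w x * p x).
  have h1 : is_derive x 1 (fun x => b + s * (x - m)) s.
    rewrite (_ : (fun x => _) = fun x => s * x + (b - s * m)).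
      exact: linear_is_derive.
    by apply/funext => y; ring.
  have h := @is_derive1_comp _ sin (fun x => b + s * (x - m)) x _ _ (is_derive_sin _) h1.
  apply: (is_derive_eq (is_deriveM h (normal_pdf_is_derive x))).
  by rewrite /GRing.scale/= /w /u /U; ring.
have cw : continuous (fun x => w x * p x).
  have cl (a c : R) : continuous (fun x : R => a * x + c).
    by apply: (is_derive_continuous (dg := fun=> a)) => y; exact: linear_is_derive.
  have ce : continuous (fun x : R => b + s * (x - m)).
    rewrite (_ : (fun x => _) = fun x => s * x + (b - s * m)) => //.
    by apply/funext => y; ring.
  have cm : continuous (fun x : R => x - m).
    rewrite (_ : (fun x => _) = fun x : R => 1 * x + - m) => //.
    by apply/funext => y; ring.
  have cu : continuous u.
    move=> x; apply: (@continuous_comp _ _ _ (fun x => b + s * (x - m)) sin).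
      exact: ce.
    exact: continuous_sin.
  have cU : continuous U.
    move=> x; apply: (@continuous_comp _ _ _ (fun x => b + s * (x - m)) cos).
      exact: ce.
    exact: continuous_cos.
  have -> : (fun x => w x * p x) = (cst s * U + cst (- (sigma ^+ 2)^-1) *
      ((fun x => x - m) * u)) * p by [].
  move=> x; apply: continuousM; last exact: continuous_normal_pdf.
  apply: continuousD; apply: continuousM; try exact: cst_continuous.
    exact: cU.
  by apply: continuousM; [exact: cm|exact: cu].
have ftc (n : nat) : (0 < n)%N ->
    (\int[mu]_(x in `[(m - n%:R)%R, (m + n%:R)%R]) (w x * p x)%:E)%E =
    (W (m + n%:R) - W (m - n%:R))%:E.
  move=> n0; have nn : m - n%:R < m + n%:R.
    by rewrite ltrD2l gtrN// ltr0n.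
  rewrite EFinB; apply: continuous_FTC2 => //.
  - exact: continuous_subspaceT.
  - have cW := is_derive_continuous Wd.
    split; [by move=> x _; have [] := Wd x|apply: cvg_at_right_filter|apply: cvg_at_left_filter]; exact: cW.
  - by move=> x _; rewrite derive1E; have h := Wd x; rewrite derive_val.
have to_In : (W (m + n.+1%:R) - W (m - n.+1%:R)) @[n --> \oo] --> In w.
  pose A (n : nat) : set R := `[m - n.+1%:R, m + n.+1%:R]%classic.
  have : (\int[mu]_(x in setT) (((fun x => (w x * p x)%:E) \_ (A n)) x))%E
      @[n --> \oo] --> (\int[mu]_x (w x * p x)%:E)%E.
    apply: (@dominated_cvg _ _ _ mu setT measurableT _ _ (fun x => `|w x * p x|%:E)) => //.
    - move=> n; apply: (measurable_restrict _ _ _).1 => //; first exact: measurable_itv.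
      by rewrite setTI; apply: measurable_funTS; case/integrableP: iw.
    - move=> x _; apply: cvg_near_cst; near=> n.
      rewrite patchE mem_set// /A /= in_itv/=.
      have : `|x - m| <= n.+1%:R.
        apply: (@le_trans _ _ n%:R); last by rewrite ler_nat.
        by near: n; exact: nbhs_infty_ger.
      by rewrite ler_norml; lra.
    - rewrite (_ : (fun x => _) = abse \o (EFin \o (fun x => w x * p x))).
        exact: integrable_abse.
      by apply/funext => x.
    - move=> n x _; rewrite patchE; case: (x \in A n) => //=.
      by rewrite normr0 lee_fin.
  have InE : (\int[mu]_x (w x * p x)%:E = (In w)%:E)%E.
    by rewrite /Rintegral fineK//; exact: integrable_fin_num.
  rewrite InE => /fine_cvgP[_]; rewrite /=.
  apply: cvg_trans; apply: near_eq_cvg; near=> n => /=.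
  by rewrite -integral_mkcond ftc.
have to_0 : (W (m + n.+1%:R) - W (m - n.+1%:R)) @[n --> \oo] --> (0 : R).
  pose K := normal_peak sigma * (2 * sigma ^+ 2).
  have WK (n : nat) x : `|x - m| = n.+1%:R -> `|W x| <= K / n.+1%:R.
    move=> xn; rewrite /W normrM (ger0_norm (normal_pdf_ge0 _ _ _)).
    apply: (le_trans (ler_piMl (normal_pdf_ge0 _ _ _) (sin_max _))).
    exact: normal_pdf_tail.
  apply/cvgr0Pnorm_le => e e0; near=> n.
  apply: (@le_trans _ _ (2 * K / n.+1%:R)).
    apply: (le_trans (ler_normB _ _)); rewrite -mulrA mulr_natl mulr2n lerD// WK//.
      by rewrite addrAC subrr add0r ger0_norm.
    by rewrite addrAC subrr add0r normrN ger0_norm.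
  rewrite ler_pdivrMr// -ler_pdivrMl// mulrC.
  apply: (@le_trans _ _ n%:R); last by rewrite ler_nat.
  by near: n; exact: nbhs_infty_ger.
have In0 : In w = 0 by exact: (cvg_unique _ to_In to_0).
move: In0; rewrite normal_intD//; last exact: quad_boundedZ.
rewrite !normal_intZ//; last exact/quad_bounded_bdd/cos_bdd.
rewrite mulNr => /eqP; rewrite subr_eq0 => /eqP h.
by rewrite -mulrA h mulrA mulfV ?mul1r// expf_neq0.
Unshelve. all: by end_near. Qed.

(** By Stein's identity, [c s], the integral of [cos (b + s * (x - m))], satisfies
   [c' = - sigma ^+ 2 * s * c]; hence its product with
   [expR (sigma ^+ 2 * s ^+ 2 / 2)] is constant. *)
Lemma normal_cos (b : R) :
  In (fun x => cos (b + (x - m))) = expR (- (sigma ^+ 2 / 2)) * cos b.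
Proof.
pose c s := In (fun x => cos (b + s * (x - m))).
have qc s : quad_bounded (fun x => cos (b + s * (x - m))) by exact/quad_bounded_bdd/cos_bdd.
have qs s : quad_bounded (fun x => (x - m) * sin (b + s * (x - m))).
  exact/quad_bounded_centerM/sin_bdd.
have cd (s : R) : is_derive s 1 c (- (sigma ^+ 2 * s * c s)).
  apply: (@quadratic_is_derive _ _ _ _ (2 * In (fun x => (x - m) ^+ 2))) => h.
  rewrite /c -normal_stein.
  rewrite (_ : _ - _ = In (fun x => cos (b + (s + h) * (x - m)) +
    (-1 * cos (b + s * (x - m)) + h * ((x - m) * sin (b + s * (x - m)))))); last first.
    have qZ1 := quad_boundedZ (-1) (qc s); have qZ2 := quad_boundedZ h (qs s).
    rewrite normal_intD//; last exact: quad_boundedD.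
    rewrite (normal_intD qZ1 qZ2) (normal_intZ (-1) (qc s)) (normal_intZ h (qs s)).
    by rewrite mulN1r mulrN opprK addrA.
  rewrite mulrC mulrA -normal_intZ; last exact: quad_bounded_center2.
  rewrite [leRHS](_ : _ = In (fun x => 2 * (h * (x - m)) ^+ 2)); last first.
    by apply: eq_Rintegral => x _; ring.
  apply: normal_int_norm_le.
  - apply: quad_boundedD => //; apply: quad_boundedD; exact: quad_boundedZ.
  - rewrite (_ : (fun x => _) = fun x => 2 * h ^+ 2 * (x - m) ^+ 2).
      exact/quad_boundedZ/quad_bounded_center2.
    by apply/funext => x; ring.
  move=> x; rewrite (_ : b + (s + h) * (x - m) = b + s * (x - m) + h * (x - m)); last by ring.
  set a := b + _; rewrite [X in `|X|](_ : _ = cos (a + h * (x - m)) -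
    (cos a - sin a * (h * (x - m)))); last by ring.
  exact: cos_taylor1.
pose e (s : R) := expR (sigma ^+ 2 * s ^+ 2 / 2).
have ed (s : R) : is_derive s 1 e (sigma ^+ 2 * s * e s).
  have qd : is_derive s 1 (fun s => sigma ^+ 2 * s ^+ 2 / 2) (sigma ^+ 2 * s).
    apply: (@quadratic_is_derive _ _ _ _ (sigma ^+ 2 / 2)) => h.
    rewrite [X in `|X|](_ : _ = sigma ^+ 2 / 2 * h ^+ 2); last by field.
    rewrite ger0_norm//; apply: mulr_ge0; last exact: sqr_ge0.
    by rewrite divr_ge0// sqr_ge0.
  have h := @is_derive1_comp _ expR (fun s => sigma ^+ 2 * s ^+ 2 / 2) s _ _ (is_derive_expR _) qd.
  by apply: (is_derive_eq h); rewrite mulrC.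
have Dd (s : R) : is_derive s 1 (fun s => e s * c s) 0.
  apply: (is_derive_eq (is_deriveM (ed s) (cd s))).
  by rewrite /GRing.scale/=; ring.
have := @mean_value_le _ _ _ 0 0 1 Dd; rewrite mul0r => /(_ _).
have z (x : R) : Num.min 0 1 <= x <= Num.max 0 1 -> `|0 : R| <= 0 by rewrite normr0.
move=> /(_ z); rewrite normr_le0 subr_eq0 => /eqP.
have c0 : c 0 = cos b.
  rewrite /c; under eq_Rintegral do rewrite mul0r addr0.
  exact: normal_int_cst.
have c1 : c 1 = In (fun x => cos (b + (x - m))).
  by apply: eq_Rintegral => x _; rewrite mul1r.
rewrite c0 c1 /e expr0n mulr0 mul0r expR0 mul1r expr1n mulr1 => <-.
by rewrite mulrA -expRD addrC subrr expR0 mul1r.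
Qed.

End normal_characteristic.

(** As for densities, an expectation is determined by the probabilities of
   events; the degenerate law is a point mass. *)
Lemma gaussian_law_cos d (T : measurableType d) (R : realType) (P : probability T R)
    (X : T -> R) (a v : R) : measurable_fun setT X -> 0 <= v ->
  (forall A, measurable A -> P (X @^-1` A) = gaussian_law a v A) ->
  forall b, \int[P]_w cos (b + X w) = expR (- (v / 2)) * cos (b + a).
Proof.
move=> mX v0 hX b; have pf := probability_finite P.
have bX (u : R -> R) : bdd_meas setT u -> bdd_meas setT (fun w => u (X w)).
  by move=> bu; apply: (bdd_meas_comp (X := X)).
have mXA A : measurable A -> measurable (X @^-1` A).
  by move=> mA; rewrite -[Y in measurable Y]setTI; apply: mX.
have EA A : measurable A -> \int[P]_w \1_A (X w) = fine (gaussian_law a v A).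
  by move=> mA; rewrite -hX// -(Rintegral_indic P (mXA _ mA)).
have bcos : bdd_meas [set: R] (fun x => cos (b + x)).
  by apply: bdd_meas_cos; apply: measurable_funD.
have ext (I : (R -> R) -> R) :
    (forall u v, bdd_meas setT u -> bdd_meas setT v ->
       I (fun x => u x + v x) = I u + I v) ->
    (forall r u, bdd_meas setT u -> I (fun x => r * u x) = r * I u) ->
    (forall u (B : R), bdd_meas setT u -> (forall x, `|u x| <= B) -> `|I u| <= B) ->
    (forall A, measurable A -> I \1_A = fine (gaussian_law a v A)) ->
    \int[P]_w cos (b + X w) = I (fun x => cos (b + x)).
  move=> ID IZ IB II; apply/eqP; rewrite -subr_eq0; apply/eqP.
  pose L (u : R -> R) := \int[P]_w u (X w) - I u.
  apply: (@bdd_meas_functional0 _ _ _ L 2); rewrite /L //.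
  - move=> u1 u2 b1 b2; rewrite ID//.
    by rewrite (bintD measurableT pf (bX _ b1) (bX _ b2)); ring.
  - by move=> r u bu; rewrite IZ// (bintZ measurableT pf _ (bX _ bu)); ring.
  - move=> u B bu hB; apply: (le_trans (ler_normB _ _)).
    rewrite mulr_natl mulr2n lerD ?IB//.
    by apply: Rintegral_prob_norm_le => //; exact: bX.
  - by move=> A mA; rewrite EA// II// subrr.
move: v0; rewrite le_eqVlt => /predU1P[v0|v0].
  rewrite (ext (fun u => u a))//.
  - by rewrite -v0 mul0r oppr0 expR0 mul1r.
  - by move=> A mA; rewrite /gaussian_law -v0 ltxx.
have s0 : 0 < Num.sqrt v by rewrite sqrtr_gt0.
rewrite (ext (fun u => \int[lebesgue_measure]_x (u x * normal_pdf a (Num.sqrt v) x))).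
- have := normal_cos a s0 (b + a); rewrite sqr_sqrtr ?ltW// => <-.
  apply: eq_Rintegral => x _; congr (cos _ * _); ring.
- by move=> u1 u2 b1 b2; apply: (normal_intD s0); exact: quad_bounded_bdd.
- by move=> r u bu; apply: (normal_intZ s0); exact: quad_bounded_bdd.
- move=> u B bu hB; rewrite -[leRHS](normal_int_cst a (Num.sqrt v)).
  apply: (normal_int_norm_le s0) => //; first exact: quad_bounded_bdd.
  by apply: quad_bounded_bdd; exact: bdd_meas_cst.
- move=> A mA; rewrite /gaussian_law v0 /normal_prob.
  rewrite -/(Rintegral _ _ _) [RHS]Rintegral_mkcond; apply: eq_Rintegral => x _.
  by rewrite indicE patchE; case: (x \in A); rewrite ?mul1r// mul0r.
Qed.

(** * Bernstein polynomials in several variables *)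

Section binomial_weights.
Variable R : realType.

(** [binomial_weight n k u] is the probability that [n] independent trials of
   success probability [u] give [k] successes, defined by conditioning on the
   first trial: moments then follow by induction, without binomial
   coefficients. *)
Fixpoint binomial_weight (n k : nat) (u : R) : R :=
  if n is n'.+1 then
    (1 - u) * binomial_weight n' k u +
    u * (if k is k'.+1 then binomial_weight n' k' u else 0)
  else (k == 0)%N%:R.

Lemma binomial_weight_ge0 n k u : 0 <= u <= 1 -> 0 <= binomial_weight n k u.
Proof.
move=> /andP[u0 u1]; elim: n k => [|n IH] k /=; first by [].
rewrite addr_ge0// mulr_ge0 ?subr_ge0//.
by case: k.
Qed.

Lemma binomial_weight_gt n k u : (n < k)%N -> binomial_weight n k u = 0.
Proof.
elim: n k => [|n IH] [|k]//= nk.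
by rewrite !IH ?mulr0 ?addr0// ltnW.
Qed.

Lemma binomial_weight_step n (h : nat -> R) u :
  \sum_(k < n.+2) h k * binomial_weight n.+1 k u =
  (1 - u) * \sum_(k < n.+1) h k * binomial_weight n k u +
  u * \sum_(k < n.+1) h k.+1 * binomial_weight n k u.
Proof.
rewrite (eq_bigr (fun k : 'I_n.+2 => (1 - u) * (h k * binomial_weight n k u) +
  u * (h k * (if nat_of_ord k is k'.+1 then binomial_weight n k' u else 0)))); last first.
  by move=> k _ /=; ring.
rewrite big_split/= -!mulr_sumr; congr (_ * _ + _ * _).
  by rewrite big_ord_recr/= binomial_weight_gt// mulr0 addr0.
by rewrite big_ord_recl/= mulr0 add0r.
Qed.

Lemma binomial_weight_sum n u : \sum_(k < n.+1) binomial_weight n k u = 1.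
Proof.
elim: n => [|n IH]; first by rewrite big_ord1.
have := binomial_weight_step n (fun=> 1) u.
under eq_bigr do rewrite mul1r; move=> ->.
by under eq_bigr do rewrite mul1r; rewrite IH; ring.
Qed.

Lemma binomial_weight_square n u c :
  \sum_(k < n.+1) (k%:R - c) ^+ 2 * binomial_weight n k u =
  n%:R * u * (1 - u) + (n%:R * u - c) ^+ 2.
Proof.
elim: n c => [|n IH] c.
  by rewrite big_ord1/= mulr1; ring.
rewrite (binomial_weight_step n (fun k => (k%:R - c) ^+ 2)) IH.
rewrite (eq_bigr (fun k : 'I_n.+1 => (k%:R - (c - 1)) ^+ 2 * binomial_weight n k u)).
  by rewrite IH -!natr1; ring.
by move=> k _; rewrite -natr1; congr (_ ^+ 2 * _); ring.
Qed.

End binomial_weights.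

Section bernstein.
Variables (R : realType) (I : finType).

Local Notation weight n nu u := (\prod_i binomial_weight n (nu i) (u i)).

Lemma bernstein_weight_sum n (u : I -> R) :
  \sum_(nu : {ffun I -> 'I_n.+1}) weight n nu u = 1.
Proof.
rewrite -(bigA_distr_bigA (fun i (k : 'I_n.+1) => binomial_weight n k (u i))) big1//.
by move=> i _; exact: binomial_weight_sum.
Qed.

Lemma bernstein_weight_marginal n (u : I -> R) (j : I) (h : nat -> R) :
  \sum_(nu : {ffun I -> 'I_n.+1}) h (nu j) * weight n nu u =
  \sum_(k < n.+1) h k * binomial_weight n k (u j).
Proof.
pose F i (k : 'I_n.+1) := (if i == j then h k else 1) * binomial_weight n k (u i).
rewrite (eq_bigr (fun nu : {ffun I -> 'I_n.+1} => \prod_i F i (nu i))); last first.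
  move=> nu _; rewrite /F big_split/=; congr (_ * _).
  by rewrite (bigD1 j)//= eqxx big1 ?mulr1// => i /negbTE ->.
rewrite -bigA_distr_bigA (bigD1 j)//= [X in _ * X]big1 ?mulr1.
  by apply: eq_bigr => k _; rewrite /F eqxx.
move=> i /negbTE ij; rewrite /F ij; under eq_bigr do rewrite mul1r.
exact: binomial_weight_sum.
Qed.

(** Bernstein's proof of the Weierstrass approximation theorem in several
   variables: the modulus of continuity of [h] enters only through the
   parabola bounding it. *)
Lemma bernstein_close n (h : (I -> R) -> R) (u : I -> R) (e c : R) : 0 <= c ->
  (forall i, 0 <= u i <= 1) ->
  (forall x, (forall i, 0 <= x i <= 1) ->
     `|h x - h u| <= e + c * \sum_i (x i - u i) ^+ 2) ->
  `|\sum_(nu : {ffun I -> 'I_n.+2}) h (fun i => (nu i)%:R / n.+1%:R) * weight n.+1 nu u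
    - h u| <= e + c * #|I|%:R / n.+1%:R.
Proof.
move=> c0 u01 hh.
have w0 (nu : {ffun I -> 'I_n.+2}) : 0 <= weight n.+1 nu u.
  by apply: prodr_ge0 => i _; exact: binomial_weight_ge0.
rewrite -[X in _ - X]mulr1 -[X in _ - _ * X](bernstein_weight_sum n.+1 u).
rewrite mulr_sumr -sumrB.
apply: (le_trans (ler_norm_sum _ _ _)).
apply: (@le_trans _ _ (\sum_(nu : {ffun I -> 'I_n.+2})
    (e + c * \sum_i ((nu i)%:R / n.+1%:R - u i) ^+ 2) * weight n.+1 nu u)).
  apply: ler_sum => nu _; rewrite -mulrBl normrM (ger0_norm (w0 nu)) ler_wpM2r//.
  apply: hh => i; rewrite divr_ge0//= ler_pdivrMr// mul1r ler_nat.
  by rewrite -ltnS.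
under eq_bigr do rewrite mulrDl -mulrA mulr_suml.
rewrite big_split/= -mulr_sumr bernstein_weight_sum mulr1 lerD2l.
rewrite -mulr_sumr -mulrA ler_wpM2l// exchange_big/=.
rewrite mulr_natl -sumr_const.
apply: ler_sum => i _.
rewrite (bernstein_weight_marginal _ _ i (fun k => (k%:R / n.+1%:R - u i) ^+ 2)).
have n0 : (0 : R) < n.+1%:R by [].
rewrite (eq_bigr (fun k : 'I_n.+2 => n.+1%:R^-1 ^+ 2 *
    ((k%:R - n.+1%:R * u i) ^+ 2 * binomial_weight n.+1 k (u i)))); last first.
  by move=> k _; rewrite mulrA -exprMn; congr (_ ^+ 2 * _); field.
rewrite -mulr_sumr binomial_weight_square subrr expr0n addr0.
rewrite [leLHS](_ : _ = n.+1%:R^-1 * (u i * (1 - u i))); last by field.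
rewrite ler_piMr ?invr_ge0//; have /andP[u0 u1] := u01 i; nra.
Qed.

End bernstein.

(** * Approximation by trigonometric polynomials *)

Section trigonometric_polynomials.
Variables (R : realType) (I : finType).

(** The functions whose expectations are known from the characteristic function;
   the product formula for cosines makes them an algebra. *)
Inductive trig_poly : ((I -> R) -> R) -> Prop :=
| trig_cos b t : trig_poly (fun x => cos (b + \sum_i t i * x i))
| trig_add T1 T2 : trig_poly T1 -> trig_poly T2 ->
    trig_poly (fun x => T1 x + T2 x)
| trig_scale r T : trig_poly T -> trig_poly (fun x => r * T x).

Lemma trig_cst r : trig_poly (fun=> r).
Proof.
rewrite (_ : (fun=> r) = fun x : I -> R => r * cos (0 + \sum_i 0 * x i)).
  exact: (trig_scale _ (trig_cos _ (fun=> 0))).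
apply/funext => x; rewrite big1 ?addr0 ?cos0 ?mulr1// => i _.
by rewrite mul0r.
Qed.

Lemma trig_cosM b t b' t' : trig_poly (fun x =>
  cos (b + \sum_i t i * x i) * cos (b' + \sum_i t' i * x i)).
Proof.
rewrite (_ : (fun x => _) = fun x : I -> R =>
    2^-1 * (cos ((b + b') + \sum_i (t i + t' i) * x i) +
            cos ((b - b') + \sum_i (t i - t' i) * x i))).
  apply/trig_scale/trig_add.
    exact: (trig_cos _ (fun i => t i + t' i)).
  exact: (trig_cos _ (fun i => t i - t' i)).
apply/funext => x.
under [X in cos (b + b' + X)]eq_bigr do rewrite mulrDl.
under [X in cos (b - b' + X)]eq_bigr do rewrite mulrBl.
rewrite big_split sumrB/=; set A := \sum_i t i * _; set A' := \sum_i _ * _.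
rewrite (_ : b + b' + _ = (b + A) + (b' + A')); last by ring.
rewrite (_ : b - b' + _ = (b + A) - (b' + A')); last by ring.
rewrite (cosD (b + A)) (cosD (b + A) (- _)) cosN sinN; by field.
Qed.

Lemma trig_mul T1 T2 : trig_poly T1 -> trig_poly T2 ->
  trig_poly (fun x => T1 x * T2 x).
Proof.
move=> h1 h2; elim: h1 => {T1} [b t|T1 T1' _ IH1 _ IH2|r T1 _ IH].
- elim: h2 => {T2} [b' t'|T2 T2' _ IH1 _ IH2|r T2 _ IH].
  + exact: trig_cosM.
  + by under eq_fun do rewrite mulrDr; exact: trig_add.
  + by under eq_fun do rewrite mulrCA; exact: trig_scale.
- by under eq_fun do rewrite mulrDl; exact: trig_add.
- by under eq_fun do rewrite -mulrA; exact: trig_scale.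
Qed.

Lemma trig_sum (J : Type) (s : seq J) (T : J -> (I -> R) -> R) :
  (forall j, trig_poly (T j)) -> trig_poly (fun x => \sum_(j <- s) T j x).
Proof.
move=> hT; elim: s => [|j s IH].
  by under eq_fun do rewrite big_nil; exact: trig_cst.
by under eq_fun do rewrite big_cons; exact: trig_add.
Qed.

Lemma trig_prod (J : Type) (s : seq J) (T : J -> (I -> R) -> R) :
  (forall j, trig_poly (T j)) -> trig_poly (fun x => \prod_(j <- s) T j x).
Proof.
move=> hT; elim: s => [|j s IH].
  by under eq_fun do rewrite big_nil; exact: trig_cst.
by under eq_fun do rewrite big_cons; exact: trig_mul.
Qed.

Lemma trig_sin (i : I) (a : R) : trig_poly (fun x => sin (a * x i)).
Proof.
rewrite (_ : (fun x => _) = fun x : I -> R =>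
    cos (- (pi / 2) + \sum_j (if j == i then a else 0) * x j)).
  exact: (trig_cos _ (fun j => if j == i then a else 0)).
apply/funext => x; rewrite (bigD1 i)//= eqxx big1 ?addr0.
  by rewrite addrC cosBpihalf.
by move=> j /negbTE ->; rewrite mul0r.
Qed.

Lemma trig_binomial_weight n k (T : (I -> R) -> R) : trig_poly T ->
  trig_poly (fun x => binomial_weight n k (T x)).
Proof.
move=> hT; elim: n k => [|n IH] k /=; first exact: trig_cst.
apply: trig_add; apply: trig_mul => //.
  apply: trig_add; first exact: trig_cst.
  by under eq_fun do rewrite -mulN1r; exact: trig_scale.
by case: k => [|k]; [exact: trig_cst|exact: IH].
Qed.

End trigonometric_polynomials.

Section trigonometric_approximation.
Variable R : realType.

(** Clamping away from the ends of the domain of the arcsine gives a bounded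
   continuous function on the line inverting the sine near zero. *)
Definition clamp (s : R) : R := Num.max (- 2^-1) (Num.min s 2^-1).

Lemma clampP (s : R) : [\/ clamp s = - 2^-1 /\ s <= - 2^-1,
  clamp s = s /\ - 2^-1 <= s <= 2^-1 | clamp s = 2^-1 /\ 2^-1 <= s].
Proof.
rewrite /clamp; case: (leP s 2^-1) => h1.
  case: (leP (- 2^-1) s) => h2; last by constructor 1; split => //; exact: ltW.
  by constructor 2; split=> //; lra.
constructor 3; split; last exact: ltW.
by rewrite max_r// lerNl; lra.
Qed.

Lemma clamp_lipschitz (s t : R) : `|clamp s - clamp t| <= `|s - t|.
Proof.
wlog st : s t / s <= t.
  move=> H; have [st|/ltW ts] := leP s t; first exact: H.
  by rewrite distrC [leRHS]distrC; exact: H.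
rewrite (distrC s) (ger0_norm (x := t - s)) ?subr_ge0// ler_norml.
by case: (clampP s) => -[-> hs]; case: (clampP t) => -[-> ht]; lra.
Qed.

Lemma clamp_norm_le (s : R) : `|clamp s| <= 2^-1.
Proof. by rewrite ler_norml; case: (clampP s) => -[-> hs]; lra. Qed.

Lemma clamp_id (s : R) : `|s| <= 2^-1 -> clamp s = s.
Proof.
by rewrite ler_norml => s2; case: (clampP s) => -[-> hs]; lra.
Qed.

Definition clamped_asin (s : R) : R := asin (clamp s).

Lemma clamped_asin_continuous : continuous clamped_asin.
Proof.
move=> s; apply: (@continuous_comp _ _ _ clamp asin).
  apply/cvgrPdist_le => e e0; near=> t.
  apply: (le_trans (clamp_lipschitz _ _)).
  by near: t; apply: cvgr_dist_le.
by apply: continuous_asin; have := clamp_norm_le s; rewrite ler_norml; lra.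
Unshelve. all: by end_near. Qed.

Lemma clamped_asin_le (s : R) : `|clamped_asin s| <= 2.
Proof.
have c2 := clamp_norm_le s; have p2 : pi / 2 <= 2 :> R.
  exact/ltW/pihalf_lt2.
have [|+ _] := @asin_def R (clamp s).
  by move: c2; rewrite ler_norml; lra.
by rewrite /clamped_asin ler_norml; lra.
Qed.

Lemma clamped_asinK (y : R) : `|y| <= 2^-1 -> clamped_asin (sin y) = y.
Proof.
move=> y2; rewrite /clamped_asin clamp_id; last exact: le_trans (sin_norm_le y) y2.
apply: sinK; rewrite in_itv/=; have := @pi_ge2 R.
by move: y2; rewrite ler_norml; lra.
Qed.

Variable I : finType.

Definition uniformly_continuous_on_bounded (Phi : (I -> R) -> R) :=
  forall M e : R, 0 < e -> exists2 delta : R, 0 < delta &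
  forall x y, (forall i, `|x i| <= M) -> (forall i, `|y i| <= M) ->
    (forall i, `|x i - y i| <= delta) -> `|Phi x - Phi y| <= e.

(** A function of [x] is a function of the numbers [sin (x i / L)] on the cube
   of side [L]; a polynomial in these sines is bounded on the whole space by
   its bound on the cube, contrary to a polynomial in [x]. *)
Lemma trig_approximation (Phi : (I -> R) -> R) (B L e : R) :
  (forall x, `|Phi x| <= B) -> uniformly_continuous_on_bounded Phi ->
  0 < L -> 0 < e ->
  exists2 T, trig_poly T &
    forall x, `|Phi x - T x| <= e + 2 * B * \sum_i (L / 2 < `|x i|)%R%:R.
Proof.
move=> PhiB PhiC L0 e0.
have B0 : 0 <= B by exact: le_trans (PhiB (fun=> 0)).
have e20 : 0 < e / 2 by rewrite divr_gt0.
have [delta delta0 hdelta] := PhiC (2 * L) _ e20.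
have [eta eta0 heta] := heine_cantor (-1) 1 clamped_asin_continuous (divr_gt0 delta0 L0).
pose zeta s := L * clamped_asin s.
have zeta_le s : `|zeta s| <= 2 * L.
  by rewrite /zeta normrM gtr0_norm// mulrC ler_pM2r// clamped_asin_le.
pose h (u : I -> R) := Phi (fun i => zeta (2 * u i - 1)).
pose c := 8 * B / eta ^+ 2.
have c0 : 0 <= c by rewrite divr_ge0 ?mulr_ge0 ?exprn_ge0// ltW.
pose n := Num.truncn (c * #|I|%:R / (e / 2)).
pose T (x : I -> R) := \sum_(nu : {ffun I -> 'I_n.+2})
  h (fun i => (nu i)%:R / n.+1%:R) *
  \prod_i binomial_weight n.+1 (nu i) (2^-1 * (1 + sin (L^-1 * x i))).
exists T.
  apply: trig_sum => nu; apply: trig_scale; apply: trig_prod => i.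
  apply: trig_binomial_weight; apply: trig_scale; apply: trig_add.
    exact: trig_cst.
  exact: trig_sin.
move=> x; pose u i := 2^-1 * (1 + sin (L^-1 * x i)).
have u01 i : 0 <= u i <= 1.
  by rewrite /u; have := sin_le1 (L^-1 * x i); have := sin_geN1 (L^-1 * x i); lra.
have hu : h u = Phi (fun i => zeta (sin (L^-1 * x i))).
  by rewrite /h; congr Phi; apply/funext => i; congr zeta; rewrite /u; field.
have T_close : `|T x - h u| <= e.
  apply: (@le_trans _ _ (e / 2 + c * #|I|%:R / n.+1%:R)); last first.
    rewrite [leRHS](splitr e) lerD2l ler_pdivrMr// -ler_pdivrMl// mulrC.
    exact/ltW/truncnS_gt.
  apply: bernstein_close => // y y01.
  have [near_|] := pselect (forall i, `|y i - u i| <= eta / 2).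
    apply: (@le_trans _ _ (e / 2)); last first.
      by rewrite lerDl mulr_ge0// sumr_ge0// => i _; exact: sqr_ge0.
    apply: hdelta => // i; rewrite -mulrBr normrM (gtr0_norm L0) mulrC.
    rewrite -ler_pdivlMr//; apply: heta; first by have := y01 i; lra.
    rewrite [X in `|X|](_ : _ = 2 * (y i - u i)); last by rewrite /u; ring.
    by rewrite normrM ger0_norm// mulrC -ler_pdivlMr.
  move=> /existsNP[i /negP]; rewrite -ltNge => far.
  apply: (@le_trans _ _ (2 * B)).
    apply: (le_trans (ler_normB _ _)).
    by have := PhiB (fun i => zeta (2 * y i - 1)); have := PhiB (fun i => zeta (2 * u i - 1));
      rewrite /h; lra.
  have -> : 2 * B = c * (eta / 2) ^+ 2 by rewrite /c; field; rewrite gt_eqF.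
  apply: (@le_trans _ _ (c * \sum_i (y i - u i) ^+ 2)); last by rewrite lerDr ltW.
  rewrite ler_wpM2l// (bigD1 i)//=.
  apply: (@le_trans _ _ ((y i - u i) ^+ 2)).
    rewrite -(real_normK (num_real (y i - u i))) ler_pXn2r ?nnegrE ?(ltW far)//.
    by rewrite divr_ge0// ltW.
  by rewrite lerDl sumr_ge0// => j _; exact: sqr_ge0.
have S0 : 0 <= \sum_i (L / 2 < `|x i|)%R%:R :> R by apply: sumr_ge0.
rewrite (_ : Phi x - T x = (Phi x - h u) - (T x - h u)); last by ring.
apply: (le_trans (ler_normB _ _)); rewrite addrC lerD//.
have [inside|] := pselect (forall i, `|x i| <= L / 2).
  rewrite hu (_ : (fun i => _) = x) ?subrr ?normr0.
    by rewrite mulr_ge0// mulr_ge0.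
  apply/funext => i; rewrite /zeta clamped_asinK.
    by rewrite mulrA mulfV ?gt_eqF// mul1r.
  by rewrite normrM gtr0_norm ?invr_gt0// ler_pdivrMl// inside.
move=> /existsNP[i /negP]; rewrite -ltNge => out.
apply: (@le_trans _ _ (2 * B)).
  apply: (le_trans (ler_normB _ _)).
  by have := PhiB x; have := PhiB (fun i => zeta (2 * u i - 1)); rewrite /h; lra.
rewrite ler_peMr ?mulr_ge0// (bigD1 i)//= out lerDl.
by apply: sumr_ge0.
Qed.

End trigonometric_approximation.

(** * Weak convergence *)

(** A single random variable is tight: the indicators of the tails decrease to
   zero pointwise. *)
Lemma tail_small d (T : measurableType d) (R : realType) (Q : probability T R)
    (Y : T -> R) (e : R) : measurable_fun setT Y -> 0 < e ->
  \forall n \near \oo, \int[Q]_w (n%:R < `|Y w|)%R%:R <= e.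
Proof.
move=> mY e0.
have mf (n : nat) : measurable_fun setT (fun w => (n%:R < `|Y w|)%R%:R : R).
  apply: (measurableT_comp (f := fun b : bool => b%:R : R)) => //.
  apply: measurable_fun_ltr => //; exact: measurableT_comp.
have bf (n : nat) : bdd_meas setT (fun w => (n%:R < `|Y w|)%R%:R : R).
  by split => //; exists 1 => w _; case: (_ < _); rewrite ?normr1 ?normr0.
have : (\int[Q]_w ((n%:R < `|Y w|)%R%:R : R)%:E)%E @[n --> \oo] -->
       (\int[Q]_w (0 : R)%:E)%E.
  apply: (@dominated_cvg _ _ _ Q setT measurableT _ _ (fun=> 1%E)) => //.
  - by move=> n; apply/measurable_EFinP.
  - move=> w _; apply: cvg_near_cst; near=> n.
    rewrite ltNge (_ : `|Y w| <= n%:R)//.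
    by near: n; exact: nbhs_infty_ger.
  - apply: (bdd_meas_integrable measurableT (probability_finite Q)).
    exact: bdd_meas_cst.
  - by move=> n w _; rewrite /= lee_fin; case: (_ < _); rewrite ?normr1 ?normr0.
rewrite integral0 => /fine_cvgP[_ /cvgrPdist_le /(_ _ e0)].
apply: filterS => n /=; rewrite sub0r normrN => /(le_trans _); apply.
exact: ler_norm.
Unshelve. all: by end_near. Qed.

Section weak_convergence.
Variables (R : realType) (I : finType).
Variables (d : nat -> measure_display) (T : forall v, measurableType (d v)).
Variables (P : forall v, probability (T v) R) (X : forall v, T v -> I -> R).
Variables (d' : measure_display) (T' : measurableType d') (Q : probability T' R).
Variable Y : T' -> I -> R.

Hypothesis mX : forall v i, measurable_fun [set: T v] (fun w => X w i).
Hypothesis mY : forall i, measurable_fun setT (fun w => Y w i).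
Hypothesis cvg_cos : forall b t,
  \int[P v]_w cos (b + \sum_i t i * X w i) @[v --> \oo] -->
  \int[Q]_w cos (b + \sum_i t i * Y w i).

Lemma bdd_meas_trig d0 (T0 : measurableType d0) (W : T0 -> I -> R) S :
  (forall i, measurable_fun setT (fun w => W w i)) -> trig_poly S ->
  bdd_meas setT (fun w => S (W w)).
Proof.
move=> mW; elim=> [b t|S1 S2 _ IH1 _ IH2|r S1 _ IH].
- apply: bdd_meas_cos; apply: measurable_funD => //.
  apply: (@measurable_sum _ _ _ _ _ _ (fun i w => t i * W w i)) => i.
  exact: measurable_funM.
- exact: bdd_measD.
- exact: bdd_measZ.
Qed.

Lemma trig_poly_cvg S : trig_poly S ->
  \int[P v]_w S (X w) @[v --> \oo] --> \int[Q]_w S (Y w).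
Proof.
have bX v S' := @bdd_meas_trig _ _ (@X v) S' (@mX v).
have bY S' := @bdd_meas_trig _ _ Y S' mY.
elim=> [b t|S1 S2 h1 IH1 h2 IH2|r S1 h1 IH]; first exact: cvg_cos.
- rewrite (bintD measurableT (probability_finite Q) (bY _ h1) (bY _ h2)).
  under eq_fun do rewrite (bintD measurableT (probability_finite _) (bX _ _ h1) (bX _ _ h2)).
  exact: cvgD.
- rewrite (bintZ measurableT (probability_finite Q) r (bY _ h1)).
  under eq_fun do rewrite (bintZ measurableT (probability_finite _) r (bX _ _ h1)).
  by apply: cvgM => //; exact: cvg_cst.
Qed.

Variable C : R.
Hypothesis bX : forall v i, bdd_meas [set: T v] (fun w => X w i).
Hypothesis XC : \forall v \near \oo, forall i, \int[P v]_w `|X w i| <= C.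

(** Lévy's continuity theorem, with the tightness of the sequence supplied by the
   bound on first moments: up to a term that is small on a large cube and bounded
   outside it, [Phi] is a trigonometric polynomial. *)
Lemma weak_convergence (Phi : (I -> R) -> R) (B : R) :
  (forall x, `|Phi x| <= B) -> uniformly_continuous_on_bounded Phi ->
  (forall v, measurable_fun [set: T v] (fun w => Phi (X w))) ->
  measurable_fun setT (fun w => Phi (Y w)) ->
  \int[P v]_w Phi (X w) @[v --> \oo] --> \int[Q]_w Phi (Y w).
Proof.
move=> PhiB PhiC mPX mPY; apply/cvgrPdist_le => e e0.
have B0 : 0 <= B by exact: le_trans (PhiB (fun=> 0)).
pose D : R := #|I|%:R; have D0 : 0 <= D by [].
have e8 : 0 < e / 8 by rewrite divr_gt0.
have BD0 : 0 < 2 * B * D + 1 by rewrite ltr_wpDl// !mulr_ge0.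
(* The level beyond which both families are negligible. *)
have [n [n0 nY nX]] : exists n : nat, [/\ (0 < n)%N,
    forall i, \int[Q]_w (n%:R < `|Y w i|)%R%:R <= e / 8 / (2 * B * D + 1) &
    2 * B * (D * (`|C| / n%:R)) <= e / 8].
  have nY : \forall n \near \oo, forall i,
      \int[Q]_w (n%:R < `|Y w i|)%R%:R <= e / 8 / (2 * B * D + 1).
    by apply: filter_forall => i; apply: tail_small => //; rewrite divr_gt0.
  have [n hn] : exists n : nat, [/\ (0 < n)%N, forall i,
      \int[Q]_w (n%:R < `|Y w i|)%R%:R <= e / 8 / (2 * B * D + 1) &
      (e / 8)^-1 * (2 * B * (D * `|C|)) <= n%:R].
    near \oo => n; exists n; split.
    - by near: n; exact: nbhs_infty_gt.
    - by near: n.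
    - by near: n; exact: nbhs_infty_ger.
  exists n; case: hn => n0 h1 h2; split => //.
  rewrite (_ : 2 * B * _ = 2 * B * (D * `|C|) / n%:R); last by rewrite !mulrA.
  by rewrite ler_pdivrMr ?ltr0n// -ler_pdivrMl.
have nR : (0 : R) < n%:R by rewrite ltr0n.
have L0 : (0 : R) < n%:R * 2 by rewrite mulr_gt0.
have [S tS hS] := trig_approximation PhiB PhiC L0 e8.
have nE : n%:R * 2 / 2 = n%:R :> R by field.
have close d0 (T0 : measurableType d0) (P0 : probability T0 R) (W : T0 -> I -> R) :
    (forall i, measurable_fun setT (fun w => W w i)) ->
    measurable_fun setT (fun w => Phi (W w)) ->
    2 * B * \sum_i \int[P0]_w (n%:R < `|W w i|)%R%:R <= e / 8 ->
    `|\int[P0]_w Phi (W w) - \int[P0]_w S (W w)| <= e / 8 + e / 8.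
  move=> mW mPW tail; have pf := probability_finite P0.
  have b1 : bdd_meas setT (fun w => Phi (W w)) by split => //; exists B.
  have b2 := bdd_meas_trig mW tS.
  have b3 i : bdd_meas setT (fun w => (n%:R < `|W w i|)%R%:R : R).
    split; last by exists 1 => w _; case: (_ < _); rewrite ?normr1 ?normr0.
    apply: (measurableT_comp (f := fun b : bool => b%:R : R)) => //.
    apply: measurable_fun_ltr => //; exact: measurableT_comp.
  have b4 : bdd_meas setT (fun w => \sum_i (n%:R < `|W w i|)%R%:R : R).
    exact: (@bdd_meas_sum _ _ _ _ _ _ _ (fun i w => (n%:R < `|W w i|)%R%:R)).
  have b5 := bdd_measZ (2 * B) b4.
  have b6 : bdd_meas [set: T0] (fun=> e / 8) by exact: bdd_meas_cst.
  rewrite -(bintB measurableT pf b1 b2).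
  apply: (le_trans (bint_norm measurableT pf (bdd_measB b1 b2))).
  apply: (@le_trans _ _ (\int[P0]_w (e / 8 + 2 * B * \sum_i (n%:R < `|W w i|)%R%:R))).
    apply: le_bint => //; [exact/bdd_meas_norm/bdd_measB|exact: bdd_measD|].
    by move=> w _; have := hS (W w); rewrite nE.
  rewrite (bintD measurableT pf b6 b5) (bintZ measurableT pf _ b4) Rintegral_prob_cst.
  rewrite lerD2l (@bint_sum _ _ _ _ _ measurableT pf _ _ _
    (fun i w => (n%:R < `|W w i|)%R%:R))//.
have closeY : `|\int[Q]_w Phi (Y w) - \int[Q]_w S (Y w)| <= e / 8 + e / 8.
  apply: close => //.
  apply: (@le_trans _ _ (2 * B * (D * (e / 8 / (2 * B * D + 1))))).
    rewrite ler_wpM2l ?mulr_ge0// /D mulr_natl -sumr_const; exact: ler_sum.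
  rewrite (_ : 2 * B * _ = e / 8 * (2 * B * D / (2 * B * D + 1))); last by ring.
  by rewrite -[leRHS]mulr1 ler_pM2l// ler_pdivrMr// mul1r lerDl.
near=> v.
have XCv : forall i, \int[P v]_w `|X w i| <= C by near: v.
have closeX : `|\int[P v]_w Phi (X w) - \int[P v]_w S (X w)| <= e / 8 + e / 8.
  apply: close => //.
  apply: le_trans nX; rewrite ler_wpM2l ?mulr_ge0// /D mulr_natl -sumr_const.
  apply: ler_sum => i _.
  have XCi := XCv i.
  have pf := probability_finite (P v).
  have bn := bdd_meas_norm (@bX v i).
  apply: (@le_trans _ _ (n%:R^-1 * \int[P v]_w `|X w i|)); last first.
    by rewrite mulrC ler_pM2r ?invr_gt0// (le_trans XCi)// ler_norm.
  rewrite -(bintZ measurableT pf)//; apply: le_bint => //; last first.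
  - move=> w _; case: ltP => [h|_] /=; last by rewrite mulr_ge0 ?invr_ge0.
    by rewrite ler_pdivlMl// mulr1 ltW.
  - exact: bdd_measZ.
  - split; last by exists 1 => w _; case: (_ < _); rewrite ?normr1 ?normr0.
    apply: (measurableT_comp (f := fun b : bool => b%:R : R)) => //.
    apply: measurable_fun_ltr => //; exact: measurableT_comp.
have Sclose : `|\int[Q]_w S (Y w) - \int[P v]_w S (X w)| <= e / 8.
  by near: v; move/cvgrPdist_le: (trig_poly_cvg tS) => /(_ _ e8).
move: closeY closeX Sclose.
move: (\int[Q]_w Phi _) (\int[Q]_w S _) (\int[P v]_w S _) (\int[P v]_w Phi _).
move=> a1 a2 a3 a4 h1 h2 h3.
rewrite (_ : a1 - a4 = (a1 - a2) + (a2 - a3) - (a4 - a3)); last by ring.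
apply: (le_trans (ler_normB _ _)).
have := ler_normD (a1 - a2) (a2 - a3); lra.
Unshelve. all: by end_near. Qed.

End weak_convergence.

(** * Mean scores as rank statistics of the pooled sample *)

Section design.
Variables (R : realType) (c : nat) (n : 'I_c -> nat).

Notation pooled := {l : 'I_c & 'I_(n l)}.

Lemma card_pooled : #|{: pooled}| = pooled_size n.
Proof.
rewrite card_tagged sumnE big_map big_enum /=.
by apply: eq_bigr => l _; rewrite card_ord.
Qed.

Lemma sum_pooled_dep (V : nmodType) (u : forall l, 'I_(n l) -> V) :
  \sum_(j : pooled) u (tag j) (tagged j) = \sum_l \sum_(i < n l) u l i.
Proof.
symmetry; rewrite (@sig_big_dep _ _ _ _ _ xpredT (fun _ _ => true) u).
by apply: eq_bigl.
Qed.

Lemma sum_pooled (V : nmodType) (u : 'I_c -> V) :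
  \sum_(j : pooled) u (tag j) = \sum_l u l *+ n l.
Proof.
rewrite (sum_pooled_dep (fun l _ => u l)).
by apply: eq_bigr => l _; rewrite sumr_const card_ord.
Qed.

Local Notation N := ((pooled_size n)%:R : R).
Local Notation s := (Num.sqrt N).

(** The mean over the [l]-th sample minus the mean over the pooled one, times
   [sqrt N].  The weights sum to zero, and the subtracted mean is negligible for
   scores of ranks. *)
Definition contrast (l l' : 'I_c) : R := s * ((l' == l)%:R / (n l)%:R - N^-1).

Hypothesis n0 : forall l, (0 < n l)%N.
Hypothesis N0 : (0 < pooled_size n)%N.

Let N0R : 0 < N. Proof. by rewrite ltr0n. Qed.
Let s0 : 0 < s. Proof. by rewrite sqrtr_gt0. Qed.
Let ss : s * s = N. Proof. by rewrite -expr2 sqr_sqrtr// ltW. Qed.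
Let invs : s^-1 = s / N.
Proof. by rewrite -[X in _ / X]ss invfM mulrA divff ?mul1r// gt_eqF. Qed.
Let n0R l : 0 < (n l)%:R :> R. Proof. by rewrite ltr0n. Qed.

Lemma natr_pooled_size : N = \sum_l (n l)%:R.
Proof. by rewrite /pooled_size natr_sum. Qed.

Lemma contrastE l l' : contrast l l' + s^-1 = s * ((l' == l)%:R / (n l)%:R).
Proof. by rewrite /contrast mulrBr -invs subrK. Qed.

Lemma contrast_sum0 l : \sum_(j : pooled) contrast l (tag j) = 0.
Proof.
rewrite sum_pooled; under eq_bigr do rewrite -mulr_natr.
rewrite /contrast; under eq_bigr do rewrite -mulrA mulrBl.
rewrite -mulr_sumr sumrB -mulr_sumr -natr_pooled_size mulVf ?gt_eqF//.
rewrite (bigD1 l)//= eqxx mul1r mulVf ?gt_eqF// big1 ?addr0 ?subrr ?mulr0//.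
by move=> l' /negbTE ->; rewrite !mul0r.
Qed.

Lemma contrast_le (A : R) l l' : N / (n l)%:R + 1 <= A -> `|contrast l l'| <= A / s.
Proof.
move=> hA; rewrite /contrast.
rewrite (_ : s * _ = ((l' == l)%:R * (N / (n l)%:R) - 1) * (s / N)); last first.
  by field; rewrite !gt_eqF.
rewrite -invs normrM (gtr0_norm (x := s^-1)) ?invr_gt0// ler_pM2r ?invr_gt0//.
apply: le_trans hA; apply: (le_trans (ler_normB _ _)); rewrite normr1 lerD2r.
have Nn : 0 <= N / (n l)%:R by rewrite divr_ge0 ?(ltW N0R).
by case: (l' == l); rewrite ?mul1r ?mul0r ?normr0// ger0_norm.
Qed.

Section ranks.
Variable x : forall l : 'I_c, 'I_(n l) -> R.

Lemma pooled_rankE (j : pooled) :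
  pooled_rank x (tagged j) = (\sum_(j' : pooled) (x (tagged j') <= x (tagged j))%R)%N.
Proof.
rewrite /pooled_rank.
by rewrite -(sum_pooled_dep (fun l' (i' : 'I_(n l')) => nat_of_bool (x i' <= x (tagged j)))).
Qed.

Lemma score_mean_pooled k r l : s * score_mean x k r l =
  \sum_(j : pooled) (contrast l (tag j) + s^-1) *
    score k r ((\sum_(j' : pooled) (x (tagged j') <= x (tagged j))%R)%:R / N).
Proof.
rewrite /score_mean.
transitivity (\sum_(j : pooled)
    s * ((tag j == l)%:R / (n l)%:R) * trig_g k r (uniform_score x (tagged j))); last first.
  apply: eq_bigr => j _; rewrite contrastE /score /uniform_score pooled_rankE.
  by congr (_ * trig_g k r _); rewrite mulrA.
rewrite (sum_pooled_dep (fun l' (i : 'I_(n l')) =>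
  s * ((l' == l)%:R / (n l)%:R) * trig_g k r (uniform_score x i))).
rewrite (bigD1 l)//= [X in _ + X]big1 ?addr0.
  by rewrite eqxx mul1r [in LHS]mulrA mulr_sumr.
by move=> l' /negbTE ll'; rewrite big1// => i _; rewrite ll' mul0r mulr0 mul0r.
Qed.

End ranks.

Section linearization.
Context d (T : measurableType d) (P : probability T R).
Variable Theta : forall l : 'I_c, 'I_(n l) -> {RV P >-> R}.
Variables (f : R -> R) (delta : 'cV[R]_c) (H B : R).
Hypothesis hf : C1_circular_density f.
Hypothesis hTheta : forall l (i : 'I_(n l)),
  has_circular_density (Theta i) (fun x => f (x + delta l 0 / s)).
Hypothesis hindep : mutually_independent
  (fun j : pooled => Theta (tagged j)).
Hypotheses (H0 : 0 <= H) (B0 : 0 <= B).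
Hypothesis hB : forall x : R, - H <= x <= 2 * pi + H -> `|f x| <= B /\ `|derive1 f x| <= B.
Hypothesis hdelta : forall l, `|delta l 0| <= H.

Local Notation F := (circular_cdf f).
Local Notation mu := (@lebesgue_measure R).
Local Notation Ex := (Rintegral P setT).

Let theta (j : pooled) := Theta (tagged j).
Let shift_ (j : pooled) := delta (tag j) 0 / s.

Let s_ge1 : 1 <= s.
Proof. by rewrite -[leLHS]sqrtr1 ler_wsqrtr// (ler_nat R 1). Qed.

Lemma shift_le j : `|shift_ j| <= H / s.
Proof.
rewrite /shift_ normrM (ger0_norm (x := s^-1)) ?invr_ge0 ?(ltW s0)//.
by rewrite ler_pM2r ?invr_gt0.
Qed.

Lemma shift_leH j : `|shift_ j| <= H.
Proof.
apply: (le_trans (shift_le j)); rewrite ler_pdivrMr// ler_peMr//.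
Qed.

Let thetaL (j : pooled) := hTheta (tagged j).

(** The scaled mean score with each rank divided by [N] replaced by the value of
   the distribution function. *)
Definition linear_stat (k : nat) (r : 'I_2) (l : 'I_c) (w : T) : R :=
  \sum_(j : pooled) contrast l (tag j) * score k r (F (theta j w)).

Let C : R := 2 * pi * B * (1 + H).

(** The linearization of rank statistics on the mesh of the points
   [2 * pi * m / M]; a shift of size [H / s] moves probabilities by [O(1 / s)]. *)
Lemma linear_stat_close (A : R) (M k : nat) r l : (0 < k)%N -> (0 < M)%N ->
  N / (n l)%:R + 1 <= A ->
  Ex (fun w => `|s * score_mean (fun l (i : 'I_(n l)) => Theta i w) k r l - linear_stat k r l w|) <=
  (2 * (A + 2) * score_lip R k * C ^+ 2 + A * score_lip R k * C) * (s / M%:R) +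
  (2 * (A + 2) * score_lip R k * C + A * score_lip R k * C * (2 + 2 * C ^+ 2) +
   score_lip R k * A * C * (2 + 2 * C ^+ 2 + 1)) / s +
  (A * score_lip R k * (C + (2 + 2 * C ^+ 2)) +
   score_lip R k * (A ^+ 2 * C + (2 + 2 * C ^+ 2))) * (Num.sqrt M%:R / s).
Proof.
move=> k0 M0 hA.
have M0R : (0 : R) < M%:R by rewrite ltr0n.
have p0 := pi2_gt0 R.
pose x_ (m : nat) : R := 2 * pi * (m%:R / M%:R).
have x_mono : {homo x_ : a b / (a <= b)%N >-> a <= b}.
  by move=> a b ab; rewrite /x_ ler_pM2l// ler_pM2r ?invr_gt0// ler_nat.
have x0 : x_ 0 = 0 by rewrite /x_ mul0r mulr0.
have xM : x_ M = 2 * pi by rewrite /x_ divff ?mulr1// gt_eqF.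
have x_ge0 m : 0 <= x_ m by rewrite -x0 x_mono.
have x_le m : (m <= M)%N -> x_ m <= 2 * pi by rewrite -xM; exact: x_mono.
have x_step m : x_ m.+1 - x_ m = 2 * pi / M%:R.
  by rewrite /x_ -natr1; ring.
have pB : 0 <= 2 * pi * B by rewrite mulr_ge0// ltW.
have CE : C = 2 * pi * B + 2 * pi * B * H by rewrite /C; ring.
have BC : 2 * pi * B <= C by rewrite CE lerDl mulr_ge0.
have HBC : 2 * pi * B * H <= C by rewrite CE lerDr.
have bcell a b : bdd_meas [set: R] (\1_`[a, b[ : R -> R).
  by apply: bdd_meas_indic; exact: measurable_itv.
have cardN : #|{: pooled}|%:R = N by rewrite card_pooled.
have J0 : (0 < #|{: pooled}|)%N by rewrite card_pooled.
have abs_indic (A' : set R) x : `|\1_A' x| = \1_A' x :> R.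
  by rewrite indicE ger0_norm.
rewrite /linear_stat; under eq_Rintegral do rewrite score_mean_pooled.
have := @rank_linearization _ _ _ P _ theta hindep M x_ F C A (score_lip R k)
  (fun j => contrast l (tag j)) (score k r) (dscore k r) (score_primitive k r)
  J0 M0 x_mono.
rewrite cardN => lin; apply: lin.
- by move=> j w; rewrite x0 xM; exact: (law_range (thetaL j)).
- exact: measurable_cdf.
- exact: score_bdd_meas.
- by move=> m mM; apply: (cdf01 hf); rewrite x_ge0 x_le// ltnW.
- move=> j m mM.
  apply: (le_trans (law_le hf hB (shift_leH j) (thetaL j) (bcell _ _) _)).
    by move=> x; rewrite indicE.
  rewrite circle_cell_length ?x_mono ?x_le// x_step mulrA (mulrC B) ler_pM2r ?invr_gt0//.
- move=> j m mM; rewrite -(cdf_cell hf) ?x_mono ?x_le//.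
  apply: (le_trans (law_close hf H0 hB (shift_leH j) (thetaL j) (bcell _ _))).
  under eq_Rintegral do rewrite abs_indic.
  rewrite circle_cell_length ?x_mono ?x_le// x_step invfM mulrA (mulrA C).
  rewrite [leLHS](_ : _ = B * `|shift_ j| * (2 * pi) / M%:R); last by rewrite mulrA.
  rewrite ler_pM2r ?invr_gt0//; apply: (@le_trans _ _ (B * (H / s) * (2 * pi))).
    by rewrite ler_pM2r// ler_wpM2l// shift_le.
  rewrite [leLHS](_ : _ = 2 * pi * B * H / s); last by ring.
  by rewrite ler_pM2r ?invr_gt0.
- move=> j m mM.
  have -> : F (x_ m) = F (x_ m) - F 0 by rewrite (cdf0 f) subr0.
  rewrite -(cdf_cell hf) ?x_ge0 ?x_le 1?ltnW//.
  have bbelow : bdd_meas [set: R] (\1_`]-oo, (x_ m)[ : R -> R).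
    by apply: bdd_meas_indic; exact: measurable_itv.
  have belowE w : \1_`]-oo, (x_ m)[ (theta j w) = \1_`[0, (x_ m)[ (theta j w) :> R.
    have /andP[h1 h2] := law_range (thetaL j) w.
    rewrite !indicE; congr (nat_of_bool _)%:R; apply/idP/idP => /set_mem/=;
      by rewrite !in_itv/= => h; apply/mem_set; rewrite /= in_itv/= ?h1//; case/andP: h.
  under eq_Rintegral do rewrite belowE.
  apply: (le_trans (law_close hf H0 hB (shift_leH j) (thetaL j) (bcell _ _))).
  under eq_Rintegral do rewrite abs_indic.
  rewrite circle_cell_length ?x_ge0 ?x_le 1?ltnW// subr0.
  apply: (@le_trans _ _ (B * (H / s) * (2 * pi))).
    apply: ler_pM => //; [by rewrite mulr_ge0|by rewrite ler_wpM2l// shift_le|].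
    by rewrite x_le// ltnW.
  rewrite [leLHS](_ : _ = 2 * pi * B * H / s); last by ring.
  by rewrite ler_pM2r ?invr_gt0.
- move=> m x mM /andP[h1 h2].
  have x2 : x <= 2 * pi by apply: (le_trans (ltW h2)); exact: x_le.
  rewrite ger0_norm ?subr_ge0 ?(cdf_mono hf)// -(cdf_cell hf)//.
  have bf := bdd_meas_density hf H0 hB.
  have bc := bdd_meas_circle (bcell (x_ m) x).
  apply: (@le_trans _ _ (\int[mu]_(y in `[0%R, (2 * pi)%R[) (B * \1_`[x_ m, x[ y))).
    apply: (@le_bint _ _ R mu _ (@measurable_circle R) (circle_finite R)).
    - exact: bdd_measM.
    - exact: bdd_measZ.
    - move=> y /in_circle yD; rewrite mulrC ler_wpM2r ?indicE//.
      apply: le_trans (ler_norm _) _; apply: (hB _).1.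
      have /andP[y0 y1] := yD.
      by rewrite (le_trans _ y0) ?oppr_le0//= (le_trans (ltW y1))// lerDl.
  rewrite (@bintZ _ _ _ mu _ (@measurable_circle R) (circle_finite R))//.
  rewrite circle_cell_length//; apply: (@le_trans _ _ (B * (2 * pi / M%:R))).
    by rewrite ler_wpM2l// -(x_step m) lerD2r ltW.
  by rewrite mulrA (mulrC B) ler_pM2r ?invr_gt0.
- exact: contrast_sum0.
- by move=> j; exact: contrast_le.
- exact: score_lipschitz.
- exact: score_taylor.
- exact: dscore_le.
- exact: score_primitive_taylor.
- exact: score_primitive_loop.
Qed.

End linearization.
End design.

(** * The linearized statistics at a fixed design *)

Section linear_clt.
Variables (R : realType) (c : nat) (n : 'I_c -> nat).
Notation pooled := {l : 'I_c & 'I_(n l)}.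
Local Notation N := ((pooled_size n)%:R : R).
Local Notation s := (Num.sqrt N).
Hypothesis N0 : (0 < pooled_size n)%N.

Context d (T : measurableType d) (P : probability T R).
Variable Theta : forall l : 'I_c, 'I_(n l) -> {RV P >-> R}.
Variables (f : R -> R) (delta : 'cV[R]_c) (H B : R).
Hypothesis hf : C1_circular_density f.
Hypothesis hTheta : forall l (i : 'I_(n l)),
  has_circular_density (Theta i) (fun x => f (x + delta l 0 / s)).
Hypothesis hindep : mutually_independent
  (fun j : pooled => Theta (tagged j)).
Hypothesis H0 : 0 <= H.
Hypothesis hB : forall x : R, - H <= x <= 2 * pi + H -> `|f x| <= B /\ `|derive1 f x| <= B.
Hypothesis hdelta : forall l, `|delta l 0| <= H.

Variable K : nat.
Notation KR := ('I_K * 'I_2)%type.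

Local Notation F := (circular_cdf f).
Local Notation mu := (@lebesgue_measure R).
Local Notation D0 := `[(0 : R), 2 * pi[%classic.
Local Notation Ex := (Rintegral P setT).

Let pf := probability_finite P.
Let theta (j : pooled) := Theta (tagged j).
Let N0R : 0 < N. Proof. by rewrite ltr0n. Qed.
Let s0 : 0 < s. Proof. by rewrite sqrtr_gt0. Qed.

Definition cdf_score (kr : KR) (x : R) : R := score kr.1.+1 kr.2 (F x).

Definition score_moment1 (h : R) (kr : KR) : R :=
  \int[mu]_(x in D0) (cdf_score kr x * f (x + h)).
Definition score_moment2 (h : R) (kr kr' : KR) : R :=
  \int[mu]_(x in D0) (cdf_score kr x * cdf_score kr' x * f (x + h)).

Lemma bdd_meas_cdf_score kr : bdd_meas setT (cdf_score kr).
Proof. exact: (bdd_meas_score_cdf hf). Qed.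

Lemma cdf_score_le kr x : `|cdf_score kr x| <= Num.sqrt 2.
Proof.
rewrite /cdf_score scoreE normrM ger0_norm ?sqrtr_ge0//.
by rewrite ler_piMr ?sqrtr_ge0// ler_norml cos_geN1 cos_le1.
Qed.

Let moment1 (j : pooled) kr :
  Ex (fun w => cdf_score kr (theta j w)) = score_moment1 (delta (tag j) 0 / s) kr.
Proof.
apply: (law_expectation hf hB _ (hTheta (tagged j))); last exact: bdd_meas_cdf_score.
exact: (shift_leH N0 H0 hdelta j).
Qed.

Let moment2 (j : pooled) kr kr' :
  Ex (fun w => cdf_score kr (theta j w) * cdf_score kr' (theta j w)) =
  score_moment2 (delta (tag j) 0 / s) kr kr'.
Proof.
apply: (law_expectation (u := fun x => cdf_score kr x * cdf_score kr' x) hf hB _ (hTheta (tagged j))).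
  exact: (shift_leH N0 H0 hdelta j).
by apply: bdd_measM; exact: bdd_meas_cdf_score.
Qed.

(* Weights of the scores in a linear combination of the statistics; they depend
   on an observation only through its sample. *)
Variable kappa : 'I_c -> KR -> R.

Let y (j : pooled) (x : R) : R := \sum_kr kappa (tag j) kr * cdf_score kr x.

Lemma bdd_meas_summand j : bdd_meas setT (y j).
Proof.
apply: (@bdd_meas_sum _ _ _ _ _ _ _ (fun kr x => kappa (tag j) kr * cdf_score kr x)) => kr.
exact/bdd_measZ/bdd_meas_cdf_score.
Qed.

Let byX j : bdd_meas setT (fun w => y j (theta j w)).
Proof. exact: (bdd_meas_comp (X := theta j) _ (bdd_meas_summand j)). Qed.

Let bsc j kr : bdd_meas setT (fun w => cdf_score kr (theta j w)).
Proof. exact: (bdd_meas_comp (X := theta j) _ (bdd_meas_cdf_score kr)). Qed.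

Lemma summand_mean j : Ex (fun w => y j (theta j w)) =
  \sum_kr kappa (tag j) kr * score_moment1 (delta (tag j) 0 / s) kr.
Proof.
rewrite (@bint_sum _ _ _ _ _ measurableT pf _ _ _
  (fun kr w => kappa (tag j) kr * cdf_score kr (theta j w))); last first.
  by move=> kr; exact: bdd_measZ.
by apply: eq_bigr => kr _; rewrite (bintZ measurableT pf)// moment1.
Qed.

Lemma summand_square j : Ex (fun w => y j (theta j w) ^+ 2) =
  \sum_kr \sum_kr' kappa (tag j) kr * kappa (tag j) kr' *
    score_moment2 (delta (tag j) 0 / s) kr kr'.
Proof.
pose g kr kr' w := kappa (tag j) kr * kappa (tag j) kr' *
  (cdf_score kr (theta j w) * cdf_score kr' (theta j w)).
have bg kr kr' : bdd_meas setT (g kr kr') by exact/bdd_measZ/bdd_measM.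
rewrite (_ : Rintegral _ _ _ = Ex (fun w => \sum_kr \sum_kr' g kr kr' w)).
  rewrite (@bint_sum _ _ _ _ _ measurableT pf _ _ _ (fun kr w => \sum_kr' g kr kr' w)).
    apply: eq_bigr => kr _.
    rewrite (@bint_sum _ _ _ _ _ measurableT pf _ _ _ (fun kr' w => g kr kr' w))//.
    apply: eq_bigr => kr' _; rewrite (bintZ measurableT pf) ?moment2//.
    exact: bdd_measM.
  by move=> kr; exact: (@bdd_meas_sum _ _ _ _ _ _ _ (fun kr' w => g kr kr' w)).
apply: eq_Rintegral => w _; rewrite expr2 /y mulr_suml; apply: eq_bigr => kr _.
by rewrite mulr_sumr; apply: eq_bigr => kr' _; rewrite /g mulrACA.
Qed.

Lemma summand_variance j :
  Ex (fun w => (y j (theta j w) - Ex (fun w => y j (theta j w))) ^+ 2) =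
  \sum_kr \sum_kr' kappa (tag j) kr * kappa (tag j) kr' *
    (score_moment2 (delta (tag j) 0 / s) kr kr' -
     score_moment1 (delta (tag j) 0 / s) kr * score_moment1 (delta (tag j) 0 / s) kr').
Proof.
set m := Ex (fun w => y j (theta j w)).
have b2 := bdd_measX 2 (byX j).
have b3 := bdd_measZ (- (2 * m)) (byX j).
have b4 : bdd_meas [set: T] (fun=> m ^+ 2) by exact: bdd_meas_cst.
rewrite (_ : Rintegral _ _ _ = Ex (fun w => y j (theta j w) ^+ 2 +
    - (2 * m) * y j (theta j w) + m ^+ 2)); last first.
  by apply: eq_Rintegral => w _; ring.
rewrite (bintD measurableT pf (bdd_measD b2 b3) b4) (bintD measurableT pf b2 b3).
rewrite (bintZ measurableT pf _ (byX j)) Rintegral_prob_cst -/m summand_square.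
rewrite (_ : _ + m ^+ 2 = \sum_kr \sum_kr' kappa (tag j) kr * kappa (tag j) kr' *
    score_moment2 (delta (tag j) 0 / s) kr kr' - m * m); last by ring.
rewrite {1 2}/m !summand_mean mulr_suml -sumrB; apply: eq_bigr => kr _.
rewrite mulr_sumr -sumrB; apply: eq_bigr => kr' _; ring.
Qed.

Variable Kb : R.
Hypothesis kappa_le : forall l kr, `|kappa l kr| <= Kb / s.

Let Bv : R := 2 * (Num.sqrt 2 * Kb * #|{: KR}|%:R / s).

Let y_le j x : `|y j x| <= Bv / 2.
Proof.
rewrite /Bv mulrAC divff// mul1r; apply: (le_trans (ler_norm_sum _ _ _)).
rewrite [leRHS](_ : _ = \sum_(kr : KR) (Kb / s * Num.sqrt 2)); last first.
  by rewrite sumr_const -[RHS]mulr_natr; ring.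
by apply: ler_sum => kr _; rewrite normrM ler_pM// cdf_score_le.
Qed.

(** With [Kb] fixed the summands are of size [1 / s], so the error is of order
   [N / s ^+ 3 = 1 / s]. *)
Lemma linear_clt (b : R) : Bv <= 1 ->
  `|Ex (fun w => cos (b + \sum_j y j (theta j w))) -
    expR (- ((\sum_l (n l)%:R * \sum_kr \sum_kr' kappa l kr * kappa l kr' *
      (score_moment2 (delta l 0 / s) kr kr' -
       score_moment1 (delta l 0 / s) kr * score_moment1 (delta l 0 / s) kr')) / 2)) *
    cos (b + \sum_l (n l)%:R * \sum_kr kappa l kr * score_moment1 (delta l 0 / s) kr)|
  <= 6 * Bv ^+ 3 * N.
Proof.
move=> B1.
have B0 (j : pooled) : 0 <= Bv.
  by have := le_trans (normr_ge0 _) (y_le j 0); lra.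
have Bv0 : 0 <= Bv.
  have /card_gt0P[j _] : (0 < #|{: pooled}|)%N by rewrite card_pooled.
  exact: B0 j.
have B01 : 0 <= Bv <= 1 by rewrite Bv0.
have ymu j x : `|y j x - Ex (fun w => y j (theta j w))| <= Bv.
  apply: (le_trans (ler_normB _ _)); rewrite (splitr Bv) lerD//.
  by apply: Rintegral_prob_norm_le.
have Emean : \sum_j Ex (fun w => y j (theta j w)) =
    \sum_l (n l)%:R * \sum_kr kappa l kr * score_moment1 (delta l 0 / s) kr.
  under [LHS]eq_bigr do rewrite summand_mean.
  pose mean l : R := \sum_kr kappa l kr * score_moment1 (delta l 0 / s) kr.
  by rewrite (sum_pooled n mean); apply: eq_bigr => l _; rewrite mulr_natl.
pose var l : R := \sum_kr \sum_kr' kappa l kr * kappa l kr' *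
      (score_moment2 (delta l 0 / s) kr kr' -
       score_moment1 (delta l 0 / s) kr * score_moment1 (delta l 0 / s) kr').
have Evar : \sum_j Ex (fun w => (y j (theta j w) - Ex (fun w => y j (theta j w))) ^+ 2) =
    \sum_l (n l)%:R * var l.
  under [LHS]eq_bigr do rewrite summand_variance.
  by rewrite (sum_pooled n var); apply: eq_bigr => l _; rewrite mulr_natl.
have := clt_cos hindep b bdd_meas_summand B01 ymu; cbv zeta.
by rewrite Evar Emean card_pooled.
Qed.

(** The source of tightness: for weights of size [1 / s] the bound is uniform as
   soon as the location is. *)
Lemma linear_moment : Ex (fun w => `|\sum_j y j (theta j w)|) <=
  1 + N * (Bv / 2) ^+ 2 +
  `|\sum_l (n l)%:R * \sum_kr kappa l kr * score_moment1 (delta l 0 / s) kr|.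
Proof.
rewrite (_ : \sum_l _ = \sum_j Ex (fun w => y j (theta j w))); last first.
  under [RHS]eq_bigr do rewrite summand_mean.
  pose mean l : R := \sum_kr kappa l kr * score_moment1 (delta l 0 / s) kr.
  by rewrite (sum_pooled n mean); apply: eq_bigr => l _; rewrite mulr_natl.
set m := \sum_j Ex _.
have bsum : bdd_meas setT (fun w => \sum_j y j (theta j w)).
  exact: (@bdd_meas_sum _ _ _ _ _ _ _ (fun j w => y j (theta j w))).
have bm : bdd_meas [set: T] (fun=> m) by exact: bdd_meas_cst.
have b1 : bdd_meas [set: T] (fun=> 1 : R) by exact: bdd_meas_cst.
have bnm : bdd_meas [set: T] (fun=> `|m|) by exact: bdd_meas_cst.
have b2 : bdd_meas setT (fun w => (\sum_j y j (theta j w) - m) ^+ 2).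
  exact/bdd_measX/bdd_measB.
apply: (@le_trans _ _ (Ex (fun w => 1 + (\sum_j y j (theta j w) - m) ^+ 2 + `|m|))).
  apply: le_bint => //; first exact: bdd_meas_norm.
    by apply: bdd_measD => //; exact: bdd_measD.
  move=> w _; move: (\sum_j _) => S.
  rewrite -{1}[S](subrK m); apply: (le_trans (ler_normD _ _)); rewrite lerD2r.
  rewrite -(real_normK (num_real (S - m))); have := normr_ge0 (S - m).
  by move: `|S - m| => u u0; have := sqr_ge0 (u - 1); nra.
rewrite (bintD measurableT pf (bdd_measD b1 b2) bnm) (bintD measurableT pf b1 b2).
rewrite !Rintegral_prob_cst lerD2r lerD2l.
have := centered_sum_sq_le hindep bdd_meas_summand.
under eq_Rintegral do rewrite sumrB -/m.
move/le_trans; apply.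
rewrite -card_pooled mulr_natl -sumr_const; apply: ler_sum => j _.
apply: Rintegral_prob_le; first exact: (bdd_measX 2 (byX j)).
move=> w; rewrite -(real_normK (num_real _)) ler_pXn2r ?nnegrE//.
exact: le_trans (normr_ge0 _) (y_le j 0).
Qed.

End linear_clt.

(** * Limits of moments along the designs *)

Lemma cvg_sum_fin (R : realType) (I : Type) (s : seq I) (u : I -> nat -> R) (a : I -> R) :
  (forall i, u i v @[v --> \oo] --> a i) ->
  \sum_(i <- s) u i v @[v --> \oo] --> \sum_(i <- s) a i.
Proof.
move=> hu; elim: s => [|i s IH].
  by under eq_fun do rewrite big_nil; rewrite big_nil; exact: cvg_cst.
by under eq_fun do rewrite big_cons; rewrite big_cons; exact: cvgD.
Qed.

Section numeric_limits.
Variables (R : realType) (c K : nat) (n : nat -> 'I_c -> nat).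
Variables (f : R -> R) (delta p : 'cV[R]_c).
Hypothesis hf : C1_circular_density f.
Hypothesis hN : pooled_size (n v) @[v --> \oo] --> \oo.
Hypothesis n0 : forall v l, (0 < n v l)%N.
Hypothesis N0 : forall v, (0 < pooled_size (n v))%N.
Hypothesis p0 : forall l, 0 < p l 0.
Hypothesis hp : forall l,
  (n v l)%:R / (pooled_size (n v))%:R @[v --> \oo] --> p l 0.

Notation KR := ('I_K * 'I_2)%type.
Local Notation N v := ((pooled_size (n v))%:R : R).
Local Notation s v := (Num.sqrt (N v)).
Local Notation F := (circular_cdf f).
Local Notation mu := (@lebesgue_measure R).
Local Notation D0 := `[(0 : R), 2 * pi[%classic.

Let N0R v : 0 < N v. Proof. by rewrite ltr0n. Qed.
Let s0 v : 0 < s v. Proof. by rewrite sqrtr_gt0. Qed.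
Let ss v : s v * s v = N v. Proof. by rewrite -expr2 sqr_sqrtr// ltW. Qed.
Let n0R v l : 0 < (n v l)%:R :> R. Proof. by rewrite ltr0n. Qed.

Lemma pooled_size_large (A : R) : \forall v \near \oo, A <= N v.
Proof.
have [k hk] : exists k : nat, A <= k%:R.
  by exists (Num.truncn A).+1; exact/ltW/truncnS_gt.
have /hN kN : \forall m \near \oo, (k <= m)%N by exact: nbhs_infty_ge.
near=> v; apply: (le_trans hk); rewrite ler_nat; near: v.
exact: kN.
Unshelve. all: by end_near.
Qed.

Lemma sqrt_size_large (A : R) : \forall v \near \oo, A <= s v.
Proof.
have := pooled_size_large (A ^+ 2); apply: filterS => v hv.
apply: (le_trans (ler_norm A)); rewrite -sqrtr_sqr.
by rewrite ler_wsqrtr.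
Qed.

Lemma inv_size_cvg0 : (s v)^-1 @[v --> \oo] --> (0 : R).
Proof.
apply/cvgr0Pnorm_le => e e0.
have := sqrt_size_large e^-1; apply: filterS => v hv.
rewrite ger0_norm ?invr_ge0 ?(ltW (s0 v))//.
by rewrite -[leRHS]invrK lef_pV2 ?posrE ?invr_gt0.
Qed.

Lemma prob_sum1 : \sum_l p l 0 = 1.
Proof.
have h1 : \sum_(l : 'I_c) ((n v l)%:R / N v) @[v --> \oo] --> \sum_(l : 'I_c) p l 0.
  exact: (@cvg_sum_fin _ _ _ (fun l v => (n v l)%:R / N v)).
have h2 : \sum_(l : 'I_c) ((n v l)%:R / N v) @[v --> \oo] --> (1 : R).
  apply: cvg_near_cst; near=> v.
  by rewrite -mulr_suml -natr_pooled_size divff// gt_eqF.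
exact: (cvg_unique _ h1 h2).
Unshelve. all: by end_near. Qed.

(** With this factor, [p l * (fraction_scale v l * s * G) ^+ 2] is exactly
   [n l * G ^+ 2]: the weights of the limit replace those of the design at no
   cost. *)
Definition fraction_scale (v : nat) (l : 'I_c) : R :=
  Num.sqrt ((n v l)%:R / N v / p l 0).

Lemma fraction_scale_cvg1 l : fraction_scale v l @[v --> \oo] --> (1 : R).
Proof.
have h : (n v l)%:R / N v / p l 0 @[v --> \oo] --> p l 0 / p l 0.
  by apply: cvgM; [exact: hp|exact: cvg_cst].
rewrite divff ?gt_eqF// in h.
have -> : 1 = Num.sqrt 1 :> R by rewrite sqrtr1.
apply: (@continuous_cvg _ _ _ _ _ _ Num.sqrt); last exact: h.
exact: sqrt_continuous.
Qed.

Variable t : 'I_K * 'I_2 * 'I_c -> R.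

(** [sqrt N] times the coefficient of [cdf_score kr] for the observations of
   the [l']-th sample in the linear combination with weights [t]. *)
Definition omega (v : nat) (l' : 'I_c) (kr : KR) : R :=
  \sum_l t (kr, l) * fraction_scale v l * ((l' == l)%:R / ((n v l)%:R / N v) - 1).

Definition omega_lim (l' : 'I_c) (kr : KR) : R :=
  \sum_l t (kr, l) * ((l' == l)%:R / p l 0 - 1).

Lemma omega_cvg l' kr : omega v l' kr @[v --> \oo] --> omega_lim l' kr.
Proof.
apply: (@cvg_sum_fin _ _ _ (fun l v => t (kr, l) * fraction_scale v l *
  ((l' == l)%:R / ((n v l)%:R / N v) - 1))) => l.
apply: cvgM.
  have h := cvgM (cvg_cst (t (kr, l))) (fraction_scale_cvg1 l).
  by rewrite mulr1 in h; exact: h.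
apply: cvgB; last exact: cvg_cst.
apply: cvgM; first exact: cvg_cst.
by apply: cvgV; [rewrite gt_eqF|exact: hp].
Qed.

Lemma omegaE v l' kr : omega v l' kr / s v =
  \sum_l t (kr, l) * fraction_scale v l * contrast R (n v) l l'.
Proof.
rewrite mulr_suml; apply: eq_bigr => l _.
rewrite -mulrA; congr (_ * _); rewrite /contrast.
have E (a b e q : R) : 0 < a -> 0 < q -> a * a = b ->
    (e / (q / b) - 1) / a = a * (e / q - b^-1).
  by move=> a0 q0 <-; field; rewrite !gt_eqF.
exact: E (s0 v) (n0R v l) (ss v).
Qed.

Lemma shift_cvg0 l : delta l 0 / s v @[v --> \oo] --> (0 : R).
Proof.
have h := cvgM (cvg_cst (delta l 0)) inv_size_cvg0.
by rewrite mulr0 in h; exact: h.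
Qed.

(** The shift is of order [1 / s], so the first-order expansion of the mean score
   in the shift gives the limit of [s] times this mean. *)
Lemma moment1_cvg l (kr : KR) :
  s v * score_moment1 f (delta l 0 / s v) kr @[v --> \oo] -->
  - (beta_coef f kr.1.+1 kr.2 * delta l 0).
Proof.
apply/cvgrPdist_le => e e0.
have e1 : 0 < e / (`|delta l 0| + 1) by rewrite divr_gt0// ltr_wpDl.
have [eta eta0 heta] := score_mean_shift hf kr.2 (ltn0Sn kr.1) e1.
have /cvgr0Pnorm_le/(_ _ eta0) := shift_cvg0 l.
apply: filterS => v /heta hv.
rewrite /score_moment1 /cdf_score; set m := Rintegral _ _ _ in hv *.
rewrite (_ : _ - _ = - (s v * (m + beta_coef f kr.1.+1 kr.2 * (delta l 0 / s v)))).
  rewrite normrN normrM (gtr0_norm (s0 v)).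
  apply: (le_trans (ler_wpM2l (ltW (s0 v)) hv)).
  rewrite normrM (ger0_norm (x := (s v)^-1)) ?invr_ge0 ?(ltW (s0 v))//.
  rewrite [leLHS](_ : _ = e * (`|delta l 0| / (`|delta l 0| + 1))).
    by rewrite ler_piMr ?(ltW e0)// ler_pdivrMr ?ltr_wpDl// mul1r lerDl.
  by field; rewrite !gt_eqF// ltr_wpDl.
by field; rewrite gt_eqF.
Qed.

Lemma moment1_cvg0 l (kr : KR) :
  score_moment1 f (delta l 0 / s v) kr @[v --> \oo] --> (0 : R).
Proof.
have h := cvgM inv_size_cvg0 (@moment1_cvg l kr).
rewrite mul0r in h; have E v : (s v)^-1 * (s v * score_moment1 f (delta l 0 / s v) kr) =
    score_moment1 f (delta l 0 / s v) kr.
  by rewrite mulrA mulVf ?mul1r// gt_eqF.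
by under eq_fun do rewrite -E; exact: h.
Qed.

(** In the limit the shift disappears and the scores are orthonormal. *)
Lemma moment2_cvg l (kr kr' : KR) :
  score_moment2 f (delta l 0 / s v) kr kr' @[v --> \oo] --> ((kr == kr')%:R : R).
Proof.
have [B B0 hB] := density_window hf ler01.
pose u (x : R) := cdf_score f kr x * cdf_score f kr' x.
have bu : bdd_meas D0 u.
  by apply: bdd_meas_circle; apply: bdd_measM; exact: bdd_meas_cdf_score.
have limE : \int[mu]_(x in D0) (u x * f x) = (kr == kr')%:R.
  rewrite /u /cdf_score (integral_scoreM hf)//.
rewrite -limE; apply/cvgrPdist_le => e e0.
pose D := \int[mu]_(x in D0) `|u x|.
have D_ge0 : 0 <= D by apply: Rintegral_ge0.
have BD : 0 < B * D + 1 by rewrite ltr_wpDl// mulr_ge0.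
have e1 : 0 < Num.min 1 (e / (B * D + 1)) by rewrite lt_min ltr01 divr_gt0.
have /cvgr0Pnorm_le/(_ _ e1) := shift_cvg0 l.
apply: filterS => v; rewrite le_min => /andP[h1 h2].
rewrite distrC; apply: (le_trans (shift_integral_close hf ler01 hB h1 bu)).
rewrite -/D mulrAC mulrC; apply: (le_trans (ler_wpM2r (mulr_ge0 B0 D_ge0) h2)).
rewrite [leLHS](_ : _ = e * (B * D / (B * D + 1))).
  by rewrite ler_piMr ?(ltW e0)// ler_pdivrMr// mul1r lerDl.
by field; rewrite gt_eqF.
Qed.

(** The mean and the variance of the linear combination with weights [t] of the
   limit vectors, in the form in which they come out of the limits. *)
Definition limit_location : R :=
  \sum_l p l 0 * \sum_(kr : KR) omega_lim l kr * - (beta_coef f kr.1.+1 kr.2 * delta l 0).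

Definition limit_variance : R := \sum_l p l 0 * \sum_(kr : KR) omega_lim l kr ^+ 2.

Definition location (v : nat) : R := \sum_l (n v l)%:R *
  \sum_(kr : KR) omega v l kr / s v * score_moment1 f (delta l 0 / s v) kr.

Definition variance_sum (v : nat) : R := \sum_l (n v l)%:R *
  \sum_(kr : KR) \sum_(kr' : KR) omega v l kr / s v * (omega v l kr' / s v) *
    (score_moment2 f (delta l 0 / s v) kr kr' -
     score_moment1 f (delta l 0 / s v) kr * score_moment1 f (delta l 0 / s v) kr').

Let rescale1 v (a b : R) : a / s v * b = (N v)^-1 * (a * (s v * b)).
Proof.
have E (u x : R) : 0 < u -> u * u = x -> a / u * b = x^-1 * (a * (u * b)).
  by move=> u0 <-; field; rewrite gt_eqF.
exact: E (s0 v) (ss v).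
Qed.

Let rescale2 v (a b x : R) : a / s v * (b / s v) * x = (N v)^-1 * (a * b * x).
Proof.
have E (u y : R) : 0 < u -> u * u = y -> a / u * (b / u) * x = y^-1 * (a * b * x).
  by move=> u0 <-; field; rewrite gt_eqF.
exact: E (s0 v) (ss v).
Qed.

Lemma location_cvg : location v @[v --> \oo] --> limit_location.
Proof.
apply: (@cvg_sum_fin _ _ _ (fun l v => (n v l)%:R *
  \sum_(kr : KR) omega v l kr / s v * score_moment1 f (delta l 0 / s v) kr)) => l.
have -> : (fun v => (n v l)%:R *
    \sum_(kr : KR) omega v l kr / s v * score_moment1 f (delta l 0 / s v) kr) =
  fun v => (n v l)%:R / N v *
    \sum_(kr : KR) omega v l kr * (s v * score_moment1 f (delta l 0 / s v) kr).
  apply/funext => v; rewrite -mulrA; congr (_ * _); rewrite mulr_sumr.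
  by apply: eq_bigr => kr _; exact: rescale1.
apply: cvgM; first exact: hp.
apply: (@cvg_sum_fin _ _ _ (fun kr v =>
  omega v l kr * (s v * score_moment1 f (delta l 0 / s v) kr))) => kr.
by apply: cvgM; [exact: omega_cvg|exact: moment1_cvg].
Qed.

Lemma variance_sum_cvg : variance_sum v @[v --> \oo] --> limit_variance.
Proof.
have limE : limit_variance = \sum_l p l 0 * \sum_(kr : KR) \sum_(kr' : KR)
    omega_lim l kr * omega_lim l kr' * ((kr == kr')%:R - 0 * 0).
  apply: eq_bigr => l _; congr (_ * _); apply: eq_bigr => kr _.
  rewrite (bigD1 kr)//= eqxx mulr0 subr0 mulr1 big1 ?addr0//.
  by move=> kr' /negbTE; rewrite eq_sym => ->; rewrite subrr mulr0.
rewrite limE.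
apply: (@cvg_sum_fin _ _ _ (fun l v => (n v l)%:R *
  \sum_(kr : KR) \sum_(kr' : KR) omega v l kr / s v * (omega v l kr' / s v) *
    (score_moment2 f (delta l 0 / s v) kr kr' -
     score_moment1 f (delta l 0 / s v) kr * score_moment1 f (delta l 0 / s v) kr'))) => l.
pose g (kr kr' : KR) v := omega v l kr * omega v l kr' *
    (score_moment2 f (delta l 0 / s v) kr kr' -
     score_moment1 f (delta l 0 / s v) kr * score_moment1 f (delta l 0 / s v) kr').
rewrite (_ : (fun v => _) = fun v => (n v l)%:R / N v * \sum_kr \sum_kr' g kr kr' v).
  apply: cvgM; first exact: hp.
  apply: (@cvg_sum_fin _ _ _ (fun kr v => \sum_kr' g kr kr' v)) => kr.
  apply: (@cvg_sum_fin _ _ _ (fun kr' v => g kr kr' v)) => kr'.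
  apply: cvgM; first by apply: cvgM; exact: omega_cvg.
  by apply: cvgB; [exact: moment2_cvg|apply: cvgM; exact: moment1_cvg0].
apply/funext => v; rewrite -mulrA; congr (_ * _); rewrite mulr_sumr.
apply: eq_bigr => kr _; rewrite mulr_sumr; apply: eq_bigr => kr' _.
exact: rescale2.
Qed.

End numeric_limits.

(** * Mean scores under the local alternatives *)

Lemma cvg_of_close (R : realType) (u g : nat -> R) (a : R) :
  u v - g v @[v --> \oo] --> (0 : R) -> g v @[v --> \oo] --> a -> u v @[v --> \oo] --> a.
Proof.
move=> hd hg; have h := cvgD hd hg; rewrite add0r in h.
have -> : u = fun v => u v - g v + g v by apply/funext => v; rewrite subrK.
exact: h.
Qed.

Section score_mean_measurable.
Context (R : realType) (c : nat) (n : 'I_c -> nat).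
Context d (T : measurableType d) (P : probability T R).
Variable Theta : forall l : 'I_c, 'I_(n l) -> {RV P >-> R}.
Hypothesis N0 : (0 < pooled_size n)%N.

Lemma bdd_meas_score_mean k r l :
  bdd_meas setT (fun w => score_mean (fun l (i : 'I_(n l)) => Theta i w) k r l).
Proof.
have s0 : (0 : R) < Num.sqrt (pooled_size n)%:R by rewrite sqrtr_gt0 ltr0n.
pose s : R := Num.sqrt (pooled_size n)%:R.
rewrite (_ : (fun w => _) = fun w => s^-1 * (s *
    score_mean (fun l (i : 'I_(n l)) => Theta i w) k r l)); last first.
  by apply/funext => w; rewrite mulKf// gt_eqF.
apply: bdd_measZ; under eq_fun do rewrite (score_mean_pooled N0).
apply: (@bdd_meas_sum _ _ _ _ _ _ _ (fun j w => (contrast R n l (tag j) + s^-1) *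
    score k r ((\sum_(j' : {l : 'I_c & 'I_(n l)})
      (Theta (tagged j') w <= Theta (tagged j) w)%R)%:R / (pooled_size n)%:R))) => j.
apply: bdd_measZ.
pose rank w : R := (\sum_(j' : {l : 'I_c & 'I_(n l)})
      (Theta (tagged j') w <= Theta (tagged j) w)%R)%:R / (pooled_size n)%:R.
suff mr : measurable_fun setT rank.
  exact: (bdd_meas_comp (X := rank) mr (score_bdd_meas R k r)).
rewrite /rank.
apply: measurable_funM => //; under eq_fun do rewrite natr_sum.
apply: (@measurable_sum _ _ _ _ _ _ (fun j' w =>
  (Theta (tagged j') w <= Theta (tagged j) w)%R%:R)) => j'.
apply: (measurableT_comp (f := fun b : bool => b%:R : R)) => //.
exact: measurable_fun_ler.
Qed.

End score_mean_measurable.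

Section local_alternatives.
Variables (R : realType) (c K : nat) (n : nat -> 'I_c -> nat).
Variables (f : R -> R) (delta p : 'cV[R]_c).
Hypothesis hf : C1_circular_density f.
Hypothesis hN : pooled_size (n v) @[v --> \oo] --> \oo.
Hypothesis n0 : forall v l, (0 < n v l)%N.
Hypothesis N0 : forall v, (0 < pooled_size (n v))%N.
Hypothesis p0 : forall l, 0 < p l 0.
Hypothesis hp : forall l,
  (n v l)%:R / (pooled_size (n v))%:R @[v --> \oo] --> p l 0.

Notation KR := ('I_K * 'I_2)%type.
Local Notation N v := ((pooled_size (n v))%:R : R).
Local Notation s v := (Num.sqrt (N v)).

Variables (d : nat -> measure_display) (T : forall v, measurableType (d v)).
Variables (P : forall v, probability (T v) R).
Variable Theta : forall v (l : 'I_c), 'I_(n v l) -> {RV (P v) >-> R}.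
Arguments Theta : clear implicits.
Hypothesis hTheta : forall v l (i : 'I_(n v l)),
    has_circular_density (Theta v l i)
      (fun x => f (x + delta l 0 / s v)).
Hypothesis hindep : forall v, mutually_independent
    (fun j : {l : 'I_c & 'I_(n v l)} => Theta v (tag j) (tagged j)).

Let N0R v : 0 < N v. Proof. by rewrite ltr0n. Qed.
Let s0 v : 0 < s v. Proof. by rewrite sqrtr_gt0. Qed.
Let n0R v l : 0 < (n v l)%:R :> R. Proof. by rewrite ltr0n. Qed.

Let mean v k r l (w : T v) : R := score_mean (fun l i => Theta v l i w) k r l.
Let linear v k r l (w : T v) : R := linear_stat (Theta v) f k r l w.

Let H : R := \sum_l `|delta l 0|.
Let H0 : 0 <= H. Proof. exact: sumr_ge0. Qed.
Let hdelta l : `|delta l 0| <= H.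
Proof. by rewrite /H (bigD1 l)//= lerDl sumr_ge0. Qed.

(** A mesh of [s / e] cells makes each of the three terms in the error of the
   linearization at most [e], for [s] large. *)
Lemma mesh_choice (e : R) : 0 < e -> \forall v \near \oo, exists2 M : nat,
  (0 < M)%N & [/\ s v / M%:R <= e, (s v)^-1 <= e & Num.sqrt M%:R / s v <= e].
Proof.
move=> e0; near=> v.
have a0 := s0 v; have ai0 : 0 < (s v)^-1 by rewrite invr_gt0.
have h1 : 1 <= s v by near: v; exact: (sqrt_size_large hN).
have h2 : e^-1 <= s v by near: v; exact: (sqrt_size_large hN).
have h3 : (e ^+ 2 / 2)^-1 <= s v by near: v; exact: (sqrt_size_large hN).
have h4 : (e ^+ 3 / 2)^-1 <= s v by near: v; exact: (sqrt_size_large hN).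
exists (Num.truncn (s v / e)).+1 => //.
have M1 : s v / e <= (Num.truncn (s v / e)).+1%:R by exact/ltW/truncnS_gt.
have M2 : (Num.truncn (s v / e)).+1%:R <= s v / e + 1.
  by rewrite -natr1 lerD2r truncn_le// divr_ge0 ?(ltW e0)// ltW.
have := M1; have := M2; move: (Num.truncn _).+1 => M M2' M1'.
have M0 : (0 : R) < M%:R by apply: lt_le_trans M1'; rewrite divr_gt0.
have inv_le x : 0 < x -> x^-1 <= s v -> (s v)^-1 <= x.
  by move=> x0 xs; rewrite -[leRHS]invrK lef_pV2 ?posrE// invr_gt0.
split; first by rewrite ler_pdivrMr// mulrC -ler_pdivrMr.
  exact: inv_le.
have k3 := inv_le _ (divr_gt0 (exprn_gt0 2 e0) (ltr0Sn _ 1)) h3.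
have k4 := inv_le _ (divr_gt0 (exprn_gt0 3 e0) (ltr0Sn _ 1)) h4.
rewrite ler_pdivrMr//; have es0 : 0 <= e * s v by rewrite mulr_ge0// ltW.
rewrite -[leRHS](ger0_norm es0) -sqrtr_sqr ler_wsqrtr//.
apply: (le_trans M2').
have -> : s v / e + 1 = ((s v)^-1 / e + (s v)^-1 * (s v)^-1) * s v ^+ 2.
  by move: (s v) a0 => a a0; field; rewrite !gt_eqF.
rewrite exprMn ler_pM2r ?exprn_gt0//.
have k5 : (s v)^-1 / e <= e ^+ 2 / 2.
  rewrite ler_pdivrMr//; apply: (le_trans k4); rewrite [leRHS](_ : _ = e ^+ 3 / 2)//.
  by ring.
have k6 : (s v)^-1 * (s v)^-1 <= e ^+ 2 / 2.
  by apply: le_trans k3; rewrite ler_piMr ?(ltW ai0)// invf_le1.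
by rewrite (splitr (e ^+ 2)) lerD.
Unshelve. all: by end_near. Qed.

(** The bound at a fixed design has constants that depend on the design only
   through [N / n l], which converges. *)
Lemma linear_stat_cvg0 (k : nat) r l : (0 < k)%N ->
  \int[P v]_w `|s v * mean k r l w - linear k r l w| @[v --> \oo] --> (0 : R).
Proof.
move=> k0.
have [B B0 hB] := density_window hf H0.
set A : R := (p l 0)^-1 + 2.
have hA : \forall v \near \oo, N v / (n v l)%:R + 1 <= A.
  have pn0 : p l 0 != 0 by rewrite gt_eqF.
  have hV : ((n v l)%:R / N v)^-1 @[v --> \oo] --> (p l 0)^-1 by apply: cvgV; [|exact: hp].
  move/cvgrPdist_le/(_ _ ltr01): hV.
  apply: filterS => v; rewrite /= invf_div ler_norml => /andP[h _].
  by move: h; rewrite /A; move: (N v / _) (p l 0)^-1 => a b; lra.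
pose C : R := 2 * pi * B * (1 + H).
pose c1 : R := 2 * (A + 2) * score_lip R k * C ^+ 2 + A * score_lip R k * C.
pose c2 : R := 2 * (A + 2) * score_lip R k * C + A * score_lip R k * C * (2 + 2 * C ^+ 2) +
   score_lip R k * A * C * (2 + 2 * C ^+ 2 + 1).
pose c3 : R := A * score_lip R k * (C + (2 + 2 * C ^+ 2)) +
   score_lip R k * (A ^+ 2 * C + (2 + 2 * C ^+ 2)).
pose D : R := `|c1| + `|c2| + `|c3| + 1.
have D0 : 0 < D by rewrite ltr_wpDl// !addr_ge0.
apply/cvgr0Pnorm_le => e e0.
have e1 : 0 < e / D by rewrite divr_gt0.
near=> v.
have [M M0 [h1 h2 h3]] : exists2 M : nat, (0 < M)%N &
  [/\ s v / M%:R <= e / D, (s v)^-1 <= e / D & Num.sqrt M%:R / s v <= e / D].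
  by near: v; exact: mesh_choice.
have hAv : N v / (n v l)%:R + 1 <= A by near: v.
rewrite ger0_norm; last by apply: Rintegral_ge0.
have := linear_stat_close (n0 v) (N0 v) hf (hTheta (v := v)) (@hindep v) H0 B0 hB hdelta r k0 M0 hAv.
rewrite -/C -/c1 -/c2 -/c3 => /le_trans; apply.
have bound (a x : R) : 0 <= x -> x <= e / D -> a * x <= `|a| * (e / D).
  move=> x0 xe; apply: (le_trans (ler_wpM2r x0 (ler_norm a))).
  by rewrite ler_wpM2l.
apply: (@le_trans _ _ (`|c1| * (e / D) + `|c2| * (e / D) + `|c3| * (e / D))).
  by rewrite !lerD// bound// ?divr_ge0 ?invr_ge0 ?sqrtr_ge0.
rewrite [leRHS](_ : e = D * (e / D)); last by rewrite mulrC divfK// gt_eqF.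
by rewrite -!mulrDl ler_pM2r// /D lerDl.
Unshelve. all: by end_near. Qed.

(** The statistic is one function, the same for all designs, of these
   variables. *)
Definition scaled_mean v (i : KR * 'I_c) (w : T v) : R :=
  fraction_scale n p v i.2 * (s v * mean i.1.1.+1 i.1.2 i.2 w).

Definition scaled_linear v (i : KR * 'I_c) (w : T v) : R :=
  fraction_scale n p v i.2 * linear i.1.1.+1 i.1.2 i.2 w.

Let bdd_meas_linear v k r l : bdd_meas [set: T v] (linear k r l).
Proof.
apply: (@bdd_meas_sum _ _ _ _ _ _ _ (fun j w => contrast R (n v) l (tag j) *
  score k r (circular_cdf f (Theta v (tag j) (tagged j) w)))) => j.
apply: bdd_measZ.
exact: (bdd_meas_comp (X := Theta v (tag j) (tagged j)) _ (bdd_meas_score_cdf hf k r)).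
Qed.

Lemma bdd_meas_scaled_mean v i : bdd_meas [set: T v] (scaled_mean i).
Proof. exact/bdd_measZ/bdd_measZ/bdd_meas_score_mean. Qed.

Lemma bdd_meas_scaled_linear v i : bdd_meas [set: T v] (scaled_linear i).
Proof. exact: bdd_measZ. Qed.

Lemma scaled_close i :
  \int[P v]_w `|scaled_mean i w - scaled_linear i w| @[v --> \oo] --> (0 : R).
Proof.
have E v : \int[P v]_w `|scaled_mean i w - scaled_linear i w| = fraction_scale n p v i.2 *
    \int[P v]_w `|s v * mean i.1.1.+1 i.1.2 i.2 w - linear i.1.1.+1 i.1.2 i.2 w|.
  rewrite -(bintZ measurableT (probability_finite _)); last first.
    apply/bdd_meas_norm/bdd_measB; last exact: bdd_meas_linear.
    exact/bdd_measZ/bdd_meas_score_mean.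
  apply: eq_Rintegral => w _.
  by rewrite /scaled_mean /scaled_linear -mulrBr normrM ger0_norm ?sqrtr_ge0.
under eq_fun do rewrite E.
have h := cvgM (fraction_scale_cvg1 p0 hp i.2) (linear_stat_cvg0 i.1.2 i.2 (ltn0Sn i.1.1)).
by rewrite mulr0 in h; exact: h.
Qed.

(** Exchanging the sums exhibits a sum of independent variables, to which the
   central limit theorem applies. *)
Lemma scaled_linear_comb (t : KR * 'I_c -> R) v (w : T v) : \sum_i t i * scaled_linear i w =
  \sum_(j : {l : 'I_c & 'I_(n v l)}) \sum_(kr : KR)
    omega n p t v (tag j) kr / s v * cdf_score f kr (Theta v (tag j) (tagged j) w).
Proof.
under eq_bigr do rewrite /scaled_linear /linear /linear_stat mulrA mulr_sumr.
rewrite exchange_big; apply: eq_bigr => j _.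
under [RHS]eq_bigr do rewrite (omegaE p n0 N0) mulr_suml.
by rewrite pair_bigA; apply: eq_bigr => -[[k r] l] _; rewrite mulrA.
Qed.

Lemma omega_bounded (t : KR * 'I_c -> R) : exists2 Kb : R, 0 <= Kb &
  \forall v \near \oo, forall l kr, `|omega n p t v l kr| <= Kb.
Proof.
pose L := \sum_(i : 'I_c * KR) `|omega_lim p t i.1 i.2|.
exists (L + 1); first by rewrite addr_ge0// sumr_ge0.
have hi : \forall v \near \oo, forall i : 'I_c * KR, `|omega n p t v i.1 i.2| <= L + 1.
  apply: filter_forall => -[l kr].
  have /cvgrPdist_le/(_ _ ltr01) := @omega_cvg _ _ _ _ _ p0 hp t l kr.
  apply: filterS => v /= h.
  apply: (@le_trans _ _ (`|omega_lim p t l kr| + 1)).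
    rewrite addrC -lerBlDr; apply: le_trans h; rewrite distrC; exact: lerB_dist.
  rewrite lerD2r /L (bigD1 (l, kr))//= lerDl; exact: sumr_ge0.
by apply: filterS hi => v h l kr; exact: (h (l, kr)).
Qed.

Let Ec (Kb : R) : R := 2 * (Num.sqrt 2 * Kb * #|{: KR}|%:R).

Lemma linear_cos_cvg b (t : KR * 'I_c -> R) :
  \int[P v]_w cos (b + \sum_i t i * scaled_linear i w) @[v --> \oo] -->
  expR (- (limit_variance p t / 2)) * cos (b + limit_location f delta p t).
Proof.
have [B B0 hB] := density_window hf H0.
have [Kb Kb0 hK] := omega_bounded t.
pose g v : R := expR (- (variance_sum n f delta p t v / 2)) * cos (b + location n f delta p t v).
have hg : g v @[v --> \oo] -->
    expR (- (limit_variance p t / 2)) * cos (b + limit_location f delta p t).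
  apply: cvgM.
    apply: continuous_cvg; first exact: continuous_expR.
    apply: cvgN; apply: cvgM; last exact: cvg_cst.
    exact: (variance_sum_cvg _ hf hN N0 p0 hp).
  apply: continuous_cvg; first exact: continuous_cos.
  apply: cvgD; first exact: cvg_cst.
  exact: (location_cvg hf hN N0 p0 hp).
suff hd : \int[P v]_w cos (b + \sum_i t i * scaled_linear i w) - g v @[v --> \oo] --> (0 : R).
  exact: cvg_of_close hd hg.
apply/cvgr0Pnorm_le => e e0; near=> v.
have hKv : forall l kr, `|omega n p t v l kr| <= Kb by near: v.
have h1 : Ec Kb <= s v by near: v; exact: (sqrt_size_large hN).
have h2 : 6 * Ec Kb ^+ 3 / e <= s v by near: v; exact: (sqrt_size_large hN).
have kappa_le l kr : `|omega n p t v l kr / s v| <= Kb / s v.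
  by rewrite normrM (ger0_norm (x := (s v)^-1)) ?invr_ge0 ?(ltW (s0 v))// ler_pM2r ?invr_gt0.
have Bv1 : 2 * (Num.sqrt 2 * Kb * #|{: KR}|%:R / s v) <= 1.
  by rewrite mulrA ler_pdivrMr// mul1r.
have := linear_clt (N0 v) hf (hTheta (v := v)) (@hindep v) H0 hB hdelta kappa_le b Bv1.
cbv beta; under eq_Rintegral do rewrite -scaled_linear_comb.
move=> /le_trans; apply.
rewrite mulrA -/(Ec Kb) [leLHS](_ : _ = 6 * Ec Kb ^+ 3 / s v).
  by rewrite ler_pdivrMr// [leRHS]mulrC -ler_pdivrMr.
have E (a y x : R) : 0 < a -> a * a = y -> 6 * (x / a) ^+ 3 * y = 6 * x ^+ 3 / a.
  by move=> a0 <-; field; rewrite gt_eqF.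
by apply: E => //; rewrite -expr2 sqr_sqrtr// ltW.
Unshelve. all: by end_near. Qed.

(** Convergence of the characteristic functions: the cosine is Lipschitz, so the
   linearization costs at most its error in mean. *)
Lemma scaled_mean_cos_cvg b (t : KR * 'I_c -> R) :
  \int[P v]_w cos (b + \sum_i t i * scaled_mean i w) @[v --> \oo] -->
  expR (- (limit_variance p t / 2)) * cos (b + limit_location f delta p t).
Proof.
have cos_lip x y : `|cos x - cos y| <= `|x - y| :> R.
  rewrite -[leRHS]mul1r; apply: (mean_value_le (df := fun z => - sin z)) => z _.
  by rewrite normrN sin_max.
have bX v := @bdd_meas_scaled_mean v.
have bU v := @bdd_meas_scaled_linear v.
suff hd : \int[P v]_w cos (b + \sum_i t i * scaled_mean i w) -
    \int[P v]_w cos (b + \sum_i t i * scaled_linear i w) @[v --> \oo] --> (0 : R).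
  apply: (cvg_of_close (g := fun v => \int[P v]_w cos (b + \sum_i t i * scaled_linear i w))).
    exact: hd.
  exact: linear_cos_cvg.
have hs : \sum_i `|t i| * \int[P v]_w `|scaled_mean i w - scaled_linear i w| @[v --> \oo] -->
    \sum_i `|t i| * (0 : R).
  apply: (@cvg_sum_fin _ _ _ (fun i v =>
    `|t i| * \int[P v]_w `|scaled_mean i w - scaled_linear i w|)) => i.
  by apply: cvgM; [exact: cvg_cst|exact: scaled_close].
rewrite big1 in hs; last by move=> i _; rewrite mulr0.
apply/cvgr0Pnorm_le => e e0; move/cvgr0Pnorm_le/(_ _ e0): hs.
apply: filterS => v; set S := \sum_i _ => hS.
apply: (le_trans _ (le_trans (ler_norm S) hS)).
have pf := probability_finite (P v).
have mcomb (X : KR * 'I_c -> T v -> R) : (forall i, bdd_meas setT (X i)) ->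
    bdd_meas setT (fun w => cos (b + \sum_i t i * X i w)).
  move=> bx; apply: bdd_meas_cos; apply: measurable_funD => //.
  apply: (@measurable_sum _ _ _ _ _ _ (fun i w => t i * X i w)) => i.
  by apply: measurable_funM => //; exact: (bx i).1.
have b1 := mcomb _ (bX v); have b2 := mcomb _ (bU v).
have b3 i : bdd_meas [set: T v] (fun w => `|scaled_mean i w - scaled_linear i w|).
  exact/bdd_meas_norm/bdd_measB.
have b4 : bdd_meas [set: T v] (fun w => \sum_i `|t i| * `|scaled_mean i w - scaled_linear i w|).
  apply: (@bdd_meas_sum _ _ _ _ _ _ _ (fun i w =>
    `|t i| * `|scaled_mean i w - scaled_linear i w|)) => i; exact: bdd_measZ.
rewrite -(bintB measurableT pf b1 b2).
apply: (le_trans (bint_norm measurableT pf (bdd_measB b1 b2))).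
rewrite (_ : S = \int[P v]_w \sum_i `|t i| * `|scaled_mean i w - scaled_linear i w|).
  apply: le_bint => //; first exact/bdd_meas_norm/bdd_measB.
  move=> w _; apply: (le_trans (cos_lip _ _)).
  rewrite opprD addrACA subrr add0r -sumrB; apply: (le_trans (ler_norm_sum _ _ _)).
  by apply: ler_sum => i _; rewrite -mulrBr normrM.
rewrite (@bint_sum _ _ _ _ _ measurableT pf _ _ _ (fun i w =>
    `|t i| * `|scaled_mean i w - scaled_linear i w|)); last by move=> i; exact: bdd_measZ.
by apply: eq_bigr => i _; rewrite (bintZ measurableT pf).
Qed.

(** The moment bound for a single linearized mean is the case where [t] is the
   indicator of its index. *)
Lemma scaled_mean_tight : exists C : R, \forall v \near \oo,
  forall i, \int[P v]_w `|scaled_mean i w| <= C.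
Proof.
have [B B0 hB] := density_window hf H0.
have each i : exists C : R, 0 <= C /\
    \forall v \near \oo, \int[P v]_w `|scaled_mean i w| <= C.
  pose t (i' : KR * 'I_c) : R := (i' == i)%:R.
  have [Kb Kb0 hK] := omega_bounded t.
  exists (1 + (1 + (Ec Kb / 2) ^+ 2 + (`|limit_location f delta p t| + 1))); split.
    by rewrite !addr_ge0// sqr_ge0.
  have tE v (w : T v) : \sum_i t i * scaled_linear i w = scaled_linear i w.
    rewrite (bigD1 i)//= /t eqxx mul1r big1 ?addr0// => i' /negbTE ->.
    by rewrite mul0r.
  have hl := @location_cvg _ _ _ _ _ delta _ hf hN N0 p0 hp t.
  have hc := scaled_close i.
  near=> v.
  have hKv : forall l kr, `|omega n p t v l kr| <= Kb by near: v.
  have kappa_le l kr : `|omega n p t v l kr / s v| <= Kb / s v.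
    by rewrite normrM (ger0_norm (x := (s v)^-1)) ?invr_ge0 ?(ltW (s0 v))// ler_pM2r ?invr_gt0.
  have pf := probability_finite (P v).
  have bX := @bdd_meas_scaled_mean v i.
  have bU := @bdd_meas_scaled_linear v i.
  have bXU := bdd_meas_norm (bdd_measB bX bU).
  apply: (@le_trans _ _ (\int[P v]_w `|scaled_mean i w - scaled_linear i w| +
      \int[P v]_w `|scaled_linear i w|)).
    rewrite -(bintD measurableT pf bXU (bdd_meas_norm bU)).
    apply: le_bint => //; [exact: bdd_meas_norm|exact/bdd_measD/bdd_meas_norm|].
    by move=> w _; rewrite -[X in `|X| <= _](subrK (scaled_linear i w)) ler_normD.
  apply: lerD.
    apply: (le_trans (ler_norm _)); near: v.
    by move/cvgr0Pnorm_le: hc; apply.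
  have := linear_moment (N0 v) hf (hTheta (v := v)) (@hindep v) H0 hB hdelta kappa_le.
  cbv beta; under eq_Rintegral do rewrite -scaled_linear_comb tE.
  move=> /le_trans; apply; apply: lerD.
    rewrite lerD2l mulrA -/(Ec Kb).
    have E (a y x : R) : 0 < a -> a * a = y -> y * (x / a / 2) ^+ 2 = (x / 2) ^+ 2.
      by move=> a0 <-; field; rewrite gt_eqF.
    by rewrite (E (s v))// -expr2 sqr_sqrtr// ltW.
  rewrite -/(location n f delta p t v).
  have h : `|limit_location f delta p t - location n f delta p t v| <= 1.
    by near: v; move/cvgrPdist_le: hl; apply.
  rewrite addrC -lerBlDr; apply: le_trans h; rewrite distrC; exact: lerB_dist.
have [C hC] := @choice _ _ _ each.
exists (\sum_i C i); apply: filter_forall => i.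
apply: filterS (hC i).2 => v /le_trans; apply.
rewrite (bigD1 i)//= lerDl sumr_ge0// => i' _; exact: (hC i').1.
Unshelve. all: by end_near. Qed.

End local_alternatives.

(** * The Gaussian limit *)

Section gaussian_limit.
Variables (R : realType) (c K : nat) (f : R -> R) (delta p : 'cV[R]_c).
Hypothesis p0 : forall l, 0 < p l 0.
Hypothesis p1 : \sum_l p l 0 = 1.

Notation KR := ('I_K * 'I_2)%type.

Section forms.
Variable t : KR * 'I_c -> R.
Let tcol kr : 'cV[R]_c := \col_l t (kr, l).

Lemma omega_limE l' kr : omega_lim p t l' kr = t (kr, l') / p l' 0 - \sum_l t (kr, l).
Proof.
rewrite /omega_lim; under eq_bigr do rewrite mulrBr mulr1.
rewrite sumrB (bigD1 l')//= eqxx mul1r big1 ?addr0// => l /negbTE ll'.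
by rewrite eq_sym ll' mul0r mulr0.
Qed.

Lemma limit_cov_form (x : 'cV[R]_c) : (x^T *m limit_cov p *m x) 0 0 =
  \sum_l x l 0 ^+ 2 / p l 0 - (\sum_l x l 0) ^+ 2.
Proof.
rewrite /limit_cov mulmxBr mulmxBl [LHS]mxE [X in _ + X]mxE; congr (_ - _).
  rewrite mxE; apply: eq_bigr => l _.
  by rewrite mul_mx_diag !mxE; ring.
rewrite mulmxA -mulmxA mxE big_ord1 !mxE expr2.
by congr (_ * _); apply: eq_bigr => l _; rewrite !mxE ?mulr1 ?mul1r.
Qed.

Lemma limit_mean_form (x : 'cV[R]_c) k r : (x^T *m limit_mean p delta f k r) 0 0 =
  beta_coef f k r * (\sum_l x l 0 * (\sum_l' p l' 0 * delta l' 0 - delta l 0)).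
Proof.
rewrite mxE mulr_sumr; apply: eq_bigr => l _; rewrite !mxE mulrCA; congr (_ * (_ * _)).
under eq_bigr do rewrite !mxE mulrBl.
rewrite sumrB; congr (_ - _); rewrite (bigD1 l)//= !eqxx mul1r big1 ?addr0//.
by move=> l' /negbTE ->; rewrite mul0r.
Qed.

(** The covariance of the limit vectors is that of a multinomial sample: with
   [S] the sum of the [t (kr, l)], both sides are
   [\sum_l t (kr, l) ^+ 2 / p l - S ^+ 2], using [\sum_l p l = 1]. *)
Lemma limit_varianceE :
  limit_variance p t = \sum_kr ((tcol kr)^T *m limit_cov p *m tcol kr) 0 0.
Proof.
rewrite /limit_variance; under eq_bigr do rewrite mulr_sumr.
rewrite exchange_big; apply: eq_bigr => kr _; rewrite limit_cov_form.
under eq_bigr do rewrite omega_limE.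
under [X in _ = X - _]eq_bigr do rewrite mxE.
under [X in _ = _ - X ^+ 2]eq_bigr do rewrite mxE.
set S := \sum_l t (kr, l).
transitivity (\sum_l (t (kr, l) ^+ 2 / p l 0 - 2 * S * t (kr, l) + S ^+ 2 * p l 0)).
  by apply: eq_bigr => l _; field; rewrite gt_eqF.
rewrite big_split sumrB /= -mulr_sumr -mulr_sumr p1 -/S; ring.
Qed.

Lemma limit_locationE : limit_location f delta p t =
  \sum_(kr : KR) ((tcol kr)^T *m limit_mean p delta f kr.1.+1 kr.2) 0 0.
Proof.
rewrite /limit_location; under eq_bigr do rewrite mulr_sumr.
rewrite exchange_big; apply: eq_bigr => kr _; rewrite limit_mean_form.
under eq_bigr do rewrite omega_limE.
under [X in _ = _ * X]eq_bigr do rewrite mxE.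
set S := \sum_l t (kr, l); set D := \sum_l p l 0 * delta l 0.
set be := beta_coef _ _ _.
transitivity (\sum_l (be * S * (p l 0 * delta l 0) - be * (t (kr, l) * delta l 0))).
  by apply: eq_bigr => l _; field; rewrite gt_eqF.
under [X in _ = _ * X]eq_bigr do rewrite mulrBr.
by rewrite !sumrB -!mulr_sumr -mulr_suml -/S -/D; ring.
Qed.

End forms.

Variables (d' : measure_display) (T' : measurableType d') (Q : probability T' R).
Variable Z : 'I_K -> 'I_2 -> {RV Q >-> c.-tuple R}.
Hypothesis hZ : forall k r,
  multinormal (Z k r) (limit_mean p delta f k.+1 r) (limit_cov p).
Hypothesis hZindep : mutually_independent (fun kr : 'I_K * 'I_2 => Z kr.1 kr.2).

Lemma measurable_coord k r l : measurable_fun setT (fun w => tnth (Z k r w) l).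
Proof.
by apply: (measurableT_comp (f := fun z : c.-tuple R => tnth z l)) => //; exact: measurable_tnth.
Qed.

(** Multinormality gives the law of a combination of the coordinates of one
   vector; the independence of the vectors gives their sum, the errors in
   [cos_sum_close] being zero. *)
Lemma gaussian_cos b (t : KR * 'I_c -> R) :
  \int[Q]_w cos (b + \sum_i t i * tnth (Z i.1.1 i.1.2 w) i.2) =
  expR (- (limit_variance p t / 2)) * cos (b + limit_location f delta p t).
Proof.
pose tcol kr : 'cV[R]_c := \col_l t (kr, l).
pose y (kr : KR) (z : c.-tuple R) := \sum_l tcol kr l 0 * tnth z l.
pose V kr := ((tcol kr)^T *m limit_cov p *m tcol kr) 0 0.
pose L (kr : KR) := ((tcol kr)^T *m limit_mean p delta f kr.1.+1 kr.2) 0 0.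
have my kr : measurable_fun setT (y kr).
  apply: (@measurable_sum _ _ _ _ _ _ (fun l z => tcol kr l 0 * tnth z l)) => l.
  by apply: measurable_funM => //; exact: measurable_tnth.
have V0 kr : 0 <= V kr by exact: (hZ kr.1 kr.2 (tcol kr)).1.
have myZ (kr : KR) : measurable_fun setT (fun w => y kr (Z kr.1 kr.2 w)).
  exact: measurableT_comp.
have one (kr : KR) b' : `|\int[Q]_w cos (b' + y kr (Z kr.1 kr.2 w)) -
    expR (- (V kr / 2)) * cos (b' + L kr)| <= 0.
  rewrite (@gaussian_law_cos _ _ _ _ (fun w => y kr (Z kr.1 kr.2 w)) (L kr) (V kr))//.
    by rewrite subrr normr0.
  exact: (hZ kr.1 kr.2 (tcol kr)).2.
have r01 kr : 0 <= expR (- (V kr / 2)) <= 1.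
  by rewrite expR_ge0 -[leRHS]expR0 ler_expR oppr_le0 divr_ge0.
have := @cos_sum_close _ _ _ _ _ _ _ _ hZindep y my (index_enum _) _ L (fun=> 0)
  (index_enum_uniq _) r01 one b.
rewrite big1_eq mulr0 normr_le0 subr_eq0 => /eqP.
rewrite -expR_sum sumrN -mulr_suml -limit_varianceE -limit_locationE => <-.
apply: eq_Rintegral => w _; congr cos; congr (_ + _).
rewrite /y pair_bigA; apply: eq_bigr => -[[k r] l] _; by rewrite mxE.
Qed.

End gaussian_limit.

(** * Lipschitz functions of the squared mean scores *)

Section lipschitz.
Variables (R : realType) (c : nat) (m : 'rV[R]_c -> R) (L : R).
Hypothesis L0 : 0 < L.
Hypothesis hL : forall x y, `|m x - m y| <= L * `|x - y|.

Lemma lipschitz_row_le (x y : 'I_c -> R) (e : R) : 0 <= e ->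
  (forall l, `|x l - y l| <= e) ->
  `|m (\row_l x l) - m (\row_l y l)| <= L * e.
Proof.
move=> e0 xy; apply: (le_trans (hL _ _)); rewrite ler_pM2l//.
rewrite [leLHS]/Num.Def.normr/= mx_normrE (bigmax_le _ e0)//= => -[i l] _.
by rewrite !mxE.
Qed.

(** [m] of a vector of measurable functions is the limit of the functions obtained
   by rounding the coordinates to multiples of [1 / k.+1], each of which takes
   countably many values. *)
Lemma measurable_lipschitz_row d (T : measurableType d) (g : 'I_c -> T -> R) :
  (forall l, measurable_fun setT (g l)) ->
  measurable_fun setT (fun w => m (\row_l g l w)).
Proof.
move=> mg.
pose G (k : nat) (w : T) : {ffun 'I_c -> int} := [ffun l => Num.floor (k.+1%:R * g l w)].
pose m_ (k : nat) (z : {ffun 'I_c -> int}) : R := m (\row_l ((z l)%:~R / k.+1%:R)).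
apply: (@measurable_fun_cvg _ _ _ _ (fun k w => m_ k (G k w))) => [k|w _].
  have mG z : measurable (G k @^-1` [set z]).
    rewrite (_ : _ @^-1` _ = \bigcap_(l in [set: 'I_c])
        ((fun w => k.+1%:R * g l w) @^-1` `[(z l)%:~R, (z l + 1)%:~R[)).
      apply: fin_bigcap_measurable => // l _; rewrite -[_ @^-1` _]setTI.
      have mkg : measurable_fun setT (fun w => k.+1%:R * g l w) by exact: measurable_funM.
      by apply: mkg => //; exact: measurable_itv.
    apply/seteqP; split=> w /= h.
      move=> l _ /=; rewrite in_itv/=; move/ffunP: h => /(_ l); rewrite ffunE => <-.
      exact: floor_itv.
    apply/ffunP => l; rewrite ffunE; apply: floor_def.
    by have := h l I; rewrite /= in_itv.
  move=> _ Y mY; rewrite setTI.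
  rewrite (_ : _ @^-1` _ = \bigcup_(z in setT)
      (if m_ k z \in Y then G k @^-1` [set z] else set0)).
    apply: countable_bigcupT_measurable; first exact: countableP.
    by move=> z; case: ifP.
  apply/seteqP; split=> [w /= h|w [z _]].
    by exists (G k w) => //; rewrite ifT//; exact/mem_set.
  by case: ifPn => // /set_mem h /= ->.
apply/cvgrPdist_le => e e0; near=> k.
have k0 : (0 : R) < k.+1%:R by [].
rewrite /m_; apply: (@le_trans _ _ (L * k.+1%:R^-1)).
  apply: lipschitz_row_le; first by rewrite invr_ge0.
  move=> l; rewrite ffunE; set u := k.+1%:R * _.
  have -> : g l w = u / k.+1%:R by rewrite /u mulrAC divff ?mul1r// gt_eqF.
  rewrite -mulrBl normrM (gtr0_norm (x := _^-1)) ?invr_gt0//.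
  rewrite ler_piMl ?invr_ge0//.
  have := floor_itv u; rewrite intrD; move: (Num.floor u)%:~R => z /andP[z1 z2].
  by rewrite ger0_norm ?subr_ge0//; move: z1 z2; rewrite /=; lra.
rewrite ler_pdivrMr//; rewrite mulrC -ler_pdivrMr//.
apply: (@le_trans _ _ k%:R); last by rewrite ler_nat.
by near: k; exact: nbhs_infty_ger.
Unshelve. all: by end_near. Qed.

End lipschitz.

Section functional.
Variables (R : realType) (c K : nat) (p : 'cV[R]_c) (phi : R -> R).
Variables (m : 'rV[R]_c -> R) (L : R).
Hypothesis L0 : 0 < L.
Hypothesis hL : forall x y, `|m x - m y| <= L * `|x - y|.

Notation KRL := ('I_K * 'I_2 * 'I_c)%type.

Definition weighted_squares (x : KRL -> R) (l : 'I_c) : R :=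
  p l 0 * \sum_(k < K) \sum_(r < 2) 2^-1 * chebyshev_coef phi k.+1 * x (k, r, l) ^+ 2.

Let W : R := \sum_l `|p l 0| * \sum_(k < K) \sum_(r < 2) `|2^-1 * chebyshev_coef phi k.+1|.

Let W0 : 0 <= W.
Proof.
apply: sumr_ge0 => l _; apply: mulr_ge0 => //.
by apply: sumr_ge0 => k _; apply: sumr_ge0.
Qed.

Let squares_close (x y : KRL -> R) (D : R) l :
  0 <= D -> (forall i, `|x i ^+ 2 - y i ^+ 2| <= D) ->
  `|weighted_squares x l - weighted_squares y l| <= W * D.
Proof.
move=> D0 hD; rewrite /weighted_squares -mulrBr normrM.
apply: (@le_trans _ _ (`|p l 0| * (\sum_(k < K) \sum_(r < 2)
    `|2^-1 * chebyshev_coef phi k.+1|) * D)).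
  rewrite -mulrA ler_wpM2l// -sumrB mulr_suml.
  apply: (le_trans (ler_norm_sum _ _ _)); apply: ler_sum => k _.
  rewrite -sumrB mulr_suml.
  apply: (le_trans (ler_norm_sum _ _ _)); apply: ler_sum => r _.
  by rewrite -mulrBr normrM ler_wpM2l.
rewrite ler_wpM2r// /W (bigD1 l)//= lerDl; apply: sumr_ge0 => l' _.
by apply: mulr_ge0 => //; apply: sumr_ge0 => k _; apply: sumr_ge0.
Qed.

(** Squares are Lipschitz on bounded sets only, and [h] is uniformly continuous
   on segments only. *)
Lemma weighted_squares_uniformly_continuous (h : R -> R) : continuous h ->
  uniformly_continuous_on_bounded (fun x : KRL -> R => h (m (\row_l weighted_squares x l))).
Proof.
move=> ch M e e0.
pose z : R := m (\row_l weighted_squares (fun=> 0) l).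
pose A : R := `|z| + L * (W * M ^+ 2).
have [eta eta0 heta] := heine_cantor (- A) A ch e0.
have D0 : 0 < L * (W * (2 * `|M|)) + 1.
  by rewrite ltr_wpDl// !mulr_ge0// ltW.
exists (eta / (L * (W * (2 * `|M|)) + 1)); first by rewrite divr_gt0.
move=> x y hx hy hxy; apply: heta.
  rewrite -ler_norml; apply: (@le_trans _ _ (`|z| + `|m (\row_l weighted_squares x l) - z|)).
    by rewrite -{1}[m _](subrK z) addrC ler_normD.
  rewrite lerD2l; apply: (lipschitz_row_le L0 hL); first by rewrite mulr_ge0// sqr_ge0.
  move=> l; apply: squares_close; first exact: sqr_ge0.
  move=> i; rewrite expr0n subr0 normrX ler_pXn2r ?nnegrE//.
  exact: le_trans (normr_ge0 _) (hx i).
apply: (@le_trans _ _ (L * (W * (2 * `|M| * (eta / (L * (W * (2 * `|M|)) + 1)))))).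
  have de0 : 0 <= 2 * `|M| * (eta / (L * (W * (2 * `|M|)) + 1)).
    by apply: mulr_ge0; [exact: mulr_ge0|rewrite divr_ge0// ltW].
  apply: (lipschitz_row_le L0 hL); first by rewrite mulr_ge0.
  move=> l; apply: squares_close => // i.
  rewrite subr_sqr normrM mulrC; apply: ler_pM => //.
  apply: (le_trans (ler_normD _ _)); rewrite [leRHS]mulr_natl mulr2n.
  by apply: lerD; [apply: le_trans (hx i) _|apply: le_trans (hy i) _]; exact: ler_norm.
rewrite [leLHS](_ : _ = eta * (L * (W * (2 * `|M|)) / (L * (W * (2 * `|M|)) + 1))).
  by rewrite ler_piMr ?(ltW eta0)// ler_pdivrMr// mul1r lerDl.
by field; rewrite gt_eqF.
Qed.

End functional.

(** * The truncated statistic *)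

Lemma truncated_statisticE (R : realType) (c K : nat) (n : nat -> 'I_c -> nat)
    (p : 'cV[R]_c) (phi : R -> R) (m : 'rV[R]_c -> R)
    (d : nat -> measure_display) (T : forall v, measurableType (d v))
    (P : forall v, probability (T v) R)
    (Theta : forall v (l : 'I_c), 'I_(n v l) -> {RV (P v) >-> R}) v (w : T v) :
  (forall v, (0 < pooled_size (n v))%N) -> (forall l, 0 < p l 0) ->
  truncated_statistic (fun l i => Theta v l i w) phi m K =
  m (\row_l weighted_squares p phi (fun i : 'I_K * 'I_2 * 'I_c => scaled_mean p Theta i w) l).
Proof.
move=> N0 p0; congr m; apply/rowP => l; rewrite !mxE /weighted_squares mulr_sumr.
apply: eq_bigr => k _; rewrite mulr_sumr; apply: eq_bigr => r _.
rewrite /scaled_mean /fraction_scale /=; move: (score_mean _ _ _ _) => G; rewrite !exprMn.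
have N0R : (0 : R) < (pooled_size (n v))%:R by rewrite ltr0n.
rewrite !sqr_sqrtr ?divr_ge0 ?(ltW (p0 l)) ?(ltW N0R)//.
by field; rewrite !gt_eqF.
Qed.

Theorem theorem6p2 (R : realType) (c K : nat) (hc : (2 <= c)%N)
  (hK : (1 <= K)%N)
  (* underlying density, shifts and kernel *)
  (f : R -> R) (hf : C1_circular_density f)
  (delta : 'cV[R]_c)
  (phi : R -> R) (hphi : chebyshev_kernel phi)
  (* sup-norm Lipschitz map: the norm of 'rV[R]_c is the sup norm *)
  (m : 'rV[R]_c -> R)
  (hm : exists2 L : R, 0 < L & forall x y, `|m x - m y| <= L * `|x - y|)
  (* sample sizes along a sequence of designs indexed by v *)
  (n : nat -> 'I_c -> nat)
  (hn : forall v l, (2 <= n v l)%N)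
  (hN : pooled_size (n v) @[v --> \oo] --> \oo)
  (p : 'cV[R]_c)
  (hp01 : forall l, 0 < p l 0 < 1)
  (hp : forall l,
    (n v l)%:R / (pooled_size (n v))%:R @[v --> \oo] --> p l 0)
  (* samples under the local alternatives *)
  (d : nat -> measure_display) (T : forall v, measurableType (d v))
  (P : forall v, probability (T v) R)
  (Theta : forall v (l : 'I_c), 'I_(n v l) -> {RV (P v) >-> R})
  (hTheta : forall v l (i : 'I_(n v l)),
    has_circular_density (Theta v l i)
      (fun x => f (x + delta l 0 / Num.sqrt (pooled_size (n v))%:R)))
  (hindep : forall v, mutually_independent
    (fun j : {l : 'I_c & 'I_(n v l)} => Theta v (tag j) (tagged j)))
  (* the Gaussian vectors *)
  (d' : measure_display) (T' : measurableType d') (Q : probability T' R)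
  (Z : 'I_K -> 'I_2 -> {RV Q >-> c.-tuple R})
  (hZ : forall k r,
    multinormal (Z k r) (limit_mean p delta f k.+1 r) (limit_cov p))
  (hZindep : mutually_independent (fun kr : 'I_K * 'I_2 => Z kr.1 kr.2)) :
  cvg_in_distribution P
    (fun v w => truncated_statistic (fun l i => Theta v l i w) phi m K)
    Q
    (fun w => limit_statistic p phi m (fun k r => Z k r w)).
Proof.
have [L L0 hL] := hm.
have p0 l : 0 < p l 0 by have /andP[] := hp01 l.
have n0 v l : (0 < n v l)%N by exact: ltnW (hn v l).
have N0 v : (0 < pooled_size (n v))%N.
  have i0 : 'I_c by exact: Ordinal (ltnW hc).
  by rewrite /pooled_size (bigD1 i0)//= addn_gt0 n0.
pose X v (w : T v) (i : 'I_K * 'I_2 * 'I_c) := scaled_mean p Theta i w.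
pose Y (w : T') (i : 'I_K * 'I_2 * 'I_c) := tnth (Z i.1.1 i.1.2 w) i.2.
pose g (x : 'I_K * 'I_2 * 'I_c -> R) := m (\row_l weighted_squares p phi x l).
have XE v w : truncated_statistic (fun l i => Theta v l i w) phi m K = g (X v w).
  exact: truncated_statisticE.
have mg d0 (T0 : measurableType d0) (V : T0 -> 'I_K * 'I_2 * 'I_c -> R) :
    (forall i, measurable_fun setT (fun w => V w i)) ->
    measurable_fun setT (fun w => g (V w)).
  move=> mV; apply: (measurable_lipschitz_row L0 hL) => l; rewrite /weighted_squares.
  apply: measurable_funM => //.
  apply: (@measurable_sum _ _ _ _ _ _ (fun (k : 'I_K) (w : T0) => \sum_(r < 2)
    2^-1 * chebyshev_coef phi k.+1 * V w (k, r, l) ^+ 2)) => k.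
  apply: (@measurable_sum _ _ _ _ _ _ (fun (r : 'I_2) (w : T0) =>
    2^-1 * chebyshev_coef phi k.+1 * V w (k, r, l) ^+ 2)) => r.
  by apply: measurable_funM => //; exact: measurable_funX.
have bX v i : bdd_meas [set: T v] (fun w => X v w i) by exact: bdd_meas_scaled_mean.
have mX v i : measurable_fun [set: T v] (fun w => X v w i) by exact: (bX v i).1.
have mY i : measurable_fun setT (fun w => Y w i) by exact: measurable_coord.
have mgX v : measurable_fun setT (fun w => g (X v w)) by exact: mg.
have mgY : measurable_fun setT (fun w => g (Y w)) by exact: mg.
split => [v||h ch [B hB]].
- rewrite (_ : (fun w => _) = fun w => g (X v w)); first exact: mgX.
  by apply/funext => w; rewrite XE.
- exact: mgY.
have mh : measurable_fun setT h by exact: continuous_measurable_fun.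
have hcos b t : \int[P v]_w cos (b + \sum_i t i * X v w i) @[v --> \oo] -->
    \int[Q]_w cos (b + \sum_i t i * Y w i).
  rewrite (gaussian_cos p0 (prob_sum1 N0 hp) hZ hZindep).
  exact: (scaled_mean_cos_cvg hf hN n0 N0 p0 hp hTheta hindep).
have [C hC] := scaled_mean_tight K hf hN n0 N0 p0 hp hTheta hindep.
have uc : uniformly_continuous_on_bounded (fun x => h (g x)).
  exact: (weighted_squares_uniformly_continuous K p phi L0 hL ch).
have lim : \int[P v]_w h (g (X v w)) @[v --> \oo] --> \int[Q]_w h (g (Y w)).
  apply: (weak_convergence mX mY hcos bX hC (fun x => hB (g x)) uc).
    by move=> v; exact: measurableT_comp.
  exact: measurableT_comp.
have bhX v : bdd_meas setT (fun w => h (g (X v w))).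
  by split; [exact: measurableT_comp|exists B].
have bhY : bdd_meas setT (fun w => h (g (Y w))).
  by split; [exact: measurableT_comp|exists B].
rewrite (_ : ('E_Q[_])%E = (\int[Q]_w h (g (Y w)))%:E)%E; last first.
  exact: expectation_Rintegral.
have EX v : ('E_(P v)[h \o (fun w => truncated_statistic (fun l i => Theta v l i w) phi m K)] =
    (\int[P v]_w h (g (X v w)))%:E)%E.
  rewrite -expectation_Rintegral//; congr expectation.
  by apply/funext => w /=; rewrite XE.
under eq_fun do rewrite EX.
by apply: cvg_EFin; [exact: nearW|exact: lim].
Qed.
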